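(* Let $w=(w_k)_{k\ge0}$ be a weight sequence with $w_k\sim ck^{-\beta}$ as $k\to\infty$ for some $c>0$ and $\beta>2$. Then $\nu<\infty$. Suppose further $m/n\to\lambda>\nu$. Let $\alpha=\beta-1>1$ and $c'=c/\Phi(1)$. (i) $Y_{(1)}=(\lambda-\nu)n+o_p(n)$ and $Y_{(2)}=o_p(n)$. (ii) $Z(m,n)\sim c(\lambda-\nu)^{-\beta}\Phi(1)^{n-1}n^{1-\beta}$. (iii) $(Y_{(1)},Y_{(2)},\dots,Y_{(n)})\approx_d\big(m-\sum_{i=1}^{n-1}\xi_i,\ \xi_{(1)},\dots,\xi_{(n-1)}\big)$, where $\xi_1,\dots,\xi_{n-1}$ are i.i.d. with $P(\xi_i=k)=w_k/\Phi(1)$ and $\xi_{(1)}\ge\dots\ge\xi_{(n-1)}$ are these variables ordered decreasingly. (iv) $Y_{(1)}=m-\nu n+O_p(n^{1/\alpha})$ and $n^{-1/\alpha}(m-\nu n-Y_{(1)})\to X_\alpha$ in distribution, where $X_\alpha$ is an $\alpha$-stable random variable with $E e^{-tX_\alpha}=\exp(c'\Gamma(-\alpha)t^\alpha)$ for $\mathrm{Re}\,t\ge0$. (v) $Y_{(2)}=O_p(n^{1/\alpha})$ and $n^{-1/\alpha}Y_{(2)}\to W$ in distribution, where $P(W\le x)=\exp(-\frac{c'}{\alpha}x^{-\alpha})$, $x\ge0$. (vi) More generally, for each $j\ge2$, $Y_{(j)}=O_p(n^{1/\alpha})$ and $n^{-1/\alpha}Y_{(j)}\to W_j$ in distribution,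 where $W_j$ has density $c'x^{-\alpha-1}\frac{(c'\alpha^{-1}x^{-\alpha})^{j-2}}{(j-2)!}\exp(-c'\alpha^{-1}x^{-\alpha})$, $x\ge0$, and $c'\alpha^{-1}W_j^{-\alpha}$ has the Gamma$(j-1,1)$ distribution.
   Context: A weight sequence is a sequence $w=(w_k)_{k\ge0}$ of nonnegative reals. $\Phi(t)=\sum_kw_kt^k$ (radius of convergence $\rho=1$), $\Psi(t)=t\Phi'(t)/\Phi(t)$, $\nu=\Psi(\rho)$. Balls-in-boxes: $\mathcal B_{m,n}=\{(y_1,\dots,y_n)\in\{0,1,\dots\}^n:\sum y_i=m\}$, weight $w(y)=\prod_iw_{y_i}$, $Z(m,n)=\sum_{y\in\mathcal B_{m,n}}w(y)$; when $Z(m,n)>0$, $B_{m,n}=(Y_1,\dots,Y_n)$ is random with $P(B_{m,n}=y)=w(y)/Z(m,n)$ (only $m,n$ with $Z(m,n)>0$ are considered). $Y_{(1)}\ge\dots\ge Y_{(n)}$ denote $Y_1,\dots,Y_n$ in decreasing order. For random vectors $X_n,X_n'$, $X_n\approx_dX_n'$ means that there is a coupling with $X_n=X_n'$ with probability tending to $1$ (equivalently, total variation distance tends to $0$).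
   Formalization: Part (iv) is proved for 2<β<3 only, since for β≥3 it fails (Γ(-2) is a pole; fluctuations are of order at least √n, not n^{1/α}); the Laplace identity for X_α is stated for real t≥0, and extends to Re t≥0 by analytic continuation. *)

(* Defs.v *)
From HB Require Import structures.
From mathcomp Require Import all_boot all_order all_algebra.
From mathcomp Require Import all_classical all_reals all_analysis.
Set Implicit Arguments. Unset Strict Implicit. Unset Printing Implicit Defensive.
Import Order.TTheory GRing.Theory Num.Theory.
Import numFieldNormedType.Exports.
Local Open Scope classical_set_scope.
Local Open Scope ring_scope.

Section Defs.
Variable R : realType.

Definition Phi (w : nat -> R) (t : R) : R :=
  limn (series (fun k => w k * t ^+ k)).

Definition Phi1 (w : nat -> R) : R := Phi w 1.

Definition Psi (w : nat -> R) (t : R) : R := t * (derive1 (Phi w) t) / Phi w t.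

(* Balls-in-boxes: configurations y in B_{m,n}.  Every y in B_{m,n} has all
   entries <= m, so B_{m,n} is exactly the set of y : {ffun 'I_n -> 'I_m.+1}
   with sum m. *)
Definition inBB (m n : nat) (y : {ffun 'I_n -> 'I_m.+1}) : bool :=
  (\sum_(i < n) (y i : nat))%N == m.

Definition BBvec (m n : nat) (y : {ffun 'I_n -> 'I_m.+1}) : seq nat :=
  [seq (y i : nat) | i <- enum 'I_n].

Definition BBweight (w : nat -> R) (m n : nat) (y : {ffun 'I_n -> 'I_m.+1}) : R :=
  \prod_(i < n) w (y i).

Definition Zmn (w : nat -> R) (m n : nat) : R :=
  \sum_(y : {ffun 'I_n -> 'I_m.+1} | inBB y) BBweight w y.

Definition BBprob (w : nat -> R) (m n : nat) (A : pred (seq nat)) : R :=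
  (\sum_(y : {ffun 'I_n -> 'I_m.+1} | inBB y && A (BBvec y)) BBweight w y)
    / Zmn w m n.

Definition ordstat (s : seq nat) (j : nat) : nat := nth 0%N (sort geq s) j.-1.

Definition ordvec (s : seq nat) : seq int := map Posz (sort geq s).

Definition xivec (m n : nat) (xi : {ffun 'I_n.-1 -> nat}) : seq int :=
  (Posz m - Posz (\sum_(i < n.-1) xi i)%N)
    :: map Posz (sort geq [seq xi i | i <- enum 'I_n.-1]).

Definition Qxi (w : nat -> R) (m n : nat) (A : pred (seq int)) : R :=
  fine (\esum_(xi in [set xi : {ffun 'I_n.-1 -> nat} | A (@xivec m n xi)])
          (\prod_(i < n.-1) (w (xi i) / Phi1 w))%:E)%E.

Definition cvg_prob0 (P : nat -> pred (seq nat) -> R) (X : nat -> seq nat -> R) :=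
  forall eps : R, 0 < eps ->
    (fun k => P k [pred s | eps < `|X k s|]) @ \oo --> (0 : R).

Definition bdd_prob (P : nat -> pred (seq nat) -> R) (X : nat -> seq nat -> R) :=
  forall eps : R, 0 < eps -> exists M : R,
    \forall k \near \oo, P k [pred s | M < `|X k s|] < eps.

Definition cvg_dist (P : nat -> pred (seq nat) -> R) (X : nat -> seq nat -> R)
    (F : R -> R) :=
  forall x : R, {for x, continuous F} ->
    (fun k => P k [pred s | X k s <= x]) @ \oo --> F x.

Definition prob_cdf (mu : probability R R) (x : R) : R := fine (mu [set y : R | y <= x]).

(* Euler Gamma function: integral for s > 0, extended to non-integer s <= 0
   by the functional equation Gamma(s) = Gamma(s+N) / (s (s+1) ... (s+N-1)). *)
Definition GammaInt (s : R) : R :=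
  Rintegral lebesgue_measure [set x : R | 0 < x] (fun x => x `^ (s - 1) * expR (- x)).
Definition GammaR (s : R) : R :=
  let N := if 0 < s then 0%N else (Num.truncn (- s)).+1 in
  GammaInt (s + N%:R) / \prod_(i < N) (s + i%:R).

Definition FrechetCDF (c' alpha x : R) : R :=
  if 0 < x then expR (- (c' / alpha) * x `^ (- alpha)) else 0.

Definition Wdens (c' alpha : R) (j : nat) (x : R) : R :=
  if 0 < x then
    c' * x `^ (- alpha - 1) * (c' / alpha * x `^ (- alpha)) ^+ (j - 2)
      / ((j - 2)`!)%:R * expR (- (c' / alpha) * x `^ (- alpha))
  else 0.

Definition WjCDF (c' alpha : R) (j : nat) (x : R) : R :=
  Rintegral lebesgue_measure [set t : R | 0 <= t <= x] (Wdens c' alpha j).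

(* density of Gamma(a,1) with a = j - 1 a positive integer *)
Definition GammaDens (j : nat) (t : R) : R :=
  if 0 <= t then t ^+ (j - 2) * expR (- t) / ((j - 2)`!)%:R else 0.

End Defs.

(* Main.v *)
(** Write p_k = w_k / Phi(1), so that the xi_i are i.i.d. with law p, mean nu and a
    tail c' k^(-beta), and Z(m,n) = Phi(1)^n P(S_n = m).  Since m ~ lam n with
    lam > nu, the event {S_n = m} is realised by a single big jump: a Chernoff bound
    makes the contribution of vectors with all entries at most eta n negligible with
    respect to n^(1-beta), and if the other n-1 entries are typical (sum close to
    nu n, maximum at most eta n), the largest entry is m - S_(n-1), of size about
    (lam - nu) n, where p is asymptotically constant.  Summing over the n possible
    positions of the big entry gives, uniformly in A,
      P(S_n = m, Y in A) ~ n c' ((lam - nu) n)^(-beta) P((m - S_(n-1), xi_(1), ...) in A),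
    hence (ii) for A = everything and (iii) by division.  Then (i) is the law of large
    numbers, (v)-(vi) follow from the Poisson limit of the number of xi_i exceeding
    x n^(1/alpha), and (iv) is the one-sided stable limit theorem for (S_(n-1) - nu n) /
    n^(1/alpha).

    For the latter, only real Laplace transforms on t >= 0 are used.  Truncating the
    jumps from below at d n^(1/alpha) leaves an error which is small in mean square and a
    centered sum A bounded from below, for which the expectations of polynomials in
    exp(-A) converge; (1 - exp(-m(A+K)))^M approximates the indicator of a half-line, so
    the distribution functions converge.  The Laplace transform of the limit law is then
    recovered by approximating exp(-t x) by step functions. *)
Require Import Defs.
From HB Require Import structures.
From mathcomp Require Import all_boot all_order all_algebra.
From mathcomp Require Import all_classical all_reals all_analysis.
From mathcomp Require Import measurable_realfun.
From mathcomp Require Import ring lra.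
Set Implicit Arguments. Unset Strict Implicit. Unset Printing Implicit Defensive.
Import Order.TTheory GRing.Theory Num.Theory.
Import numFieldNormedType.Exports.
Local Open Scope classical_set_scope.
Local Open Scope ring_scope.

Set Implicit Arguments. Unset Strict Implicit. Unset Printing Implicit Defensive.
Import Order.TTheory GRing.Theory Num.Theory.
Import numFieldNormedType.Exports.
Local Open Scope classical_set_scope.
Local Open Scope ring_scope.

(** * Signed expectations under discrete weights *)

(** The number [nu] appears as the limit of [Psi] at 1 but is used as the mean of [p]; Abel's
    theorem, for the series of [w] and for its derivative, identifies the two. The conditioning
    event has polynomially small probability, so errors must be compared with N^(-beta) per
    position. When no entry is large, only the Chernoff bound provides such a rate: a tilt by a
    multiple of ln N / N yields any prescribed power, and [eta] has to shrink as that power grows.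
    When one entry is large, that entry supplies N^(-beta) itself, so for the others a probability
    tending to 0 without a rate is enough. In the stable limit, (S_N - nu N) / N^(1/alpha) is
    bounded below only by -nu N^(1 - 1/alpha), which tends to minus infinity, so exp(-t x) is not a
    bounded test function along the sequence; hence the truncation. No subsequence is extracted:
    between any a < b the distribution functions are shown not to oscillate, and the limit law is
    built from them. All moments come from one statement, s^alpha E h(xi / s) -> c' times the
    integral of h(y) y^(-beta); beta < 3 makes y^(2 - beta) integrable at 0. *)

Section Expectation.
Context {R : realType} {T : choiceType}.
Variable q : T -> R.

Definition summ (F : T -> R) : Prop :=
  (\esum_(x in [set: T]) `|q x * F x|%:E < +oo)%E.

(** A junk value unless [summ F]. *)
Definition Ex (F : T -> R) : R :=
  fine (\esum_(x in [set: T]) (Num.max (q x * F x) 0)%:E)%E -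
  fine (\esum_(x in [set: T]) (Num.max (- (q x * F x)) 0)%:E)%E.

Lemma eq_Ex F G : F =1 G -> Ex F = Ex G.
Proof. by move=> /funext ->. Qed.

Lemma esum_real_fin (f g : T -> R) : (forall x, 0 <= f x <= g x) ->
  (\esum_(x in [set: T]) (g x)%:E < +oo)%E ->
  (\esum_(x in [set: T]) (f x)%:E)%E \is a fin_num.
Proof.
move=> fg goo; rewrite ge0_fin_numE; last first.
  by apply: esum_ge0 => x _; rewrite lee_fin; have /andP[] := fg x.
apply: le_lt_trans goo; apply: le_esum => x _.
by rewrite lee_fin; have /andP[] := fg x.
Qed.

Hypothesis q0 : forall x, 0 <= q x.

Lemma summ_le F G : (forall x, `|F x| <= `|G x|) -> summ G -> summ F.
Proof.
move=> FG; apply: le_lt_trans; apply: le_esum => x _.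
by rewrite lee_fin !normrM ler_wpM2l.
Qed.

Lemma summD F G : summ F -> summ G -> summ (fun x => F x + G x).
Proof.
move=> sF sG.
apply: le_lt_trans (lte_add_pinfty sF sG).
rewrite -esumD//.
by apply: le_esum => x _; rewrite -EFinD lee_fin mulrDr ler_normD.
Qed.

Lemma esumZ (c : R) (f : T -> R) : 0 <= c -> (forall x, 0 <= f x) ->
  (\esum_(x in [set: T]) (c * f x)%:E = c%:E * \esum_(x in [set: T]) (f x)%:E)%E.
Proof.
move=> c0 f0; apply/eqP; rewrite eq_le; apply/andP; split.
  apply: ge_ereal_sup => _ [X [finX XT] <-].
  rewrite fsbig_finite//=; under eq_bigr do rewrite EFinM.
  rewrite -ge0_sume_distrr; last by move=> i _; rewrite lee_fin.
  rewrite lee_wpmul2l ?lee_fin//; apply: esum_ge; exists X => //.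
  by rewrite fsbig_finite.
have [->|cn0] := eqVneq c 0.
  by rewrite mul0e; apply: esum_ge0 => x _; rewrite mul0r.
have {cn0}c0 : 0 < c by rewrite lt_def cn0.
rewrite -lee_pdivlMl//.
apply: ge_ereal_sup => _ [X [finX XT] <-].
rewrite lee_pdivlMl//; apply: esum_ge; exists X => //.
rewrite !fsbig_finite//= ge0_sume_distrr; last by move=> i _; rewrite lee_fin.
by apply: lee_sum => i _; rewrite EFinM.
Qed.

Lemma summZ c F : summ F -> summ (fun x => c * F x).
Proof.
rewrite /summ => sF.
rewrite (_ : (fun x : T => `|q x * (c * F x)|%:E) = (fun x => (`|c| * `|q x * F x|)%:E)).
  by rewrite esumZ// lte_mul_pinfty// ?lee_fin.
by apply/funext => x; rewrite mulrCA normrM.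
Qed.

Lemma summN F : summ F -> summ (fun x => - F x).
Proof. by apply: summ_le => x; rewrite normrN. Qed.

Lemma summB F G : summ F -> summ G -> summ (fun x => F x - G x).
Proof. by move=> sF /summN sG; exact: summD. Qed.

Lemma summ_pos F : summ F ->
  (\esum_(x in [set: T]) (Num.max (q x * F x) 0)%:E)%E \is a fin_num.
Proof.
apply: esum_real_fin => x; rewrite le_max lexx orbT/=.
by rewrite ge_max normr_ge0 ler_norm.
Qed.

Lemma summ_neg F : summ F ->
  (\esum_(x in [set: T]) (Num.max (- (q x * F x)) 0)%:E)%E \is a fin_num.
Proof.
apply: esum_real_fin => x; rewrite le_max lexx orbT/=.
by rewrite ge_max normr_ge0 -normrN ler_norm.
Qed.

Lemma ExD F G : summ F -> summ G -> Ex (fun x => F x + G x) = Ex F + Ex G.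
Proof.
move=> sF sG; have sFG := summD sF sG.
have mx0 (r : R) : (0 <= (Num.max r 0)%:E)%E by rewrite lee_fin le_max lexx orbT.
(* The identity (u+v)^+ + u^- + v^- = (u+v)^- + u^+ + v^+ is free of subtraction, so it can be
   summed in the extended reals; finiteness is used only afterwards. *)
have H : (\esum_(x in [set: T]) (Num.max (q x * (F x + G x)) 0)%:E +
    (\esum_(x in [set: T]) (Num.max (- (q x * F x)) 0)%:E +
    \esum_(x in [set: T]) (Num.max (- (q x * G x)) 0)%:E) =
    \esum_(x in [set: T]) (Num.max (- (q x * (F x + G x))) 0)%:E +
    (\esum_(x in [set: T]) (Num.max (q x * F x) 0)%:E +
    \esum_(x in [set: T]) (Num.max (q x * G x) 0)%:E))%E.
  rewrite -!esumD//; try by move=> x _; rewrite ?adde_ge0.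
  apply: eq_esum => x _; rewrite -!EFinD; congr EFin.
  rewrite mulrDr; move: (q x * F x) (q x * G x) => u v.
  by rewrite /Num.max; do !case: ifPn; lra.
have [pF nF] := (summ_pos sF, summ_neg sF).
have [pG nG] := (summ_pos sG, summ_neg sG).
have [pFG nFG] := (summ_pos sFG, summ_neg sFG).
move/(congr1 fine): H; rewrite !fineD ?fin_numD ?pF ?nF ?pG ?nG ?pFG ?nFG// => H.
by rewrite /Ex; lra.
Qed.

Lemma Ex_nneg F : (forall x, 0 <= F x) ->
  Ex F = fine (\esum_(x in [set: T]) (q x * F x)%:E)%E.
Proof.
move=> F0; rewrite /Ex.
under eq_esum do rewrite (max_l (mulr_ge0 (q0 _) (F0 _))).
rewrite [X in _ - fine X](_ : _ = 0)%E ?subr0//.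
apply: esum1 => x _; congr EFin; apply/max_idPr.
by rewrite oppr_le0 mulr_ge0.
Qed.

Lemma summ_nnegE F : (forall x, 0 <= F x) ->
  summ F = (\esum_(x in [set: T]) (q x * F x)%:E < +oo)%E :> Prop.
Proof.
move=> F0; rewrite /summ; congr (_ < _)%E.
by apply: eq_esum => x _; rewrite ger0_norm// mulr_ge0.
Qed.

Lemma Ex_esum F : (forall x, 0 <= F x) -> summ F ->
  (\esum_(x in [set: T]) (q x * F x)%:E = (Ex F)%:E)%E.
Proof.
move=> F0 sF; rewrite Ex_nneg// fineK// ge0_fin_numE; last first.
  by apply: esum_ge0 => x _; rewrite lee_fin mulr_ge0.
by rewrite -(summ_nnegE F0).
Qed.

Lemma esum_Ex F (a : R) : (forall x, 0 <= F x) ->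
  (\esum_(x in [set: T]) (q x * F x)%:E = a%:E)%E -> summ F /\ Ex F = a.
Proof.
move=> F0 H; split; last by rewrite Ex_nneg// H.
by rewrite (summ_nnegE F0) H ltry.
Qed.

Lemma Ex_ge0 F : (forall x, 0 <= F x) -> 0 <= Ex F.
Proof.
move=> F0; rewrite Ex_nneg//; apply: fine_ge0.
by apply: esum_ge0 => x _; rewrite lee_fin mulr_ge0.
Qed.

Lemma ExN F : Ex (fun x => - F x) = - Ex F.
Proof.
rewrite /Ex opprB; congr (fine _ - fine _); apply: eq_esum => x _.
  by rewrite mulrN.
by rewrite mulrN opprK.
Qed.

Lemma ExB F G : summ F -> summ G -> Ex (fun x => F x - G x) = Ex F - Ex G.
Proof. by move=> sF sG; rewrite ExD ?ExN//; exact: summN. Qed.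

Lemma Ex_le F G : summ F -> summ G -> (forall x, F x <= G x) -> Ex F <= Ex G.
Proof.
move=> sF sG FG; rewrite -subr_ge0 -ExB//; apply: Ex_ge0 => x.
by rewrite subr_ge0.
Qed.

(** This also holds for the junk value: an infinite part has [fine] equal to 0 both before and after
    scaling. Negative c is reduced to positive c by [ExN]. *)
Lemma ExZ c F : Ex (fun x => c * F x) = c * Ex F.
Proof.
wlog c0 : c / 0 <= c => [hw|].
  have [|c0] := leP 0 c; first exact: hw.
  rewrite -[c]opprK mulNr -hw ?oppr_ge0 1?ltW// -ExN.
  by apply: eq_Ex => x; rewrite mulNr.
rewrite /Ex mulrBr.
have H (f : T -> R) : fine (\esum_(x in [set: T]) (c * Num.max (f x) 0)%:E)%E =
  c * fine (\esum_(x in [set: T]) (Num.max (f x) 0)%:E)%E.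
  rewrite esumZ//; last by move=> x; rewrite le_max lexx orbT.
  set e := (\esum_(_ in _) _)%E.
  have : (0 <= e)%E by apply: esum_ge0 => x _; rewrite lee_fin le_max lexx orbT.
  case: e => [r _ //|_|//]; rewrite /= mulr0.
  by rewrite mulry /Num.sg; case: ifP => // _; rewrite ?mul0e// ltNge c0 mul1e.
rewrite -!H; congr (fine _ - fine _); apply: eq_esum => x _; congr EFin.
  by rewrite maxr_pMr// mulr0 mulrCA.
by rewrite maxr_pMr// mulr0 mulrN mulrCA.
Qed.

Lemma Ex_sum (I : Type) (r : seq I) (P : pred I) (F : I -> T -> R) :
  (forall i, P i -> summ (F i)) ->
  summ (fun x => \sum_(i <- r | P i) F i x) /\
  Ex (fun x => \sum_(i <- r | P i) F i x) = \sum_(i <- r | P i) Ex (F i).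
Proof.
move=> sF; elim: r => [|i r [sr Er]].
  have s0 : summ (fun=> 0).
    rewrite /summ esum1 ?ltry// => x _; by rewrite mulr0 normr0.
  rewrite big_nil; split.
    by apply: summ_le s0 => x; rewrite big_nil.
  under eq_Ex do rewrite big_nil -(mul0r 0).
  by rewrite ExZ mul0r.
rewrite big_cons; under eq_Ex do rewrite big_cons.
split.
  apply: (@summ_le _ (fun x => if P i then F i x + \sum_(j <- r | P j) F j x
     else \sum_(j <- r | P j) F j x)); first by move=> x; rewrite big_cons.
  by case: (boolP (P i)) => // Pi; apply: summD => //; exact: sF.
case: ifPn => Pi; last exact: Er.
by rewrite ExD// ?Er//; exact: sF.
Qed.

Hypothesis q1 : (\esum_(x in [set: T]) (q x)%:E = 1)%E.

Lemma summ_bd F C : (forall x, `|F x| <= C) -> summ F.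
Proof.
move=> FC; apply: (@summ_le _ (fun=> C)).
  by move=> x; apply: le_trans (FC x) (ler_norm _).
rewrite /summ (_ : (fun x : T => `|q x * C|%:E) = (fun x => (`|C| * q x)%:E)).
  by rewrite esumZ// q1 mule1 ltry.
by apply/funext => x; rewrite normrM (ger0_norm (q0 x)) mulrC.
Qed.

Lemma Ex_cst c : Ex (fun=> c) = c.
Proof.
rewrite -[X in Ex (fun=> X)]mulr1 ExZ Ex_nneg//.
by under eq_esum do rewrite mulr1; rewrite q1 mulr1.
Qed.

Lemma summ_nat (A : pred T) : summ (fun x => (A x)%:R).
Proof. by apply: (@summ_bd _ 1) => x; case: (A x); rewrite ?normr1 ?normr0. Qed.

Definition Prq (A : pred T) : R := Ex (fun x => (A x)%:R).

Lemma Prq_ge0 A : 0 <= Prq A.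
Proof. by apply: Ex_ge0 => x. Qed.

Lemma Prq_le (A B : pred T) : (forall x, A x -> B x) -> Prq A <= Prq B.
Proof.
move=> AB; apply: Ex_le; [exact: summ_nat|exact: summ_nat|move=> x].
by rewrite ler_nat; move: (AB x); case: (A x); case: (B x) => // /(_ isT).
Qed.

Lemma Prq_le1 A : Prq A <= 1.
Proof. by rewrite -[leRHS](Ex_cst 1); apply: (@Prq_le _ xpredT). Qed.

Lemma PrqC (A : pred T) : Prq (fun x => ~~ A x) = 1 - Prq A.
Proof.
rewrite -[X in X - _](Ex_cst 1) -ExB; [|exact: (summ_nat xpredT)|exact: summ_nat].
by apply: eq_Ex => x; case: (A x); rewrite ?subrr ?subr0.
Qed.

Lemma Prq_or (A B : pred T) : Prq (fun x => A x || B x) <= Prq A + Prq B.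
Proof.
rewrite -ExD; [|exact: summ_nat|exact: summ_nat].
apply: Ex_le; [exact: summ_nat|by apply: summD; exact: summ_nat|move=> x].
by case: (A x); case: (B x) => /=; lra.
Qed.

Lemma Prq_union (A B C : pred T) : (forall x, A x -> B x || C x) -> Prq A <= Prq B + Prq C.
Proof. by move=> /Prq_le h; exact: le_trans (Prq_or _ _). Qed.

Lemma eq_Prq A B : A =1 B -> Prq A = Prq B.
Proof. by move=> AB; apply: eq_Ex => x; rewrite AB. Qed.

Lemma Prq_markov (A : pred T) F : summ F -> (forall x, (A x)%:R <= F x) -> Prq A <= Ex F.
Proof. by move=> sF AF; apply: Ex_le => //; exact: summ_nat. Qed.

End Expectation.

(** * Independent coordinates as product weights on finite functions *)

Section Product.
Context {R : realType}.

(** The other N coordinates keep their order through [lift i]. Summing over pairs of a remainder and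
    a value is what allows conditioning on the position of the large entry. *)
Definition ins N (i : 'I_N.+1) (k : nat) (xi : {ffun 'I_N -> nat}) :
  {ffun 'I_N.+1 -> nat} :=
  [ffun j => if unlift i j is Some j' then xi j' else k].

Lemma ins_at N (i : 'I_N.+1) k xi : ins i k xi i = k.
Proof. by rewrite ffunE unlift_none. Qed.

Lemma ins_lift N (i : 'I_N.+1) k xi j : ins i k xi (lift i j) = xi j.
Proof. by rewrite ffunE liftK. Qed.

Lemma ins_bij N (i : 'I_N.+1) :
  set_bij [set: {ffun 'I_N -> nat} * nat] [set: {ffun 'I_N.+1 -> nat}]
    (fun z => ins i z.2 z.1).
Proof.
split => //.
  move=> [x k] [y l] _ _ /= /ffunP E; congr pair.
    by apply/ffunP => j; have := E (lift i j); rewrite !ins_lift.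
  by have := E i; rewrite !ins_at.
move=> y _; exists ([ffun j => y (lift i j)], y i) => //=.
apply/ffunP => j; rewrite ffunE; case: unliftP => [j' ->|->] //.
by rewrite ffunE.
Qed.

Lemma esum_slice N (i : 'I_N.+1) (f : {ffun 'I_N.+1 -> nat} -> \bar R) :
  (forall y, 0 <= f y)%E ->
  (\esum_(y in [set: {ffun 'I_N.+1 -> nat}]) f y =
   \esum_(xi in [set: {ffun 'I_N -> nat}]) \esum_(k in [set: nat]) f (ins i k xi))%E.
Proof.
move=> f0; rewrite esum_esum//.
rewrite (reindex_esum [set: {ffun 'I_N -> nat} * nat] _ (fun z => ins i z.2 z.1))//.
  by congr esum; apply/seteqP; split.
exact: ins_bij.
Qed.

(** Tonelli, one coordinate at a time: splitting off [ord0] turns the sum over functions into an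
    iterated sum of a product. *)
Lemma esum_prod N (g : 'I_N -> nat -> R) (G : 'I_N -> R) :
  (forall i k, 0 <= g i k) ->
  (forall i, \esum_(k in [set: nat]) (g i k)%:E = (G i)%:E)%E ->
  (\esum_(xi in [set: {ffun 'I_N -> nat}]) (\prod_i g i (xi i))%:E
   = (\prod_i G i)%:E)%E.
Proof.
elim: N g G => [|N IH] g G g0 gG.
  rewrite big_ord0 (_ : [set: {ffun 'I_0 -> nat}] = [set [ffun=> 0%N]]).
    by rewrite esum_set1 big_ord0 ?lee_fin.
  by apply/seteqP; split=> // x _; apply/ffunP; case.
rewrite (esum_slice ord0); last by move=> y; rewrite lee_fin prodr_ge0.
have G0 i : 0 <= G i by rewrite -lee_fin -gG esum_ge0// => k _; rewrite lee_fin.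
rewrite big_ord_recl EFinM.
rewrite -(IH (fun i => g (lift ord0 i)) (fun i => G (lift ord0 i)))//.
rewrite -esumZ//; last by move=> xi; exact: prodr_ge0.
apply: eq_esum => xi _; rewrite mulrC EFinM -gG -esumZ//; last exact: prodr_ge0.
apply: eq_esum => k _; rewrite big_ord_recl ins_at mulrC; congr (_ * _)%:E.
by apply: eq_bigr => i _; rewrite ins_lift.
Qed.

Variable p : nat -> R.
Hypothesis p0 : forall k, 0 <= p k.
Hypothesis p1 : (\esum_(k in [set: nat]) (p k)%:E = 1)%E.

Definition Qn N (xi : {ffun 'I_N -> nat}) : R := \prod_i p (xi i).

Lemma Qn_ge0 N (xi : {ffun 'I_N -> nat}) : 0 <= Qn xi.
Proof. exact: prodr_ge0. Qed.

Lemma Qn_sum1 N : (\esum_(xi in [set: {ffun 'I_N -> nat}]) (Qn xi)%:E = 1)%E.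
Proof. by rewrite (@esum_prod N (fun=> p) (fun=> 1)) ?big1. Qed.

Lemma Ex_prod N (g : 'I_N -> nat -> R) : (forall i k, 0 <= g i k) ->
  (forall i, summ p (g i)) ->
  summ (@Qn N) (fun xi => \prod_i g i (xi i)) /\
  Ex (@Qn N) (fun xi => \prod_i g i (xi i)) = \prod_i Ex p (g i).
Proof.
move=> g0 sg; apply: esum_Ex.
- by move=> xi; exact: Qn_ge0.
- by move=> xi; exact: prodr_ge0.
under eq_esum do rewrite -big_split/=.
apply: (@esum_prod _ (fun i k => p k * g i k)).
  by move=> i k; rewrite mulr_ge0.
by move=> i; rewrite Ex_esum.
Qed.

Lemma Ex_exp N (g : nat -> R) : (forall k, 0 <= g k) -> summ p g ->
  summ (@Qn N) (fun xi => \prod_i g (xi i)) /\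
  Ex (@Qn N) (fun xi => \prod_i g (xi i)) = Ex p g ^+ N.
Proof.
move=> g0 sg; have [s E] := @Ex_prod N (fun=> g) (fun=> g0) (fun=> sg).
by rewrite E prodr_const card_ord.
Qed.

Lemma Qn_ins N (i : 'I_N.+1) k (xi : {ffun 'I_N -> nat}) :
  Qn (ins i k xi) = p k * Qn xi.
Proof.
rewrite /Qn (bigD1_ord i)//= ins_at; congr (_ * _).
by apply: eq_bigr => j _; rewrite ins_lift.
Qed.

Lemma sum_ins N (i : 'I_N.+1) k (xi : {ffun 'I_N -> nat}) :
  (\sum_j ins i k xi j = k + \sum_j xi j)%N.
Proof.
rewrite (bigD1_ord i)//= ins_at; congr (_ + _)%N.
by apply: eq_bigr => j _; rewrite ins_lift.
Qed.

(** Under the constraint on the sum, coordinate [i] is determined by the others, so the inner sum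
    over its value has at most one nonzero term, and none when the others already exceed m. *)
Lemma Prq_slice N (i : 'I_N.+1) (m : nat) (B : pred {ffun 'I_N.+1 -> nat}) :
  Prq (@Qn N.+1) (fun y => (\sum_j y j == m)%N && B y) =
  Ex (@Qn N) (fun xi => if (\sum_j xi j <= m)%N then
    p (m - \sum_j xi j) * (B (ins i (m - \sum_j xi j) xi))%:R else 0).
Proof.
rewrite /Prq Ex_nneg//; last by move=> y; exact: Qn_ge0.
rewrite [RHS]Ex_nneg//; first last.
- by move=> xi; case: ifP => // _; rewrite mulr_ge0.
- by move=> y; exact: Qn_ge0.
congr fine; rewrite (esum_slice i); last first.
  by move=> y; rewrite lee_fin mulr_ge0// Qn_ge0.
apply: eq_esum => xi _.
under eq_esum do rewrite Qn_ins sum_ins.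
set s := (\sum_j xi j)%N.
case: leqP => sm; last first.
  rewrite mulr0; apply: esum1 => k _.
  by rewrite gtn_eqF ?mulr0// (leq_trans sm)// leq_addl.
rewrite mulrA [Qn xi * _]mulrC.
rewrite -[RHS](@esum_set1 _ _ (m - s)%N (fun k => (p k * Qn xi * (B (ins i k xi))%:R)%:E));
  last by rewrite lee_fin !mulr_ge0// Qn_ge0.
rewrite [RHS]esum_mkcond; apply: eq_esum => k _.
case: ifPn => [/set_mem/= ->|/negP ks]; first by rewrite subnK// eqxx.
have {}ks : k <> (m - s)%N by move=> kE; apply: ks; rewrite kE; apply/mem_set.
case: eqP => [mE|_]; last by rewrite mulr0.
by case: ks; rewrite -mE addnK.
Qed.

(** The embedding [e] of bounded configurations reaches every vector of sum m, because no entry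
    exceeds the sum. A finite weighted count thus becomes a probability for i.i.d. entries. *)
Lemma BB_Prq (n m : nat) (A : pred (seq nat)) :
  \sum_(y : {ffun 'I_n -> 'I_m.+1} | inBB y && A (BBvec y)) \prod_(i < n) p (y i) =
  Prq (@Qn n) (fun y => (\sum_j y j == m)%N && A [seq y i | i <- enum 'I_n]).
Proof.
set D := [set y : {ffun 'I_n -> 'I_m.+1} | inBB y && A (BBvec y)].
pose e (y : {ffun 'I_n -> 'I_m.+1}) : {ffun 'I_n -> nat} := [ffun i => y i : nat].
rewrite /Prq Ex_nneg//; last by move=> y; exact: Qn_ge0.
rewrite -[LHS]/(fine (_%:E)); congr fine.
transitivity (\esum_(y in D) (Qn (e y))%:E)%E.
  rewrite esum_fset; [|exact: finite_finset|by move=> y _; rewrite lee_fin Qn_ge0].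
  have nidx (y : {ffun 'I_n -> 'I_m.+1}) : inBB y && A (BBvec y) ->
    y \notin index_enum {ffun 'I_n -> 'I_m.+1} -> (\prod_(i < n) p (y i))%:E = 0%E.
    by move=> _; rewrite mem_index_enum.
  rewrite -sumEFin (bigfs _ (index_enum_uniq _) nidx).
  apply: eq_fsbigr => y _; congr EFin.
  by apply: eq_bigr => i _; rewrite ffunE.
have einj : set_inj D e.
  move=> y z _ _ /ffunP yz; apply/ffunP => i; apply/val_inj.
  by have := yz i; rewrite !ffunE.
rewrite -(esum_image D e (fun x => (Qn x)%:E))// esum_mkcond.
apply: eq_esum => x _.
case: (boolP (x \in e @` D)) => [|xD].
  rewrite inE => -[y /andP[ym Ay] <-].
  suff -> : (\sum_j e y j == m)%N && A [seq e y i | i <- enum 'I_n] by rewrite mulr1.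
  apply/andP; split.
    move: ym; rewrite /inBB => /eqP <-; apply/eqP.
    by apply: eq_bigr => i _; rewrite ffunE.
  move: Ay; rewrite /BBvec; congr (is_true (A _)).
  by apply: eq_map => i; rewrite ffunE.
case: andP => [[/eqP xm Ax]|_]; last by rewrite mulr0.
case/negP: xD; rewrite inE /=.
have xle i : (x i < m.+1)%N by rewrite ltnS -xm (bigD1 i)//= leq_addr.
exists [ffun i => Ordinal (xle i)]; last by apply/ffunP => i; rewrite !ffunE.
rewrite /D /=; apply/andP; split.
  by apply/eqP; rewrite -[RHS]xm; apply: eq_bigr => i _; rewrite ffunE.
move: Ax; rewrite /BBvec; congr (is_true (A _)).
by apply: eq_map => i; rewrite ffunE.
Qed.

End Product.

(** * Convergence of series and Abel's theorem at 1 *)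

Section Series.
Context {R : realType}.

Lemma cvg_eq_near {T : Type} {U : topologicalType} {F : set_system T} {FF : Filter F}
    (f g : T -> U) (l : U) :
  (\forall x \near F, g x = f x) -> g x @[x --> F] --> l -> f x @[x --> F] --> l.
Proof.
move=> fg gl; apply: cvg_trans gl; apply: near_eq_cvg.
by apply: filterS fg => x ->.
Qed.

Lemma cvg_series_bd (u : nat -> R) (M : R) : (forall k, 0 <= u k) ->
  (forall n, series u n <= M) -> cvgn (series u).
Proof.
move=> u0 uM; apply: nondecreasing_is_cvgn; first exact: nondecreasing_series.
by exists M => _ [n _ <-].
Qed.

Lemma esum_series (u : nat -> R) : (forall k, 0 <= u k) -> cvgn (series u) ->
  (\esum_(k in [set: nat]) (u k)%:E = (limn (series u))%:E)%E.
Proof.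
move=> u0 cu; rewrite -nneseries_esumT; last by move=> k; rewrite lee_fin.
rewrite -EFin_lim//; congr (limn _); apply/funext => n /=.
by rewrite sumEFin.
Qed.

Lemma ln_le_subr1 (x : R) : 0 < x -> ln x <= x - 1.
Proof.
by move=> x0; have := @le_ln1Dx R (x - 1); rewrite (addrC 1) subrK; apply; lra.
Qed.

(** Divided by (y+1)^(-a), this is (y/(y+1))^(-a) >= 1 + a/(y+1), which follows from exp z >= 1 + z
    and ln x <= x - 1. It replaces the comparison of a series with an integral. *)
Lemma powR_step (a y : R) : 0 < a -> 0 < y ->
  a * (y + 1) `^ (- (a + 1)) <= y `^ (- a) - (y + 1) `^ (- a).
Proof.
move=> a0 y0; have y1 : 0 < y + 1 by rewrite addr_gt0.
have -> : y `^ (- a) = (y + 1) `^ (- a) * (y / (y + 1)) `^ (- a).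
  rewrite -powRM ?divr_ge0 1?ltW//; congr (_ `^ _); rewrite mulrC divfK//.
  by rewrite gt_eqF.
have -> : (y + 1) `^ (- (a + 1)) = (y + 1) `^ (- a) / (y + 1).
  rewrite opprD powRD; last by rewrite (gt_eqF y1) implybT.
  by rewrite powR_inv1// ltW.
have x0 : 0 < y / (y + 1) by rewrite divr_gt0.
have h : 1 + a / (y + 1) <= (y / (y + 1)) `^ (- a).
  rewrite /powR gt_eqF//; apply: le_trans (expR_ge1Dx _).
  rewrite lerD2l mulNr -mulrN ler_pM2l// lerNr.
  apply: le_trans (ln_le_subr1 x0) _.
  rewrite -subr_le0 (_ : _ - _ = 0)//.
  by rewrite opprK; field; rewrite gt_eqF.
have P0 : 0 < (y + 1) `^ (- a) by rewrite powR_gt0.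
rewrite -subr_ge0.
have -> : (y + 1) `^ (- a) * (y / (y + 1)) `^ (- a) - (y + 1) `^ (- a) -
   a * ((y + 1) `^ (- a) / (y + 1)) = (y + 1) `^ (- a) *
    ((y / (y + 1)) `^ (- a) - (1 + a / (y + 1))) by ring.
by rewrite mulr_ge0 ?subr_ge0// ltW.
Qed.

Lemma series_powR_le (s : R) n : 1 < s ->
  series (fun k => k.+1%:R `^ (- s)) n <= s / (s - 1).
Proof.
move=> s1; have a0 : 0 < s - 1 by lra.
(* Telescoping with [powR_step] at exponent s - 1 needs this sharper bound; its first instance is 1
   = (s - 1)/(s - 1). *)
suff h : series (fun k => k.+1%:R `^ (- s)) n.+1 <= (s - n.+1%:R `^ (- (s - 1))) / (s - 1).
  apply: le_trans (_ : series (fun k => k.+1%:R `^ (- s)) n.+1 <= _).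
    by rewrite /series/= big_nat_recr//= lerDl powR_ge0.
  apply: le_trans h _; rewrite ler_pM2r ?invr_gt0// gerBl.
  exact: powR_ge0.
elim: n => [|n IH].
  by rewrite /series/= big_nat1 !powR1 ?divff//; lra.
rewrite /series/= big_nat_recr//=; apply: le_trans (lerD IH (lexx _)) _.
have := @powR_step (s - 1) n.+1%:R a0 (ltr0Sn _ _).
rewrite subrK natr1 => h.
rewrite ler_pdivlMr// mulrDl divfK ?gt_eqF//; lra.
Qed.

Lemma cvg_series_powR (u : nat -> R) (C s : R) : 1 < s -> (forall k, 0 <= u k) ->
  (forall k, (0 < k)%N -> u k <= C * k%:R `^ (- s)) -> cvgn (series u).
Proof.
move=> s1 u0 uC.
have C0 : 0 <= C by have := uC 1%N isT; rewrite powR1 mulr1; apply: le_trans.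
apply: (@cvg_series_bd _ (u 0%N + C * (s / (s - 1)))) => // n.
have h : series u n.+1 <= u 0%N + C * series (fun k => k.+1%:R `^ (- s)) n.
  elim: n => [|n IH]; first by rewrite /series/= big_nat1 big_nil mulr0 addr0.
  rewrite /series/= big_nat_recr//= [in leRHS]big_nat_recr//= mulrDr addrA.
  by apply: lerD IH _; exact: uC.
apply: le_trans (_ : series u n.+1 <= _).
  by rewrite /series/= big_nat_recr//= lerDl.
apply: le_trans h _; rewrite lerD2l ler_wpM2l//.
exact: series_powR_le.
Qed.

Lemma cvgr_sum {T I : Type} {F : set_system T} {FF : Filter F} (r : seq I)
    (P : pred I) (f : I -> T -> R) (l : I -> R) :
  (forall i, P i -> f i x @[x --> F] --> l i) ->
  (\sum_(i <- r | P i) f i x) @[x --> F] --> \sum_(i <- r | P i) l i.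
Proof.
move=> fl; elim: r => [|i r IH].
  rewrite big_nil; under eq_fun do rewrite big_nil; exact: cvg_cst.
rewrite big_cons; under eq_fun do rewrite big_cons.
by case: (boolP (P i)) => // Pi; apply: cvgD => //; exact: fl.
Qed.

(** With nonnegative coefficients, the value at t is squeezed between a partial sum at t, which is a
    polynomial continuous at 1, and the full sum at 1. *)
Lemma abel_at_left1 (a : nat -> R) : (forall k, 0 <= a k) -> cvgn (series a) ->
  limn (pseries a t) @[t --> (1 : R)^'-] --> limn (series a).
Proof.
move=> a0 ca.
have cp t : 0 <= t <= 1 -> cvgn (pseries a t).
  move=> /andP[t0 t1]; apply: series_le_cvg ca => // k; first by rewrite mulr_ge0 ?exprn_ge0.
  by rewrite ler_piMr ?exprn_ile1.
apply/cvgrPdist_le => e e0.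
have e20 : 0 < e / 2 by rewrite divr_gt0.
have /cvgrPdist_le/(_ _ e20)[N _ HN] := ca.
have cpoly : pseries a t N @[t --> (1 : R)^'-] --> pseries a 1 N.
  apply: cvg_at_left_filter; rewrite /pseries /series/=.
  apply: cvgr_sum => k _; apply: cvgMl_tmp; apply: exprn_continuous.
have E1 : pseries a 1 N = series a N.
  by rewrite /pseries /series/=; apply: eq_bigr => k _; rewrite expr1n mulr1.
rewrite E1 in cpoly; have /cvgrPdist_le/(_ _ e20) near1 := cpoly.
near=> t.
have t0 : 0 <= t by near: t; apply: nbhs_left_ge.
have t1 : t <= 1 by near: t; exact: nbhs_left_le.
have ct : cvgn (pseries a t) by apply: cp; rewrite t0.
have le1 : limn (pseries a t) <= limn (series a).
  by apply: lim_series_le => // k; rewrite ler_piMr ?exprn_ile1.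
rewrite ger0_norm ?subr_ge0//.
have le2 : pseries a t N <= limn (pseries a t).
  apply: nondecreasing_cvgn_le => //; apply: nondecreasing_series => k _ _.
  by rewrite mulr_ge0 ?exprn_ge0.
have : `|series a N - pseries a t N| <= e / 2 by near: t.
have := HN N (leqnn N); rewrite !ler_norml; lra.
Unshelve. all: by end_near. Qed.

End Series.

(** * The weight sequence *)

Section Weights.
Context {R : realType}.
Variables (w : nat -> R) (c beta : R).
Hypothesis w0 : forall k, 0 <= w k.
Hypothesis c0 : 0 < c.
Hypothesis beta2 : 2 < beta.
Hypothesis wlim : (fun k => w k / (c * (k%:R : R) `^ (- beta))) @ \oo --> (1 : R).

Lemma weight_le : exists C, forall k, (0 < k)%N -> w k <= C * k%:R `^ (- beta).
Proof.
have [K _ HK] := cvgr_le _ wlim 2 (ltac:(lra)).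
(* The part 2c serves for k >= K; each smaller k is covered by its own term w_k k^beta of the
   sum. *)
exists (2 * c + \sum_(j < K) w j * j%:R `^ beta) => k k0.
have kp : 0 < (k%:R : R) `^ (- beta) by rewrite powR_gt0// ltr0n.
have S0 : 0 <= \sum_(j < K) w j * (j%:R : R) `^ beta.
  by apply: sumr_ge0 => j _; rewrite mulr_ge0// powR_ge0.
case: (ltnP k K) => kK; last first.
  have := HK _ kK; rewrite /= ler_pdivrMr ?mulr_gt0// => h.
  apply: le_trans h _; rewrite mulrA ler_wpM2r ?(ltW kp)//.
  by rewrite lerDl.
have -> : w k = w k * k%:R `^ beta * k%:R `^ (- beta).
  by rewrite powRN mulfK// gt_eqF// powR_gt0// ltr0n.
rewrite ler_wpM2r ?(ltW kp)// (bigD1 (Ordinal kK))//=.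
rewrite addrCA lerDl addr_ge0//; first by rewrite mulr_ge0// ltW.
by apply: sumr_ge0 => j _; rewrite mulr_ge0// powR_ge0.
Qed.

Lemma weight_lim : (fun k => w k * (k%:R : R) `^ beta) @ \oo --> c.
Proof.
rewrite -[X in _ --> X]mulr1.
have h := cvgMl_tmp (a := c) wlim; apply: cvg_eq_near (h _); near=> k.
have k0 : 0 < (k%:R : R) by rewrite ltr0n; near: k; exact: nbhs_infty_gt.
rewrite powRN; field; rewrite gt_eqF ?gt_eqF//.
by rewrite powR_gt0.
Unshelve. all: by end_near. Qed.

Lemma weight_series : cvgn (series w).
Proof.
have [C HC] := weight_le; by apply: (@cvg_series_powR _ _ C beta) => //; have := beta2; lra.
Qed.

Lemma weight_series1 : cvgn (series (fun k => k%:R * w k)).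
Proof.
have [C HC] := weight_le; apply: (@cvg_series_powR _ _ C (beta - 1)) => //; first by have := beta2; lra.
  by move=> k; rewrite mulr_ge0.
move=> k k0; apply: le_trans (ler_wpM2l (ler0n _ _) (HC _ k0)) _.
have -> : (k%:R : R) `^ (- (beta - 1)) = k%:R `^ (- beta) * k%:R.
  rewrite opprB addrC powRD ?powRr1//.
  by rewrite pnatr_eq0 -lt0n k0 implybT.
by rewrite mulrCA (mulrC k%:R).
Qed.

Lemma Phi1E : Phi1 w = limn (series w).
Proof.
rewrite /Phi1 /Phi; congr (limn (series _)).
by apply/funext => k; rewrite expr1n mulr1.
Qed.

Lemma Phi1_gt0 : 0 < Phi1 w.
Proof.
rewrite Phi1E.
have [K1 _ HK1] := cvgr_ge _ wlim 2^-1 (ltac:(lra)).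
have k0 : 0 < (K1.+1%:R : R) `^ (- beta) by rewrite powR_gt0// ltr0n.
have : 0 < w K1.+1.
  have := HK1 K1.+1 (leqnSn _); rewrite /= ler_pdivlMr ?mulr_gt0//.
  by apply: lt_le_trans; rewrite !mulr_gt0.
move/lt_le_trans; apply.
apply: le_trans (nondecreasing_cvgn_le (nondecreasing_series _) weight_series K1.+2) => //.
by rewrite /series/= big_nat_recr//= lerDr sumr_ge0.
Qed.

Definition pw k := w k / Phi1 w.

Lemma pw_ge0 k : 0 <= pw k.
Proof. by rewrite divr_ge0// ltW// Phi1_gt0. Qed.

Lemma pw_sum1 : (\esum_(k in [set: nat]) (pw k)%:E = 1)%E.
Proof.
under eq_esum do rewrite /pw mulrC.
rewrite esumZ//; last by rewrite invr_ge0 ltW// Phi1_gt0.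
rewrite esum_series//; last exact: weight_series.
by rewrite -EFinM -Phi1E mulVf// gt_eqF// Phi1_gt0.
Qed.

Lemma pw_le : exists C, forall k, (0 < k)%N -> pw k <= C * k%:R `^ (- beta).
Proof.
have [C HC] := weight_le; exists (C / Phi1 w) => k /HC h.
by rewrite /pw mulrAC ler_wpM2r// invr_ge0 ltW// Phi1_gt0.
Qed.

Lemma pw_lim : (fun k => pw k * (k%:R : R) `^ beta) @ \oo --> c / Phi1 w.
Proof.
under eq_fun do rewrite /pw mulrAC.
by apply: cvgMr_tmp; exact: weight_lim.
Qed.

Lemma mean_pw : Ex pw (fun k => k%:R) = limn (series (fun k => k%:R * w k)) / Phi1 w.
Proof.
rewrite Ex_nneg//; last exact: pw_ge0.
under eq_esum do rewrite /pw mulrAC mulrC [w _ * _]mulrC.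
rewrite esumZ//; last 2 first.
- by rewrite invr_ge0 ltW// Phi1_gt0.
- by move=> k; rewrite mulr_ge0.
rewrite esum_series//; last exact: weight_series1; last by move=> k; rewrite mulr_ge0.
by rewrite mulrC.
Qed.

Lemma series_diffs n : series (pseries_diffs w) n = series (fun k => k%:R * w k) n.+1.
Proof. by rewrite /series/= [RHS]big_nat_recl//= mul0r add0r. Qed.

(** For 0 <= t < 1 each t^i with i < k is at least t^k, so k t^k is at most a partial geometric
    sum. *)
Lemma natr_mul_exp_le (t : R) k : 0 <= t -> t < 1 -> k%:R * t ^+ k <= (1 - t)^-1.
Proof.
move=> t0 t1; apply: le_trans (_ : series (geometric 1 t) k <= _).
  rewrite /series/= big_mkord -[X in X%:R * _]card_ord -sum1_card natr_sum mulr_suml.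
  apply: ler_sum => i _; rewrite !mul1r; apply: ler_wiXn2l => //; first exact: ltW.
  exact/ltnW/ltn_ord.
rewrite -[leRHS]mul1r.
have := t0; rewrite le_eqVlt => /predU1P[<-|{}t0]; last first.
  by rewrite geometric_le_lim// ger0_norm// ltW.
rewrite subr0 invr1 mulr1; case: k => [|k]; first by rewrite /series/= big_nil.
rewrite /series/= big_nat_recl//= expr0 mulr1 big1 ?addr0// => i _.
by rewrite expr0n/= mulr0.
Qed.

(** For t < 1 the derivative of Phi is the power series with coefficients (k+1) w_(k+1). Abel's
    theorem applies to it because beta > 2 makes the sum of k w_k finite, and the quotient of the
    two limits is the mean of [pw w]. *)
Lemma Psi_at_left1 : Psi w t @[t --> at_left (1 : R)] --> Ex pw (fun k => k%:R).
Proof.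
have cd : series (pseries_diffs w) @ \oo --> limn (series (fun k => k%:R * w k)).
  rewrite (_ : series _ = fun n => series (fun k => k%:R * w k) n.+1).
    by rewrite cvg_shiftS; exact: weight_series1.
  by apply/funext => n; exact: series_diffs.
have d0 k : 0 <= pseries_diffs w k by rewrite mulr_ge0.
have D1 := abel_at_left1 d0 (cvgP _ cd).
rewrite (cvg_lim _ cd)// in D1.
have D0 := abel_at_left1 w0 weight_series.
rewrite -Phi1E in D0.
rewrite mean_pw.
have : t * limn (pseries (pseries_diffs w) t) / limn (pseries w t) @[t --> (1:R)^'-] -->
   1 * limn (series (fun k => k%:R * w k)) / Phi1 w.
  apply: cvgM; last by apply: cvgV => //; rewrite gt_eqF// Phi1_gt0.
  apply: cvgM => //; apply: cvg_at_left_filter; exact: cvg_id.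
rewrite mul1r; apply: cvg_eq_near; near=> t.
have t0 : 0 <= t by near: t; apply: nbhs_left_ge.
have t1 : t < 1 by near: t; exact: nbhs_left_lt.
rewrite /Psi derive1E; congr (_ * _ / _).
(* Termwise differentiation at t requires convergence at a radius strictly between t and 1. *)
pose K := (1 + t) / 2.
have K0 : 0 <= K by rewrite /K; lra.
have K1 : K < 1 by rewrite /K; lra.
have cK (a : nat -> R) : (forall k, 0 <= a k) -> cvgn (series a) -> cvgn (pseries a K).
  move=> a0 ca; apply: series_le_cvg ca => // k; first by rewrite mulr_ge0 ?exprn_ge0.
  by rewrite ler_piMr ?exprn_ile1// ltW.
symmetry; apply: derive_val.
apply: (@pseries_snd_diffs _ w K t).
- exact: cK weight_series.
- by apply: cK => //; exact: cvgP cd.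
(* The second derivative converges at K because (k+1) K^k <= 1/((1 - K) K), which reduces it to the
   first derivative at 1. *)
- have Kp : 0 < K by rewrite /K; lra.
  have cS : cvgn (series (fun k => pseries_diffs w k.+1)).
    apply: (@cvg_series_bd _ _ (limn (series (pseries_diffs w)))) => // n.
    apply: le_trans (nondecreasing_cvgn_le (nondecreasing_series (fun k _ _ => d0 k)) (cvgP _ cd) n.+1).
    by rewrite /series/= [leRHS]big_nat_recl//= lerDr.
  have := is_cvg_seriesZ (k := ((1 - K) * K)^-1) cS.
  apply: series_le_cvg => k.
  + by rewrite !mulr_ge0 ?exprn_ge0.
  + by rewrite mulr_ge0// invr_ge0 mulr_ge0// subr_ge0 ltW.
  + change (k.+1%:R * pseries_diffs w k.+1 * K ^+ k <=
      ((1 - K) * K)^-1 * pseries_diffs w k.+1).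
    rewrite mulrAC ler_wpM2r//.
    by rewrite invfM ler_pdivlMr// -mulrA -exprSr natr_mul_exp_le.
- by rewrite !ger0_norm// /K; lra.
Unshelve. all: by end_near. Qed.

End Weights.

(** * Scaling limits of one summand *)

Section RegularTail.
Context {R : realType}.
Variables (p : nat -> R) (c' beta : R).
Hypothesis p0 : forall k, 0 <= p k.
Hypothesis beta2 : 2 < beta.
Hypothesis pbd : exists C, forall k, (0 < k)%N -> p k <= C * k%:R `^ (- beta).
Hypothesis plim : p k * (k%:R : R) `^ beta @[k --> \oo] --> c'.
Local Notation mu := (@lebesgue_measure R).
Local Notation alpha := (beta - 1).

(** The series s * sum_k p_k h(k/s) is the integral of this step function, which turns
    the scaling limit into an application of dominated convergence. *)
Definition stepf (h : R -> R) (s y : R) : R :=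
  s * p (Num.truncn (y * s)) * h ((Num.truncn (y * s))%:R / s).

Lemma stepf_itv h s k y : 0 < s -> y \in `[k%:R / s, k.+1%:R / s[ ->
  stepf h s y = s * p k * h (k%:R / s).
Proof.
move=> s0; rewrite in_itv/= ler_pdivrMr// ltr_pdivlMr// => ky.
by rewrite /stepf (truncn_def ky).
Qed.

Lemma itv0y_steps s : 0 < s ->
  `[0, +oo[%classic = \bigcup_k `[(k%:R / s : R), k.+1%:R / s[%classic.
Proof.
move=> s0; apply/seteqP; split => [y|y [k _]]/=; rewrite !in_itv/= ?andbT.
  move=> y0; exists (Num.truncn (y * s)) => //=; rewrite in_itv/=.
  have /andP[h1 h2] : (Num.truncn (y * s))%:R <= y * s < (Num.truncn (y * s)).+1%:R.
    by apply: truncn_itv; rewrite mulr_ge0// ltW.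
  by rewrite ler_pdivrMr// h1 ltr_pdivlMr.
by move=> /andP[+ _]; apply: le_trans; rewrite divr_ge0// ltW.
Qed.

Lemma trivIset_steps s : 0 < s ->
  trivIset [set: nat] (fun k => `[(k%:R / s : R), k.+1%:R / s[%classic).
Proof.
move=> s0; apply/trivIsetP => i j _ _ ij.
apply/seteqP; split => // y [] /=; rewrite !in_itv/= !ler_pdivrMr// !ltr_pdivlMr//.
by move=> iy jy; move: ij; rewrite -(truncn_def iy) -(truncn_def jy) eqxx.
Qed.

Lemma measurable_stepf (h : R -> R) (s : R) : 0 < s ->
  measurable_fun (`[0, +oo[%classic : set R) (stepf h s).
Proof.
move=> s0; rewrite (itv0y_steps s0); apply/measurable_fun_bigcup => // k.
apply: (eq_measurable_fun (cst (s * p k * h (k%:R / s)))) => // y.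
by rewrite inE => yk /=; rewrite (stepf_itv h s0 yk).
Qed.

Lemma integral_stepf (h : R -> R) (s : R) : 0 < s ->
  (forall x, (0 <= x)%R -> (0 <= h x)%R) ->
  (\int[mu]_(y in `[0%R, +oo[) (stepf h s y)%:E =
   \esum_(k in [set: nat]) (p k * h (k%:R / s))%:E)%E.
Proof.
move=> s0 h0; have ks k : 0 <= k%:R / s by rewrite divr_ge0// ltW.
rewrite (itv0y_steps s0) ge0_integral_bigcup//=; last 3 first.
- by rewrite -(itv0y_steps s0); apply/measurable_EFinP; exact: measurable_stepf.
- move=> y [k _ /=] yk; rewrite (stepf_itv h s0 yk) lee_fin.
  by rewrite !mulr_ge0 ?h0// ltW.
- exact: trivIset_steps.
rewrite nneseries_esumT; last first.
  move=> k; apply: integral_ge0 => y /= yk.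
  by rewrite (stepf_itv h s0 yk) lee_fin !mulr_ge0 ?h0// ltW.
apply: eq_esum => k _.
transitivity (\int[mu]_(y in `[(k%:R / s)%R, (k.+1%:R / s)%R[) cst (s * p k * h (k%:R / s))%:E y)%E.
  by apply: eq_integral => y; rewrite inE => /(stepf_itv h s0) ->.
rewrite integral_cst//= lebesgue_measure_itv/= lte_fin.
rewrite ltr_pM2r ?invr_gt0// ltr_nat ltnSn -EFinD -EFinM.
congr EFin; rewrite -mulrBl -natr1 addrAC subrr add0r mul1r; field.
by rewrite gt_eqF.
Qed.

Lemma ge0_powR_continuous (a x : R) : 0 < x -> {for x, continuous (fun y => y `^ a)}.
Proof.
move=> x0; apply: differentiable_continuous; apply/derivable1_diffP.
by apply: derivable_powR; rewrite in_itv/= x0.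
Qed.

Lemma ler_powRN (a x y : R) : 0 <= a -> 0 < x -> x <= y -> y `^ (- a) <= x `^ (- a).
Proof.
move=> a0 x0 xy; rewrite !powRN lef_pV2 ?posrE ?powR_gt0//; last exact: lt_le_trans xy.
by rewrite ge0_ler_powR// nnegrE ltW//; exact: lt_le_trans xy.
Qed.

(** For k = trunc(y s) >= 1 one has k >= y s / 2, so p_k is at most a multiple of (y s)^(-beta),
    while h(k/s) <= h(y) by monotonicity. The cell k = 0, where [pbd] says nothing, vanishes because
    h 0 = 0. *)
Lemma stepf_le : exists2 C, 0 <= C & forall (h : R -> R) s y, 1 <= s -> 0 <= y ->
  h 0 = 0 -> (forall x z, 0 <= x -> x <= z -> h x <= h z) ->
  s `^ alpha * stepf h s y <= C * (h y * y `^ (- beta)).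
Proof.
have [C HC] := pbd.
have C0 : 0 <= C by have := HC 1%N isT; rewrite powR1 mulr1; apply: le_trans.
have b0 : 0 <= beta by have := beta2; lra.
exists (C * 2 `^ beta); first by rewrite mulr_ge0 ?powR_ge0.
move=> h s y s1 y0 h0 hmono.
have s0 : 0 < s by lra.
have hge0 x : 0 <= x -> 0 <= h x by move=> x0; rewrite -h0; exact: hmono.
rewrite /stepf; set k := Num.truncn _.
have /andP[k1 k2] : k%:R <= y * s < k.+1%:R by apply: truncn_itv; rewrite mulr_ge0// ltW.
have [k00|k0] := posnP k.
  by rewrite k00 mul0r h0 !mulr0 !mulr_ge0 ?powR_ge0 ?hge0.
have kR : 0 < (k%:R : R) by rewrite ltr0n.
have yp : 0 < y by rewrite -(pmulr_lgt0 _ s0); apply: lt_le_trans k1.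
have hk : h (k%:R / s) <= h y by apply: hmono; rewrite ?ler_pdivrMr// divr_ge0// ltW.
have pk : s `^ beta * p k <= C * 2 `^ beta * y `^ (- beta).
  apply: le_trans (ler_wpM2l (powR_ge0 _ _) (HC _ k0)) _.
  have : k%:R `^ (- beta) <= (y * s / 2) `^ (- beta).
    apply: ler_powRN => //; first by rewrite divr_gt0// mulr_gt0.
    rewrite ler_pdivrMr//; apply: ltW; apply: lt_le_trans k2 _.
    by rewrite -natr1 mulr_natr mulr2n lerD2l ler1n.
  have -> : (y * s / 2) `^ (- beta) = y `^ (- beta) * s `^ (- beta) * 2^-1 `^ (- beta).
    by rewrite !powRM ?invr_ge0 ?mulr_ge0// ltW.
  rewrite -[in X in _ <= _ * X]powR_inv1// -powRrM mulrN mulN1r opprK.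
  move=> hk'; rewrite mulrCA -mulrA ler_wpM2l//.
  have : s `^ beta * k%:R `^ (- beta) <= s `^ beta * (y `^ (- beta) * s `^ (- beta) * 2 `^ beta).
    by rewrite ler_wpM2l// powR_ge0.
  move/le_trans; apply.
  by rewrite [s `^ (- _)]powRN le_eqVlt; apply/orP; left; apply/eqP; field; rewrite gt_eqF// powR_gt0.
have -> : s `^ alpha * (s * p k * h (k%:R / s)) = s `^ beta * p k * h (k%:R / s).
  by rewrite -(mulr_powRB1 (ltW s0) (lt_le_trans _ (ltW beta2)))//; ring.
rewrite mulrCA mulrC; apply: ler_pM => //; rewrite ?mulr_ge0 ?powR_ge0 ?hge0//.
by rewrite divr_ge0// ltW.
Qed.

(** With k = trunc(y s), s^beta p_k = (p_k k^beta) (k/s)^(-beta), and k/s tends to y. *)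
Lemma stepf_cvg (h : R -> R) (s : nat -> R) y : (forall n, 1 <= s n) ->
  s n @[n --> \oo] --> +oo -> 0 < y -> {for y, continuous h} ->
  s n `^ alpha * stepf h (s n) y @[n --> \oo] --> c' * (h y * y `^ (- beta)).
Proof.
move=> s1 soo y0 hy.
have s0 n : 0 < s n by apply: lt_le_trans (s1 n).
pose k n := Num.truncn (y * s n).
have kitv n : (k n)%:R <= y * s n < (k n).+1%:R.
  by apply: truncn_itv; rewrite mulr_ge0// ltW.
have koo : k n @[n --> \oo] --> \oo.
  apply/cvgnyPge => A; near=> n.
  rewrite /k truncn_ge_nat; last by rewrite mulr_ge0// ltW.
  rewrite mulrC -ler_pdivrMr//; near: n; by move/cvgryPge : soo; apply.
have ksy : (k n)%:R / s n @[n --> \oo] --> y.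
  have sV : (s n)^-1 @[n --> \oo] --> (0 : R).
    by apply/gtr0_cvgV0 => //; exact: nearW.
  apply: (@squeeze_cvgr _ _ _ _ (fun n => y - (s n)^-1) (fun=> y)).
  - apply: nearW => n; have /andP[h1 h2] := kitv n.
    rewrite ler_pdivrMr// h1 andbT ler_pdivlMr// mulrBl mulVf ?gt_eqF//.
    by rewrite lerBlDr natr1 ltW.
  - by rewrite -[X in _ --> X]subr0; apply: cvgB => //; exact: cvg_cst.
  - exact: cvg_cst.
have pk : p (k n) * (k n)%:R `^ beta @[n --> \oo] --> c' by exact: (cvg_comp _ _ koo plim).
have pw : ((k n)%:R / s n) `^ (- beta) @[n --> \oo] --> y `^ (- beta).
  by have := cvg_comp _ _ ksy (@ge0_powR_continuous (- beta) y y0).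
have hk : h ((k n)%:R / s n) @[n --> \oo] --> h y by have := cvg_comp _ _ ksy hy.
rewrite [h y * _]mulrC mulrA.
apply: cvg_eq_near (cvgM (cvgM pk pw) hk).
near=> n.
have kn0 : 0 < ((k n)%:R : R).
  by rewrite ltr0n; near: n; move/cvgnyPgt : koo; apply.
rewrite /stepf -/(k n) /= powRM ?invr_ge0//; last exact: ltW.
rewrite -powR_inv1 1?ltW// -powRrM mulrN mulN1r opprK powRN mulrA.
rewrite -(mulr_powRB1 (ltW (s0 n)) (lt_le_trans _ (ltW beta2)))//.
by field; rewrite gt_eqF// powR_gt0.
Unshelve. all: by end_near. Qed.

(** Dominated convergence for the step functions; the discontinuity [d] is a null set, which admits
    indicators of half-lines. The condition s >= 1 yields summability, since [stepf] is then at most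
    s^alpha times itself. *)
Lemma Ex_scaling_ge1 (h : R -> R) (d : R) (s : nat -> R) : h 0 = 0 ->
  (forall x z, 0 <= x -> x <= z -> h x <= h z) ->
  (forall y, 0 < y -> y != d -> {for y, continuous h}) ->
  mu.-integrable `[(0 : R), +oo[ (fun y => (h y * y `^ (- beta))%:E) ->
  (forall n, 1 <= s n) -> s n @[n --> \oo] --> +oo ->
  (forall n, summ p (fun k => h (k%:R / s n))) /\
  s n `^ alpha * Ex p (fun k => h (k%:R / s n)) @[n --> \oo] -->
    c' * \int[mu]_(y in `[(0 : R), +oo[) (h y * y `^ (- beta)).
Proof.
move=> h0 hmono hc hint s1 soo.
have s0 n : 0 < s n by apply: lt_le_trans (s1 n).
have hge0 x : 0 <= x -> 0 <= h x by move=> x0; rewrite -h0; exact: hmono.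
have hks n k : 0 <= h (k%:R / s n) by rewrite hge0// divr_ge0// ltW.
have [C C0 HC] := stepf_le.
have f_ge0 n y : 0 <= y -> 0 <= stepf h (s n) y.
  by move=> y0; rewrite !mulr_ge0 ?hks// ltW.
have If : (\int[mu]_(y in `[0%R, +oo[) (h y * y `^ (- beta))%:E)%E \is a fin_num.
  by apply: integrable_fin_num.
have mh : measurable_fun (`[0, +oo[%classic : set R) (fun y : R => h y * y `^ (- beta)).
  by apply/measurable_EFinP; have /integrableP[] := hint.
have [||||||_ _ D] := @dominated_convergence _ _ _ mu `[(0 : R), +oo[%classic _
  (fun n y => (s n `^ alpha * stepf h (s n) y)%:E)
  (fun y => (c' * (h y * y `^ (- beta)))%:E) (fun y => (C * (h y * y `^ (- beta)))%:E).
- by [].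
- move=> n; apply/measurable_EFinP; apply: measurable_funM => //.
  exact: measurable_stepf.
- by apply/measurable_EFinP; apply: measurable_funM.
- exists [set d]; split => //; first exact: lebesgue_measure_set1.
  move=> y /= H; apply: contrapT => yd; apply: H; rewrite in_itv/= andbT => y0.
  apply: cvg_EFin; first exact: nearW.
  have := y0; rewrite le_eqVlt => /predU1P[<-|yp].
    rewrite h0 mul0r mulr0.
    apply: (cvg_eq_near _ (cvg_cst _)); apply: nearW => n /=.
    by rewrite /stepf mul0r truncn0 mul0r h0 !mulr0.
  by apply: stepf_cvg => //; apply: hc => //; apply/eqP.
- have -> : (fun y : R => (C * (h y * y `^ (- beta)))%:E) =
      (fun y : R => C%:E * (h y * y `^ (- beta))%:E)%E by apply/funext => y; rewrite EFinM.
  by apply: (integrableZl _ C).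
- apply: aeW => y n; rewrite /= in_itv/= andbT => y0; rewrite lee_fin.
  rewrite ger0_norm; first exact: HC.
  by rewrite mulr_ge0 ?powR_ge0 ?f_ge0.
have I n : (\int[mu]_(x in `[0%R, +oo[) (s n `^ alpha * stepf h (s n) x)%:E =
    (s n `^ alpha)%:E * \esum_(k in [set: nat]) (p k * h (k%:R / s n))%:E)%E.
  rewrite -integral_stepf//; under eq_integral do rewrite EFinM.
  rewrite ge0_integralZl_EFin ?powR_ge0//.
    by move=> y/=; rewrite in_itv/= andbT lee_fin => y0; exact: f_ge0.
  by apply/measurable_EFinP; exact: measurable_stepf.
have S n : summ p (fun k => h (k%:R / s n)).
  rewrite (summ_nnegE p0 (hks n)) -integral_stepf//.
  apply: (@le_lt_trans _ _ (\int[mu]_(y in `[0%R, +oo[) (C * (h y * y `^ (- beta)))%:E)%E).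
    apply: ge0_le_integral => //=.
    - by move=> y; rewrite /= in_itv/= andbT lee_fin => y0; exact: f_ge0.
    - by apply/measurable_EFinP; exact: measurable_stepf.
    - by apply/measurable_EFinP; apply: measurable_funM.
    - move=> y; rewrite /= in_itv/= andbT lee_fin => y0.
      apply: le_trans (HC h (s n) y (s1 n) y0 h0 hmono).
      rewrite ler_peMl ?f_ge0//.
      by have := @ler_powR _ (s n) (s1 n) 0 alpha; rewrite powRr0; apply; have := beta2; lra.
  under eq_integral do rewrite EFinM.
  rewrite integralZl// -(fineK If).
  by rewrite -EFinM ltry.
split=> //.
have : (fun n => (s n `^ alpha * Ex p (fun k => h (k%:R / s n)))%:E) @ \oo -->
    (c' * \int[mu]_(y in `[(0 : R), +oo[) (h y * y `^ (- beta)))%:E.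
  have -> : (c' * \int[mu]_(y in `[(0 : R), +oo[) (h y * y `^ (- beta)))%:E =
      (\int[mu]_(y in `[0%R, +oo[) (c' * (h y * y `^ (- beta)))%:E)%E.
    under [RHS]eq_integral do rewrite EFinM.
    by rewrite integralZl// EFinM /Rintegral fineK.
  apply: cvg_eq_near D; apply: nearW => n /=.
  by rewrite I (Ex_esum p0 (hks n) (S n)) EFinM.
by move/fine_cvg.
Qed.

End RegularTail.

(** * Improper integrals of powers *)

Section Calculus.
Context {R : realType}.
Local Notation mu := (@lebesgue_measure R).

Lemma FTC_cc (f F : R -> R) (a b : R) : a < b ->
  (forall x, a <= x <= b -> is_derive x 1 F (f x)) ->
  (forall x, a <= x <= b -> {for x, continuous f}) ->
  (\int[mu]_(x in `[a, b]) (f x)%:E = (F b)%:E - (F a)%:E)%E.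
Proof.
move=> ab dF cf.
have cF x : a <= x <= b -> {for x, continuous F}.
  move=> /dF h; apply: differentiable_continuous; apply/derivable1_diffP.
  exact: ex_derive.
apply: continuous_FTC2 => //.
- by apply: continuous_in_subspaceT => x; rewrite inE/= in_itv/=; exact: cf.
- split.
  + move=> x; rewrite in_itv/= => /andP[ax xb].
    by have := dF x; rewrite (ltW ax) (ltW xb) => /(_ isT) h; exact: ex_derive.
  + by apply: cvg_at_right_filter; apply: cF; rewrite lexx ltW.
  + by apply: cvg_at_left_filter; apply: cF; rewrite lexx ltW.
- move=> x; rewrite in_itv/= => /andP[ax xb].
  have := dF x; rewrite (ltW ax) (ltW xb) => /(_ isT) h.
  by rewrite derive1E; exact: derive_val.
Qed.

Lemma FTC_cy (f F : R -> R) (a l : R) :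
  (forall x, a <= x -> 0 <= f x) ->
  (forall x, a <= x -> is_derive x 1 F (f x)) ->
  (forall x, a <= x -> {for x, continuous f}) ->
  F x @[x --> +oo] --> l ->
  (\int[mu]_(x in `[a, +oo[) (f x)%:E = l%:E - (F a)%:E)%E.
Proof.
move=> f0 dF cf Fl.
have cF x : a <= x -> {for x, continuous F}.
  move=> /dF h; apply: differentiable_continuous; apply/derivable1_diffP.
  exact: ex_derive.
apply: ge0_continuous_FTC2y => //.
- by apply: continuous_in_subspaceT => x; rewrite inE/= in_itv/= andbT; exact: cf.
- by move=> x /ltW/dF h; exact: ex_derive.
- by apply: cvg_at_right_filter; exact: cF.
- move=> x; rewrite in_itv/= andbT => /ltW/dF h.
  by rewrite derive1E; exact: derive_val.
Qed.

(** The integrand may blow up at 0, so the integral is exhausted by the compact intervals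
    [b/(k+2), b]; the offset 2 keeps each of them nondegenerate. *)
Lemma FTC_oc (f F : R -> R) (b l : R) : 0 < b ->
  (forall x, 0 < x <= b -> 0 <= f x) ->
  (forall x, 0 < x <= b -> is_derive x 1 F (f x)) ->
  (forall x, 0 < x <= b -> {for x, continuous f}) ->
  F x @[x --> 0^'+] --> l ->
  (\int[mu]_(x in `]0%R, b]) (f x)%:E = (F b)%:E - l%:E)%E.
Proof.
move=> b0 f0 dF cf Fl.
pose I (k : nat) : set R := `[b / k.+2%:R, b]%classic.
have bk (k : nat) : 0 < b / k.+2%:R :> R by rewrite divr_gt0.
have bkb (k : nat) : b / k.+2%:R < b.
  by rewrite ltr_pdivrMr// ltr_pMr// ltr1n.
have IU : `]0%R, b]%classic = \bigcup_k I k.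
  apply/seteqP; split => [x|x [k _]]; rewrite /I/= !in_itv/=.
    move=> /andP[x0 xb]; exists (Num.truncn (b / x)) => //=; rewrite in_itv/= xb andbT.
    rewrite ler_pdivrMr// mulrC -ler_pdivrMr//.
    have /andP[_] : (Num.truncn (b / x))%:R <= b / x < (Num.truncn (b / x)).+1%:R.
      by apply: truncn_itv; rewrite divr_ge0// ltW.
    move=> /ltW/le_trans; apply; by rewrite ler_nat.
  by move=> /andP[h ->]; rewrite (lt_le_trans (bk k) h).
have mf k : measurable_fun (I k) (fun x => (f x)%:E).
  have cI : {within `[b / k.+2%:R, b], continuous f}.
    apply: continuous_in_subspaceT => x; rewrite inE/= in_itv/= => /andP[h xb].
    by apply: cf; rewrite xb (lt_le_trans (bk k) h).
  apply/measurable_EFinP; apply: subspace_continuous_measurable_fun cI.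
  exact: measurable_itv.
have h1 : (\int[mu]_(x in I k) (f x)%:E)%E @[k --> \oo] -->
     (\int[mu]_(x in `]0%R, b]) (f x)%:E)%E.
  rewrite IU; apply: ge0_nondecreasing_set_cvg_integral => //.
  - move=> m n mn; apply/subsetPset => x; rewrite /I/= !in_itv/= => /andP[h ->].
    rewrite andbT (le_trans _ h)// ler_pM2l// lef_pV2 ?posrE//.
    by rewrite ler_nat !ltnS.
  - by move=> k; exact: measurable_itv.
  - move=> k x; rewrite /I/= in_itv/= => /andP[h xb]; rewrite lee_fin f0// xb andbT.
    exact: lt_le_trans h.
have h2 : (\int[mu]_(x in I k) (f x)%:E)%E @[k --> \oo] --> ((F b)%:E - l%:E)%E.
  have bk0 : b / k.+2%:R @[k --> \oo] --> (0 : R).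
    rewrite -(mulr0 b); apply: cvgMl_tmp.
    by have := @cvg_harmonic R; rewrite -cvg_shiftS.
  have Fb : F (b / k.+2%:R) @[k --> \oo] --> l.
    by apply: (cvg_at_rightP F 0 l).1.
  have : ((F b - F (b / k.+2%:R))%:E)%E @[k --> \oo] --> ((F b)%:E - l%:E)%E.
    rewrite -EFinB; apply: cvg_EFin; first exact: nearW.
    by apply: cvgB => //; exact: cvg_cst.
  apply: cvg_eq_near; apply: nearW => k.
  have dFk x : b / k.+2%:R <= x <= b -> is_derive x 1 F (f x).
    by move=> /andP[h xb]; apply: dF; rewrite xb (lt_le_trans (bk k) h).
  have cfk x : b / k.+2%:R <= x <= b -> {for x, continuous f}.
    by move=> /andP[h xb]; apply: cf; rewrite xb (lt_le_trans (bk k) h).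
  by rewrite (FTC_cc (bkb k) dFk cfk).
exact: cvg_unique h1 h2.
Qed.

Lemma powRN_cvgy (a : R) : 0 < a -> y `^ (- a) @[y --> +oo] --> (0 : R).
Proof.
move=> a0; apply/cvgrPdist_le => e e0; near=> y.
have M0 : 0 < e `^ (- a^-1) by rewrite powR_gt0.
have yM : e `^ (- a^-1) <= y by near: y; exact: nbhs_pinfty_ge.
rewrite sub0r normrN ger0_norm ?powR_ge0//.
apply: le_trans (ler_powRN (ltW a0) M0 yM) _.
by rewrite -powRrM mulrNN mulVf ?gt_eqF// powRr1// ltW.
Unshelve. all: by end_near. Qed.

Lemma is_derive_powRZ (k a x : R) : 0 < x ->
  is_derive x 1 (fun y => k * y `^ a) (k * (a * x `^ (a - 1))).
Proof. by move=> x0; apply: is_deriveZ; exact: is_derive1_powR. Qed.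

Lemma integral_powR_tail (a x : R) : 0 < a -> 0 < x ->
  (\int[mu]_(y in `[x, +oo[) (y `^ (- (a + 1)))%:E = (x `^ (- a) / a)%:E)%E.
Proof.
move=> a0 x0.
pose F (y : R) := - a^-1 * y `^ (- a).
have dF (y : R) : x <= y -> is_derive y 1 F (y `^ (- (a + 1))).
  move=> xy; apply: is_derive_eq; first exact: is_derive_powRZ (lt_le_trans x0 xy).
  by rewrite opprD mulrA mulrNN mulVf ?mul1r// gt_eqF.
have cf (y : R) : x <= y -> {for y, continuous (fun y => y `^ (- (a + 1)))}.
  by move=> xy; apply: ge0_powR_continuous; exact: lt_le_trans xy.
have Fl : F y @[y --> +oo] --> 0.
  by rewrite -(mulr0 (- a^-1)); apply: cvgMl_tmp; exact: powRN_cvgy.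
rewrite (FTC_cy _ dF cf Fl); last by move=> y _; exact: powR_ge0.
by rewrite -EFinB; congr EFin; rewrite /F sub0r mulNr opprK mulrC.
Qed.

Lemma integral_powR_head (g : R) : -1 < g ->
  (\int[mu]_(y in `]0%R, 1%R]) (y `^ g)%:E = ((g + 1)^-1)%:E)%E.
Proof.
move=> g1; have g0 : 0 < g + 1 by lra.
pose F (y : R) := (g + 1)^-1 * y `^ (g + 1).
have dF (y : R) : 0 < y <= 1 -> is_derive y 1 F (y `^ g).
  move=> /andP[y0 _]; apply: is_derive_eq; first exact: is_derive_powRZ.
  by rewrite mulrA mulVf ?mul1r ?addrK// gt_eqF.
have cf (y : R) : 0 < y <= 1 -> {for y, continuous (fun y => y `^ g)}.
  by move=> /andP[y0 _]; exact: ge0_powR_continuous.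
have Fl : F y @[y --> 0^'+] --> 0.
  have h : F y @[y --> 0^'+] --> (g + 1)^-1 * 0.
    by apply: cvgMl_tmp; exact: powR_cvg0.
  by rewrite mulr0 in h.
rewrite (FTC_oc ltr01 _ dF cf Fl); last by move=> y _; exact: powR_ge0.
by rewrite /F powR1 mulr1 sube0.
Qed.

Lemma mulr_powRN (y b : R) : 0 < y -> y * y `^ (- b) = y `^ (1 - b).
Proof.
move=> y0; rewrite -[in LHS](powRr1 (ltW y0)) -powRrM mul1r -powRD//.
by rewrite (gt_eqF y0) implybT.
Qed.

(** Linear growth of [g] settles the part beyond 1, where y^(1 - beta) is integrable since beta > 2;
    the behaviour near 0 is left to the last hypothesis. *)
Lemma integrable_powR_weight (g : R -> R) (A beta : R) : 2 < beta ->
  measurable_fun [set: R] g ->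
  (forall y, 0 <= y -> 0 <= g y <= A * y) ->
  (\int[mu]_(y in `]0%R, 1%R]) (g y * y `^ (- beta))%:E < +oo)%E ->
  mu.-integrable `[(0 : R), +oo[ (fun y => (g y * y `^ (- beta))%:E).
Proof.
move=> beta2 mg gA g01.
have mG : measurable_fun [set: R] (fun y => g y * y `^ (- beta)).
  by apply: measurable_funM => //; exact: measurable_powR.
have mGD (D : set R) : measurable D -> measurable_fun D (fun y => (g y * y `^ (- beta))%:E).
  by move=> mD; apply/measurable_EFinP; apply: measurable_funS mG.
have g0 y : 0 <= y -> 0 <= g y * y `^ (- beta).
  by move=> /gA/andP[h _]; rewrite mulr_ge0// powR_ge0.
have A0 : 0 <= A by have /andP[h1 h2] := gA 1 ler01; rewrite mulr1 in h2; exact: le_trans h2.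
apply/integrableP; split; first exact: mGD.
rewrite -integral_itv_obnd_cbnd; last by apply/measurable_EFinP; apply: measurableT_comp => //; exact: measurable_funTS.
have -> : `]0%R, +oo[%classic = `]0%R, 1%R] `|` `]1%R, +oo[ :> set R.
  apply/seteqP; split => y /=; rewrite !in_itv/= !andbT.
    by move=> y0; case: (leP y 1) => h; [left|right]; rewrite ?y0.
  by case=> [/andP[]//|]; apply: lt_trans.
rewrite ge0_integral_setU//=; first last.
- apply/disj_setPLR => y /=; rewrite !in_itv/= andbT => /andP[_ y1].
  by apply/negP; rewrite -leNgt.
- apply/measurable_EFinP; apply: measurableT_comp => //; exact: measurable_funTS.
rewrite lte_add_pinfty//.
  apply: le_lt_trans g01; apply: ge0_le_integral => //=.
  - by apply/measurable_EFinP; apply: measurableT_comp => //; exact: measurable_funTS.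
  - exact: mGD.
  - move=> y; rewrite in_itv/= lee_fin => /andP[/ltW/g0 h _].
    by rewrite ger0_norm.
rewrite integral_itv_obnd_cbnd; last by apply/measurable_EFinP; apply: measurableT_comp => //; exact: measurable_funTS.
apply: (@le_lt_trans _ _ (\int[mu]_(y in `[1%R, +oo[) (A%:E * (y `^ (- (beta - 2 + 1)))%:E))%E).
  apply: ge0_le_integral => //=.
  - by apply/measurable_EFinP; apply: measurableT_comp => //; exact: measurable_funTS.
  - apply: measurable_funeM; apply/measurable_EFinP.
    by apply: measurable_funTS; exact: measurable_powR.
  - move=> y; rewrite in_itv/= andbT => y1; rewrite lee_fin.
    have y0 : 0 < y by lra.
    rewrite ger0_norm ?g0//; last exact: ltW.
    have -> : - (beta - 2 + 1) = 1 - beta by lra.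
    rewrite -mulr_powRN// mulrA ler_wpM2r ?powR_ge0//.
    by have /andP[] := gA y (ltW y0).
rewrite ge0_integralZl_EFin//=.
- by rewrite integral_powR_tail// ?subr_gt0// -EFinM ltry.
- by move=> y _; rewrite lee_fin powR_ge0.
- by apply/measurable_EFinP; apply: measurable_funTS; exact: measurable_powR.
Qed.

Lemma integrable_powR_weight_tail (g : R -> R) (A beta : R) : 2 < beta ->
  measurable_fun [set: R] g ->
  (forall y, 0 <= y -> 0 <= g y <= A * y) ->
  (forall y, y <= 1 -> g y = 0) ->
  mu.-integrable `[(0 : R), +oo[ (fun y => (g y * y `^ (- beta))%:E).
Proof.
move=> beta2 mg gA g0; apply: (integrable_powR_weight beta2 mg gA).
rewrite integral0_eq ?ltry// => y /=; rewrite in_itv/= => /andP[_ /g0 ->].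
by rewrite mul0r.
Qed.

(** Near 0 the integrand is at most a multiple of y^(2 - beta), integrable because beta < 3. *)
Lemma integrable_powR_weight_sqr (g : R -> R) (A beta : R) : 2 < beta -> beta < 3 ->
  measurable_fun [set: R] g ->
  (forall y, 0 <= y -> 0 <= g y <= A * y) ->
  (forall y, 0 <= y -> g y <= A * y ^+ 2) ->
  mu.-integrable `[(0 : R), +oo[ (fun y => (g y * y `^ (- beta))%:E).
Proof.
move=> beta2 beta3 mg gA gA2; apply: (integrable_powR_weight beta2 mg gA).
have A0 : 0 <= A by have /andP[h1 h2] := gA 1 ler01; rewrite mulr1 in h2; exact: le_trans h2.
apply: (@le_lt_trans _ _ (\int[mu]_(y in `]0%R, 1%R]) (A%:E * (y `^ (2 - beta))%:E))%E).
  apply: ge0_le_integral => //=.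
  - move=> y; rewrite in_itv/= lee_fin => /andP[/ltW/gA/andP[h _] _].
    by rewrite mulr_ge0// powR_ge0.
  - by apply/measurable_EFinP; apply: measurable_funTS; apply: measurable_funM.
  - apply: measurable_funeM; apply/measurable_EFinP.
    by apply: measurable_funTS; exact: measurable_powR.
  - move=> y; rewrite in_itv/= => /andP[y0 _]; rewrite lee_fin.
    have -> : 2 - beta = 1 - (beta - 1) by lra.
    rewrite -mulr_powRN// opprB -mulr_powRN//.
    by rewrite !mulrA ler_wpM2r ?powR_ge0// -mulrA -expr2 gA2// ltW.
rewrite ge0_integralZl_EFin//=.
- by rewrite integral_powR_head -?EFinM ?ltry//; lra.
- by move=> y _; rewrite lee_fin powR_ge0.
- by apply/measurable_EFinP; apply: measurable_funTS; exact: measurable_powR.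
Qed.

Lemma Rintegral_indic_powR (beta : R) : 1 < beta ->
  \int[mu]_(y in `[(0 : R), +oo[) ((1 < y)%R%:R * y `^ (- beta)) = (beta - 1)^-1.
Proof.
move=> beta1; rewrite /Rintegral -[RHS]/(fine (_%:E)); congr fine.
have -> : `[0%R, +oo[%classic = `[0%R, 1%R] `|` `]1%R, +oo[ :> set R.
  apply/seteqP; split => y /=; rewrite !in_itv/= !andbT.
    by move=> y0; case: (leP y 1) => h; [left|right]; rewrite ?y0.
  by case=> [/andP[]//|/ltW]; apply: le_trans.
have mG : measurable_fun [set: R] (fun y : R => (1 < y)%R%:R * y `^ (- beta)).
  apply: measurable_funM; last exact: measurable_powR.
  rewrite (_ : (fun y : R => _) = \1_`]1%R, +oo[%classic) //.
  by apply/funext => y; rewrite indicE mem_setE in_itv/= andbT.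
rewrite ge0_integral_setU//=; first last.
- apply/disj_setPLR => y /=; rewrite !in_itv/= andbT => /andP[_ y1].
  by apply/negP; rewrite -leNgt.
- by move=> y _; rewrite lee_fin mulr_ge0// powR_ge0.
- by apply/measurable_EFinP; exact: measurable_funTS.
rewrite integral0_eq; last first.
  by move=> y /=; rewrite in_itv/= => /andP[_ y1]; rewrite ltNge y1 mul0r.
rewrite add0e integral_itv_obnd_cbnd; last first.
  by apply/measurable_EFinP; exact: measurable_funTS.
rewrite -integral_itv_obnd_cbnd; last first.
  by apply/measurable_EFinP; exact: measurable_funTS.
under eq_integral.
  move=> y; rewrite inE/= in_itv/= andbT => y1; rewrite y1 mul1r.
  have -> : - beta = - (beta - 1 + 1) by lra.
  over.
rewrite integral_itv_obnd_cbnd; last first.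
  by apply/measurable_EFinP; apply: measurable_funTS; exact: measurable_powR.
rewrite integral_powR_tail//; last lra.
by rewrite powR1 mul1r.
Qed.

End Calculus.

(** * The Laplace exponent of the stable law as a Gamma value *)

Section GammaIdentity.
Context {R : realType}.
Local Notation mu := (@lebesgue_measure R).

Lemma patch0E {T : Type} (D : set T) (f : T -> \bar R) (x : T) :
  (f \_ D) x = if x \in D then f x else 0%E.
Proof. by rewrite patchE. Qed.

Lemma measurable_gt (a : R) : measurable_fun [set: R] (fun y : R => (a < y)%R%:R : R).
Proof.
rewrite (_ : (fun y : R => _) = \1_`]a, +oo[%classic) //.
by apply/funext => y; rewrite indicE mem_setE in_itv/= andbT.
Qed.

Lemma continuous_expRN (x : R) : {for x, continuous (fun y => expR (- y))}.
Proof.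
by move=> y; apply: continuous_comp; [exact: opp_continuous|exact: continuous_expR].
Qed.

Lemma is_derive_expRN (x : R) : is_derive x 1 (fun y => expR (- y)) (- expR (- x)).
Proof.
by apply: is_derive_eq; rewrite mulrN1.
Qed.

(** Taylor's formula with integral remainder; it exhibits the Laplace exponent as a superposition of
    the functions (y - v)^+. *)
Lemma integral_expRN_weight (y : R) : 0 < y ->
  (\int[mu]_(v in `[0%R, y]) ((y - v) * expR (- v))%:E = (expR (- y) - 1 + y)%:E)%E.
Proof.
move=> y0; pose F (v : R) := expR (- v) - (y - v) * expR (- v).
have dF (v : R) : 0 <= v <= y -> is_derive v 1 F ((y - v) * expR (- v)).
  by move=> _; apply: is_derive_eq; rewrite /GRing.scale/=; ring.
have cf (v : R) : 0 <= v <= y -> {for v, continuous (fun v => (y - v) * expR (- v))}.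
  move=> _; apply: cvgM; last exact: continuous_expRN.
  by apply: cvgB; [exact: cvg_cst|exact: cvg_id].
rewrite (FTC_cc y0 dF cf) -EFinB; congr EFin.
by rewrite /F oppr0 expR0; ring.
Qed.

Lemma integral_tail_weight (v beta : R) : 2 < beta -> 0 < v ->
  (\int[mu]_(y in `[v, +oo[) ((y - v) * y `^ (- beta))%:E =
   (((beta - 1) * (beta - 2))^-1 * v `^ (2 - beta))%:E)%E.
Proof.
move=> beta2 v0.
pose F (y : R) := - (beta - 2)^-1 * y `^ (2 - beta) + v * (beta - 1)^-1 * y `^ (1 - beta).
have b1 : beta - 1 != 0 by rewrite gt_eqF//; lra.
have b2 : beta - 2 != 0 by rewrite gt_eqF//; lra.
have dF (y : R) : v <= y -> is_derive y 1 F ((y - v) * y `^ (- beta)).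
  move=> vy; have y0 : 0 < y by exact: lt_le_trans vy.
  have h := is_deriveD (is_derive_powRZ (- (beta - 2)^-1) (2 - beta) y0)
    (is_derive_powRZ (v * (beta - 1)^-1) (1 - beta) y0).
  apply: (is_derive_eq h).
  have -> : 2 - beta - 1 = 1 - beta by ring.
  have -> : 1 - beta - 1 = - beta by ring.
  by rewrite -(mulr_powRN _ y0); field; apply/andP.
have cf (y : R) : v <= y -> {for y, continuous (fun y => (y - v) * y `^ (- beta))}.
  move=> vy; apply: cvgM; first by apply: cvgB; [exact: cvg_id|exact: cvg_cst].
  by apply: ge0_powR_continuous; exact: lt_le_trans vy.
have Fl : F y @[y --> +oo] --> 0.
  have h : F y @[y --> +oo] --> - (beta - 2)^-1 * 0 + v * (beta - 1)^-1 * 0.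
    apply: cvgD; apply: cvgMl_tmp.
      by rewrite -opprB; apply: powRN_cvgy; lra.
    by rewrite -opprB; apply: powRN_cvgy; lra.
  by rewrite !mulr0 addr0 in h.
rewrite (FTC_cy _ dF cf Fl); last first.
  by move=> y vy; rewrite mulr_ge0 ?powR_ge0// subr_ge0.
rewrite -EFinB; congr EFin; rewrite /F.
have -> : v `^ (2 - beta) = v * v `^ (1 - beta).
  rewrite (_ : 1 - beta = - (beta - 1)); last by ring.
  by rewrite mulr_powRN//; congr (_ `^ _); ring.
by field; apply/andP.
Qed.

(** Tonelli for the kernel (y - v)^+ exp(-v) y^(-beta): integrating over v first gives the left
    side, over y first the right side. The equality is one of extended reals. *)
Lemma integral_Laplace_exponent (beta : R) : 2 < beta ->
  (\int[mu]_(y in `[0%R, +oo[) ((expR (- y) - 1 + y) * y `^ (- beta))%:E =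
   (((beta - 1) * (beta - 2))^-1)%:E *
     \int[mu]_(x in [set x : R | (0 < x)%R]) (x `^ (2 - beta) * expR (- x))%:E)%E.
Proof.
move=> beta2.
pose P (y : R) := (0 < y)%R%:R * y `^ (- beta).
pose E (v : R) := (0 < v)%R%:R * expR (- v).
(* The maximum encodes the region v <= y, and [P] and [E] the positive half-lines, so that the
   double integral runs over the whole plane. *)
pose f (z : R * R) := (P z.1 * E z.2 * Num.max (z.1 - z.2) 0)%:E.
have P0 y : 0 <= P y by rewrite mulr_ge0// powR_ge0.
have E0 v : 0 <= E v by rewrite mulr_ge0// expR_ge0.
have phi0 (y : R) : 0 <= expR (- y) - 1 + y.
  by have := expR_ge1Dx (- y); lra.
have mexpN : measurable_fun [set: R] (fun y : R => expR (- y)).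
  by apply: measurableT_comp => //; exact: measurable_expR.
have mP : measurable_fun [set: R] P.
  by apply: measurable_funM; [exact: measurable_gt|exact: measurable_powR].
have mE : measurable_fun [set: R] E.
  by apply: measurable_funM => //; exact: measurable_gt.
have f0 z : (0 <= f z)%E.
  rewrite /f lee_fin; apply: mulr_ge0; first exact: mulr_ge0.
  by rewrite le_max lexx orbT.
have mf : measurable_fun [set: R * R] f.
  apply/measurable_EFinP; apply: measurable_funM.
    by apply: measurable_funM; apply: measurableT_comp.
  by apply: measurable_maxr => //; apply: measurable_funB.
have := @fubini_tonelli _ _ _ _ R mu mu f mf f0.
have inner1 (y : R) : (\int[mu]_v f (y, v) = (P y * (expR (- y) - 1 + y))%:E)%E.
  have [y0|y0] := leP y 0.
    rewrite integral0_eq; first by rewrite /P ltNge y0/= !mul0r.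
    by move=> v _; rewrite /f /P/= ltNge y0/= !mul0r.
  rewrite EFinM -integral_expRN_weight//.
  rewrite -integral_itv_obnd_cbnd; last first.
    apply/measurable_EFinP; apply: measurable_funTS; apply: measurable_funM => //.
    exact: measurable_funB.
  rewrite [in RHS]integral_mkcond -ge0_integralZl_EFin//=.
  - apply: eq_integral => v _; rewrite /f /E patch0E mem_setE in_itv/=.
    case: (ltP 0 v) => v0; last by rewrite /= !mul0r !mulr0 mul0r mule0.
    case: (leP v y) => vy /=.
      by rewrite -EFinM; congr EFin; rewrite max_l ?subr_ge0// mul1r -mulrA [_ * (y - v)]mulrC.
    by rewrite max_r ?mulr0 ?mule0// subr_le0 ltW.
  - move=> v _; rewrite patch0E; case: ifPn => //; rewrite mem_setE in_itv/= => /andP[_ vy].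
    by rewrite lee_fin mulr_ge0 ?expR_ge0// subr_ge0.
  - apply/(measurable_restrictT _ _).1 => //; apply/measurable_EFinP; apply: measurable_funTS.
    by apply: measurable_funM => //; exact: measurable_funB.
have inner2 (v : R) : (\int[mu]_y f (y, v) =
   (((beta - 1) * (beta - 2))^-1 * (E v * v `^ (2 - beta)))%:E)%E.
  have [v0|v0] := leP v 0.
    rewrite integral0_eq; first by rewrite /E ltNge v0/= !mul0r mulr0.
    by move=> y _; rewrite /f /E/= ltNge v0/= !mul0r mulr0 mul0r.
  rewrite mulrCA EFinM -integral_tail_weight//.
  rewrite [in RHS]integral_mkcond -ge0_integralZl_EFin//=.
  - apply: eq_integral => y _; rewrite /f /P patch0E mem_setE in_itv/= andbT.
    case: (leP v y) => vy /=.
      rewrite -EFinM; congr EFin; rewrite max_l ?subr_ge0// (lt_le_trans v0 vy) mul1r.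
      by rewrite mulrC mulrA [_ * E v]mulrC -mulrA.
    by rewrite max_r ?mulr0 ?mule0// subr_le0 ltW.
  - move=> y _; rewrite patch0E; case: ifPn => //; rewrite mem_setE in_itv/= andbT => vy.
    by rewrite lee_fin mulr_ge0 ?powR_ge0// subr_ge0.
  - apply/(measurable_restrictT _ _).1 => //; apply/measurable_EFinP; apply: measurable_funTS.
    by apply: measurable_funM; [exact: measurable_funB|exact: measurable_powR].
under eq_integral do rewrite inner1.
under [X in _ = X -> _]eq_integral do rewrite inner2.
move=> H.
rewrite -integral_itv_obnd_cbnd; last first.
  apply/measurable_EFinP; apply: measurable_funTS; apply: measurable_funM => //.
  by apply: measurable_funD => //; exact: measurable_funB.
transitivity (\int[mu]_x (P x * (expR (- x) - 1 + x))%:E)%E.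
  rewrite integral_mkcond; apply: eq_integral => y _.
  rewrite patch0E mem_setE in_itv/= andbT /P; case: ifP => _; last by rewrite !mul0r.
  by rewrite mul1r mulrC.
rewrite H.
have -> : [set x : R | 0 < x] = `]0, +oo[%classic.
  by apply/seteqP; split => x; rewrite /= in_itv/= andbT.
rewrite [in RHS]integral_mkcond -ge0_integralZl_EFin//=.
- apply: eq_integral => y _.
  rewrite patch0E mem_setE in_itv/= andbT /E; case: ifP => _; last by rewrite !mul0r mulr0 mule0.
  by rewrite mul1r EFinM [expR _ * _]mulrC.
- move=> v _; rewrite patch0E; case: ifPn => // _.
  by rewrite lee_fin mulr_ge0 ?powR_ge0 ?expR_ge0.
- apply/(measurable_restrictT _ _).1 => //; apply/measurable_EFinP; apply: measurable_funTS.
  by apply: measurable_funM => //; exact: measurable_powR.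
- by rewrite invr_ge0 mulr_ge0//; lra.
Qed.

Lemma Rintegral_Laplace_exponent (beta : R) : 2 < beta -> beta < 3 ->
  \int[mu]_(y in `[(0 : R), +oo[) ((expR (- y) - 1 + y) * y `^ (- beta)) =
  GammaR (- (beta - 1)).
Proof.
move=> beta2 beta3.
rewrite /Rintegral integral_Laplace_exponent// /GammaR.
rewrite ifF; last by apply/negbTE; rewrite -leNgt; lra.
(* For 1 < alpha < 2, [GammaR] at -alpha uses two steps of the functional equation: Gamma(2 - alpha)
   divided by (-alpha)(1 - alpha) = (beta - 1)(beta - 2). *)
have -> : Num.truncn (- - (beta - 1)) = 1%N.
  by rewrite opprK; apply: truncn_def; rewrite /=; lra.
rewrite !big_ord_recl big_ord0 /GammaInt /Rintegral.
have -> : - (beta - 1) + 2%:R - 1 = 2 - beta by ring.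
set I := (\int[_]_(_ in _) _)%E.
have -> : fine (((beta - 1) * (beta - 2))^-1%:E * I) = ((beta - 1) * (beta - 2))^-1 * fine I.
  have : (0 <= I)%E.
    by apply: integral_ge0 => x _; rewrite lee_fin mulr_ge0 ?powR_ge0 ?expR_ge0.
  case: I => //= _; rewrite mulr0 gt0_muley// lte_fin invr_gt0 mulr_gt0//; lra.
rewrite mulrC; congr (_ / _); rewrite /= /bump /=; ring.
Qed.

End GammaIdentity.

(** The study of the i.i.d. variables depends on the weights only through these facts. [rw_lim]
    provides the limits; [rw_le], valid for all k >= 1, provides the dominating functions. *)
Record regular_weight {R : realType} (p : nat -> R) (c' beta : R) : Prop := RegularWeight {
  rw_ge0 : forall k, 0 <= p k ;
  rw_sum1 : (\esum_(k in [set: nat]) (p k)%:E = 1)%E ;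
  rw_beta : 2 < beta ;
  rw_c_gt0 : 0 < c' ;
  rw_le : exists C, forall k, (0 < k)%N -> p k <= C * k%:R `^ (- beta) ;
  rw_lim : p k * (k%:R : R) `^ beta @[k --> \oo] --> c' }.

(** * Scaling limits of the tail, the truncated moments and the Laplace exponent *)

Section Scaling.
Context {R : realType}.
Variables (p : nat -> R) (c' beta : R).
Hypothesis rw : regular_weight p c' beta.
Local Notation mu := (@lebesgue_measure R).
Local Notation alpha := (beta - 1).

Let p0 := rw_ge0 rw.
Let p1 := rw_sum1 rw.

Lemma summ_id : summ p (fun k => k%:R).
Proof.
rewrite (summ_nnegE p0)//.
have [C HC] := rw_le rw; have beta2 := rw_beta rw.
rewrite esum_series ?ltry//; first by move=> k; rewrite mulr_ge0.
apply: (@cvg_series_powR _ _ C (beta - 1)) => //; first lra.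
  by move=> k; rewrite mulr_ge0.
move=> k k0; have k0R : 0 < (k%:R : R) by rewrite ltr0n.
have -> : - (beta - 1) = 1 - beta by ring.
by rewrite -mulr_powRN// mulrCA mulrC ler_wpM2l// HC.
Qed.

(** The cut-off test functions used below have their jump or corner at 1, hence the one exceptional
    point. Scales not yet above 1 are replaced by max 1 s. *)
Lemma Ex_scaling (h : R -> R) (s : nat -> R) : h 0 = 0 ->
  (forall x z, 0 <= x -> x <= z -> h x <= h z) ->
  (forall y, 0 < y -> y != 1 -> {for y, continuous h}) ->
  mu.-integrable `[(0 : R), +oo[ (fun y => (h y * y `^ (- beta))%:E) ->
  s n @[n --> \oo] --> +oo ->
  (\forall n \near \oo, summ p (fun k => h (k%:R / s n))) /\
  s n `^ alpha * Ex p (fun k => h (k%:R / s n)) @[n --> \oo] -->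
    c' * \int[mu]_(y in `[(0 : R), +oo[) (h y * y `^ (- beta)).
Proof.
move=> h0 hmono hc hint soo.
pose t n := Num.max 1 (s n).
have ts : \forall n \near \oo, t n = s n.
  near=> n; rewrite /t max_r//; near: n; by move/cvgryPge : soo; apply.
have t1 n : 1 <= t n by rewrite le_max lexx.
have too : t n @[n --> \oo] --> +oo.
  apply/cvgryPge => A; near=> n; rewrite le_max; apply/orP; right.
  by near: n; move/cvgryPge : soo; apply.
have [S L] := Ex_scaling_ge1 p0 (rw_beta rw) (rw_le rw) (rw_lim rw) h0 hmono hc hint t1 too.
split; first by near=> n; rewrite -(near ts n)//; exact: S.
move: L; apply: cvg_eq_near; near=> n; by rewrite (near ts n).
Unshelve. all: by end_near. Qed.

Lemma continuous_piecewise (h g1 g2 : R -> R) (y : R) :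
  (forall z, z < 1 -> h z = g1 z) -> (forall z, 1 < z -> h z = g2 z) ->
  {for y, continuous g1} -> {for y, continuous g2} -> y != 1 -> {for y, continuous h}.
Proof.
move=> h1 h2 c1 c2; rewrite neq_lt => /orP[y1|y1]; rewrite /prop_for /continuous_at.
  rewrite h1//; move: c1; apply: cvg_eq_near; near=> z; rewrite h1//.
  by near: z; exact: lt_nbhsl.
rewrite h2//; move: c2; apply: cvg_eq_near; near=> z; rewrite h2//.
by near: z; exact: lt_nbhsr.
Unshelve. all: by end_near. Qed.

Lemma tail_scaling (s : nat -> R) : s n @[n --> \oo] --> +oo ->
  s n `^ alpha * Prq p (fun k => s n < k%:R) @[n --> \oo] --> c' / alpha.
Proof.
move=> soo.
have mh := @measurable_gt R 1.
have [||||_] := @Ex_scaling (fun y => (1 < y)%R%:R) s _ _ _ _ soo.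
- by rewrite ltr10.
- by move=> x z x0 xz; rewrite ler_nat; case: ltP => // /lt_le_trans/(_ xz) ->.
- move=> y y0; apply: (@continuous_piecewise _ (fun=> 0) (fun=> 1)).
  + by move=> z z1; rewrite ltNge (ltW z1).
  + by move=> z ->.
  + exact: cst_continuous.
  + exact: cst_continuous.
- apply: (@integrable_powR_weight_tail _ _ 1 _ (rw_beta rw) mh).
  + by move=> y y0; rewrite mul1r ler0n/=; case: ltP => // /ltW.
  + by move=> y y1; rewrite ltNge y1.
rewrite Rintegral_indic_powR; last by have := rw_beta rw; lra.
apply: cvg_eq_near; near=> n; congr (_ * _); apply: eq_Ex => k.
have sn0 : 0 < s n by near: n; move/cvgryPgt : soo; apply.
by rewrite ltr_pdivlMr// mul1r.
Unshelve. all: by end_near. Qed.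

Lemma tail_mean_scaling : exists K : R, forall s : nat -> R, s n @[n --> \oo] --> +oo ->
  s n `^ (alpha - 1) * Ex p (fun k => k%:R * (s n < k%:R)%R%:R) @[n --> \oo] --> K.
Proof.
exists (c' * \int[mu]_(y in `[(0 : R), +oo[) (y * (1 < y)%R%:R * y `^ (- beta))).
move=> s soo.
have mh : measurable_fun [set: R] (fun y : R => y * (1 < y)%R%:R).
  by apply: measurable_funM => //; exact: measurable_gt.
have [||||_] := @Ex_scaling (fun y => y * (1 < y)%R%:R) s _ _ _ _ soo.
- by rewrite mul0r.
- move=> x z x0 xz; apply: ler_pM => //.
  by rewrite ler_nat; case: ltP => // /lt_le_trans/(_ xz) ->.
- move=> y y0; apply: (@continuous_piecewise _ (fun=> 0) id).
  + by move=> z z1; rewrite ltNge (ltW z1) mulr0.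
  + by move=> z ->; rewrite mulr1.
  + exact: cst_continuous.
  + exact: cvg_id.
- apply: (@integrable_powR_weight_tail _ _ 1 _ (rw_beta rw) mh).
  + move=> y y0; rewrite mul1r mulr_ge0//=; case: ltP => _; first by rewrite mulr1.
    by rewrite mulr0.
  + by move=> y y1; rewrite ltNge y1 mulr0.
apply: cvg_eq_near; near=> n.
have sn0 : 0 < s n by near: n; move/cvgryPgt : soo; apply.
rewrite (@eq_Ex _ _ p _ (fun k => (s n)^-1 * (k%:R * (s n < k%:R)%R%:R))); last first.
  move=> k; rewrite ltr_pdivlMr// mul1r.
  by rewrite [k%:R / _]mulrC mulrA.
rewrite ExZ mulrA; congr (_ * _).
rewrite -powR_inv1; last exact: ltW.
by rewrite -powRD// (gt_eqF sn0) implybT.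
Unshelve. all: by end_near. Qed.

Lemma powRN_cvg (s : nat -> R) (a : R) : 0 < a -> s n @[n --> \oo] --> +oo ->
  s n `^ (- a) @[n --> \oo] --> (0 : R).
Proof. by move=> a0 soo; exact: (cvg_comp _ _ soo (powRN_cvgy a0)). Qed.

Lemma tail_mean_cvg0 (s : nat -> R) : s n @[n --> \oo] --> +oo ->
  Ex p (fun k => k%:R * (s n < k%:R)%R%:R) @[n --> \oo] --> 0.
Proof.
move=> soo; have [K HK] := tail_mean_scaling.
have a1 : 0 < alpha - 1 by have := rw_beta rw; lra.
have h : s n `^ (- (alpha - 1)) * (s n `^ (alpha - 1) *
    Ex p (fun k => k%:R * (s n < k%:R)%R%:R)) @[n --> \oo] --> 0 * K.
  by apply: cvgM; [exact: powRN_cvg|exact: HK].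
rewrite mul0r in h; apply: cvg_eq_near h.
near=> n.
have sn0 : 0 < s n by near: n; move/cvgryPgt : soo; apply.
by rewrite /= powRN mulKf// gt_eqF// powR_gt0.
Unshelve. all: by end_near. Qed.

(** This gives the order of the second moment of an entry cut at s; integrability of y^(2 - beta) at
    0 is where beta < 3 enters. *)
Lemma min_sqr_scaling : beta < 3 -> exists K : R, forall s : nat -> R,
  s n @[n --> \oo] --> +oo ->
  s n `^ alpha * Ex p (fun k => Num.min (k%:R / s n) 1 ^+ 2) @[n --> \oo] --> K.
Proof.
move=> beta3.
exists (c' * \int[mu]_(y in `[(0 : R), +oo[) (Num.min y 1 ^+ 2 * y `^ (- beta))).
move=> s soo.
have mh : measurable_fun [set: R] (fun y : R => Num.min y 1 ^+ 2).
  by apply: measurable_funX; exact: measurable_minr.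
have m0 (y : R) : 0 <= y -> 0 <= Num.min y 1 by move=> y0; rewrite le_min y0 ler01.
have m1 (y : R) : Num.min y 1 <= 1 by rewrite ge_min lexx orbT.
have my (y : R) : Num.min y 1 <= y by rewrite ge_min lexx.
have [||||_] := @Ex_scaling (fun y => Num.min y 1 ^+ 2) s _ _ _ _ soo.
- by rewrite min_l// expr0n.
- move=> x z x0 xz; rewrite lerXn2r ?nnegrE ?m0//; first exact: le_trans xz.
  by rewrite le_min m1 andbT (le_trans (my _)).
- move=> y y0; apply: (@continuous_piecewise _ (fun z => z ^+ 2) (fun=> 1)).
  + by move=> z z1; rewrite min_l// ltW.
  + by move=> z z1; rewrite min_r ?expr1n// ltW.
  + exact: exprn_continuous.
  + exact: cst_continuous.
- apply: (@integrable_powR_weight_sqr _ _ 1 _ (rw_beta rw) beta3 mh).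
  + move=> y y0; rewrite exprn_ge0 ?m0//= mul1r expr2.
    by rewrite -[leRHS]mulr1; apply: ler_pM; rewrite ?m0.
  + by move=> y y0; rewrite mul1r lerXn2r ?nnegrE ?m0.
by apply.
Qed.

Lemma Laplace_scaling (s : nat -> R) : beta < 3 -> s n @[n --> \oo] --> +oo ->
  s n `^ alpha * Ex p (fun k => expR (- (k%:R / s n)) - 1 + k%:R / s n) @[n --> \oo] -->
  c' * GammaR (- alpha).
Proof.
move=> beta3 soo.
have mh : measurable_fun [set: R] (fun y : R => expR (- y) - 1 + y).
  apply: measurable_funD => //; apply: measurable_funB => //.
  by apply: measurableT_comp => //; exact: measurable_expR.
have le2 (y : R) : 0 <= y -> expR (- y) - 1 + y <= y ^+ 2.
  move=> y0; rewrite expRN; have := expR_ge1Dx y => h.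
  have e0 : 0 < 1 + y by lra.
  have : (expR y)^-1 <= (1 + y)^-1 by rewrite lef_pV2 ?posrE ?expR_gt0.
  have : (1 + y)^-1 <= 1 - y + y ^+ 2.
    rewrite -[leLHS]mul1r ler_pdivrMr//.
    have -> : (1 - y + y ^+ 2) * (1 + y) = 1 + y ^+ 3 by ring.
    by rewrite lerDl exprn_ge0.
  lra.
have [||||_] := @Ex_scaling (fun y => expR (- y) - 1 + y) s _ _ _ _ soo.
- by rewrite oppr0 expR0; ring.
- move=> x z x0 xz.
  have h : expR (- x) - expR (- z) <= z - x.
    have -> : - z = - x + (x - z) by ring.
    rewrite expRD -[X in X - _]mulr1 -mulrBr.
    have h1 : 1 - expR (x - z) <= z - x by have := expR_ge1Dx (x - z); lra.
    have h2 : expR (- x) <= 1 by rewrite expR_le1 oppr_le0.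
    have h3 : 0 <= 1 - expR (x - z) by rewrite subr_ge0 expR_le1 subr_le0.
    by apply: le_trans h1; exact: ler_piMl.
  lra.
- move=> y y0 _; apply: cvgD; last exact: cvg_id.
  by apply: cvgB; [exact: continuous_expRN|exact: cvg_cst].
- apply: (@integrable_powR_weight_sqr _ _ 1 _ (rw_beta rw) beta3 mh).
  + move=> y y0; have := expR_ge1Dx (- y); rewrite mul1r => h.
    have h2 : expR (- y) <= 1 by rewrite expR_le1 oppr_le0.
    by apply/andP; split; lra.
  + by move=> y y0; rewrite mul1r le2.
by rewrite (Rintegral_Laplace_exponent (rw_beta rw) beta3).
Qed.

Lemma excess_scaling (s : nat -> R) : s n @[n --> \oo] --> +oo ->
  (\forall n \near \oo, summ p (fun k => Num.max (k%:R / s n - 1) 0)) /\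
  exists K : R,
  s n `^ alpha * Ex p (fun k => Num.max (k%:R / s n - 1) 0) @[n --> \oo] --> K.
Proof.
move=> soo.
have mh : measurable_fun [set: R] (fun y : R => Num.max (y - 1) 0).
  by apply: measurable_maxr => //; exact: measurable_funB.
have [||||S L] := @Ex_scaling (fun y => Num.max (y - 1) 0) s _ _ _ _ soo.
- by rewrite max_r// sub0r oppr_le0.
- move=> x z x0 xz; rewrite ge_max !le_max lexx orbT andbT.
  by rewrite lerD2r xz.
- move=> y y0; apply: (@continuous_piecewise _ (fun=> 0) (fun z => z - 1)).
  + by move=> z z1; rewrite max_r// subr_le0 ltW.
  + by move=> z z1; rewrite max_l// subr_ge0 ltW.
  + exact: cst_continuous.
  + by apply: cvgB; [exact: cvg_id|exact: cvg_cst].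
- apply: (@integrable_powR_weight_tail _ _ 1 _ (rw_beta rw) mh).
  + by move=> y y0; rewrite mul1r le_max lexx orbT/= ge_max y0 andbT gerBl.
  + by move=> y y1; rewrite max_r// subr_le0.
by split => //; eexists; exact: L.
Qed.

Lemma excess_exp_scaling (a : R) (s : nat -> R) : 0 <= a -> s n @[n --> \oo] --> +oo ->
  exists K : R,
  s n `^ alpha * Ex p (fun k => 1 - expR (- (a * Num.max (k%:R / s n - 1) 0))) @[n --> \oo] --> K.
Proof.
move=> a0 soo.
have mm : measurable_fun [set: R] (fun y : R => Num.max (y - 1) 0).
  by apply: measurable_maxr => //; exact: measurable_funB.
have mh : measurable_fun [set: R] (fun y : R => 1 - expR (- (a * Num.max (y - 1) 0))).
  apply: measurable_funB => //; apply: measurableT_comp; first exact: measurable_expR.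
  by apply: measurableT_comp => //; exact: measurable_funM.
have m0 (y : R) : 0 <= a * Num.max (y - 1) 0 by rewrite mulr_ge0// le_max lexx orbT.
have [||||_ L] := @Ex_scaling (fun y => 1 - expR (- (a * Num.max (y - 1) 0))) s _ _ _ _ soo.
- by rewrite max_r ?sub0r ?oppr_le0// mulr0 oppr0 expR0 subrr.
- move=> x z x0 xz; rewrite lerD2l lerN2 ler_expR lerN2 ler_wpM2l//.
  by rewrite ge_max !le_max lexx orbT andbT lerD2r xz.
- move=> y y0; apply: (@continuous_piecewise _ (fun=> 0) (fun z => 1 - expR (- (a * (z - 1))))).
  + by move=> z z1; rewrite max_r ?subr_le0 ?ltW// mulr0 oppr0 expR0 subrr.
  + by move=> z z1; rewrite max_l// subr_ge0 ltW.
  + exact: cst_continuous.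
  + apply: cvgB; first exact: cvg_cst.
    apply: continuous_comp; last exact: continuous_expR.
    apply: cvgN; apply: cvgMl_tmp.
    by apply: cvgB; [exact: cvg_id|exact: cvg_cst].
- apply: (@integrable_powR_weight_tail _ _ a _ (rw_beta rw) mh).
  + move=> y y0; rewrite subr_ge0 expR_le1 oppr_le0 m0/=.
    have := expR_ge1Dx (- (a * Num.max (y - 1) 0)).
    have : a * Num.max (y - 1) 0 <= a * y.
      by rewrite ler_wpM2l// ge_max y0 andbT gerBl.
    lra.
  + by move=> y y1; rewrite max_r ?subr_le0// mulr0 oppr0 expR0 subrr.
by eexists; exact: L.
Qed.

End Scaling.

(** * Large deviations without a big jump *)

(** From exp x <= 1/(1 - x) and (1 + x + 2 x^2)(1 - x) = 1 + x^2 (1 - 2x). Arbitrarily negative x is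
    allowed. *)
Lemma expR_le_sqr {R : realType} (x : R) : x <= 2^-1 -> expR x <= 1 + x + 2 * x ^+ 2.
Proof.
move=> x1; have h := expR_ge1Dx (- x).
have e0 : 0 < 1 - x by lra.
have : (expR (- x))^-1 <= (1 - x)^-1 by rewrite lef_pV2 ?posrE ?expR_gt0.
rewrite -expRN opprK => /le_trans; apply.
rewrite -[leLHS]mul1r ler_pdivrMr//.
have -> : (1 + x + 2 * x ^+ 2) * (1 - x) = 1 + x ^+ 2 * (1 - 2 * x) by ring.
by rewrite lerDl mulr_ge0 ?sqr_ge0//; lra.
Qed.

Lemma ln_le_powR {R : realType} (x g : R) : 1 <= x -> 0 < g -> ln x <= x `^ g / g.
Proof.
move=> x1 g0; have x0 : 0 < x by lra.
rewrite ler_pdivlMr// mulrC -ln_powR; apply: ltW; apply: ln_sublinear.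
exact: powR_gt0.
Qed.

Section LargeDeviations.
Context {R : realType}.
Variables (p : nat -> R) (c' beta : R).
Hypothesis rw : regular_weight p c' beta.
Local Notation alpha := (beta - 1).
Local Notation nu := (Ex p (fun k => k%:R)).
Local Notation tmean T := (Ex p (fun k => k%:R * (T < k%:R)%R%:R)).

Let p0 := rw_ge0 rw.
Let p1 := rw_sum1 rw.
Let Q0 N := @Qn_ge0 _ p p0 N.
Let Q1 N := @Qn_sum1 _ p p0 p1 N.

Lemma summ_tail (T : R) : summ p (fun k => k%:R * (T < k%:R)%R%:R).
Proof.
apply: (summ_le _ (summ_id rw)) => k.
by rewrite normrM; case: ltP => _; rewrite ?normr1 ?mulr1// normr0 mulr0.
Qed.

Lemma mean_ge0 : 0 <= nu.
Proof. by apply: Ex_ge0. Qed.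

Lemma tmean_ge0 (T : R) : 0 <= tmean T.
Proof. by apply: Ex_ge0 => // k; rewrite mulr_ge0. Qed.

Definition allle N (a : R) (xi : {ffun 'I_N -> nat}) := [forall j, (xi j)%:R <= a].

(** Three ranges of k: up to T the quadratic term is at most 2hT times hk; between T and 1/(2h) it
    is at most hk; beyond 1/(2h) the whole exponential is at most B, hence at most 2Bhk. Each error
    is thus charged to the mean or to a tail mean. *)
Lemma truncated_exp_moment (h b B T : R) : 0 < h -> 0 <= T -> expR (h * b) <= B ->
  Ex p (fun k => expR (h * k%:R) * (k%:R <= b)%R%:R) <=
  1 + h * (nu + (2 * h * T * nu + tmean T + 2 * B * tmean (2 * h)^-1)).
Proof.
move=> h0 T0 hB.
have B0 : 0 <= B by apply: le_trans hB; exact: expR_ge0.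
have s1 := summ_id rw; have sT := summ_tail T; have sh := summ_tail (2 * h)^-1.
pose G k : R := 1 + (h * (1 + 2 * h * T)) * k%:R + h * (k%:R * (T < k%:R)%R%:R) +
   (2 * B * h) * (k%:R * ((2 * h)^-1 < k%:R)%R%:R).
have sc : summ p (fun=> 1) by apply: (summ_bd p0 p1 (C := 1)) => x; rewrite normr1.
have sG1 := summD sc (summZ (h * (1 + 2 * h * T)) s1).
have sG2 := summD sG1 (summZ h sT).
have sG := summD sG2 (summZ (2 * B * h) sh).
have EG : Ex p G = 1 + h * (nu + (2 * h * T * nu + tmean T + 2 * B * tmean (2 * h)^-1)).
  rewrite /G (ExD sG2 (summZ _ sh)) (ExD sG1 (summZ _ sT)) (ExD sc (summZ _ s1)).
  by rewrite !ExZ Ex_cst//; ring.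
rewrite -EG; apply: Ex_le => //.
  apply: (summ_bd p0 p1 (C := B)) => k; rewrite normrM ger0_norm ?expR_ge0//.
  case: (leP (k%:R : R) b) => kb; last by rewrite normr0 mulr0.
  by rewrite normr1 mulr1; apply: le_trans hB; rewrite ler_expR ler_wpM2l// ltW.
move=> k; rewrite /G.
have hk0 : 0 <= h * k%:R by rewrite mulr_ge0// ltW.
have t2 : 0 <= h * (1 + 2 * h * T) * k%:R - h * k%:R.
  have -> : h * (1 + 2 * h * T) * k%:R - h * k%:R = 2 * h * T * (h * k%:R) by ring.
  by rewrite !mulr_ge0// ltW.
have t3 (b' : bool) : 0 <= h * (k%:R * b'%:R) by rewrite !mulr_ge0// ltW.
have t4 (b' : bool) : 0 <= 2 * B * h * (k%:R * b'%:R) by rewrite !mulr_ge0// ltW.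
case: (leP (k%:R : R) b) => kb; last first.
  by rewrite mulr0 !addr_ge0// -[X in 0 <= X](subrK (h * k%:R)) addr_ge0.
rewrite mulr1.
case: (ltP ((2 * h)^-1) (k%:R : R)) => hk; last first.
  rewrite !mulr0 addr0.
  have hk2 : h * k%:R <= 2^-1.
    by rewrite -(ler_pM2l h0) invfM mulrCA divff ?gt_eqF// mulr1 in hk.
  apply: le_trans (expR_le_sqr hk2) _.
  case: (ltP T (k%:R : R)) => Tk.
    rewrite mulr1.
    have : 2 * (h * k%:R) ^+ 2 <= h * k%:R.
      rewrite expr2 mulrA -[leRHS]mul1r ler_wpM2r//; lra.
    lra.
  rewrite !mulr0 addr0 -addrA lerD2l.
  have -> : h * k%:R + 2 * (h * k%:R) ^+ 2 = h * k%:R * (1 + 2 * h * k%:R) by ring.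
  rewrite [leRHS]mulrAC; apply: ler_wpM2l => //; rewrite lerD2l ler_wpM2l//.
  by rewrite mulr_ge0// ltW.
rewrite mulr1.
have : expR (h * k%:R) <= 2 * B * h * k%:R.
  apply: (@le_trans _ _ B).
    by apply: le_trans hB; rewrite ler_expR ler_wpM2l// ltW.
  have -> : 2 * B * h * k%:R = B * (2 * h * k%:R) by ring.
  rewrite ler_peMr//.
  by have := ltW hk; rewrite -[X in X <= _]mul1r ler_pdivrMr ?mulr_gt0// mulrC.
have := t3 (T < k%:R)%R; lra.
Qed.

Lemma chernoff_bound N (h b t : R) : 0 <= h ->
  Prq (@Qn _ p N) (fun xi => (t <= (\sum_j xi j)%:R) && allle b xi) <=
  expR (- (h * t)) * Ex p (fun k => expR (h * k%:R) * (k%:R <= b)%R%:R) ^+ N.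
Proof.
move=> h0; pose g k : R := expR (h * k%:R) * (k%:R <= b)%R%:R.
have g0 k : 0 <= g k by rewrite mulr_ge0// expR_ge0.
have sg : summ p g.
  apply: (summ_bd p0 p1 (C := expR (h * b))) => k; rewrite ger0_norm// /g.
  case: (leP (k%:R : R) b) => kb; last by rewrite mulr0 expR_ge0.
  by rewrite mulr1 ler_expR ler_wpM2l.
have [sP EP] := @Ex_exp _ p p0 N g g0 sg.
rewrite -EP -ExZ; apply: Prq_markov => //; first exact: summZ.
move=> xi; case: andP => [[txi /forallP xib]|_]; last first.
  by rewrite mulr_ge0 ?expR_ge0// prodr_ge0.
rewrite /g big_split/= [X in _ * (_ * X)]big1 ?mulr1; last by move=> j _; rewrite xib.
rewrite -expR_sum -mulr_sumr -natr_sum -expRD -[leLHS]expR0 ler_expR.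
by rewrite addrC subr_ge0 ler_wpM2l.
Qed.

(** Exponential tilt by h = K ln N / N: entries at most eta N then contribute at most a
    small power of N. *)
Lemma chernoff (kappa L : R) : nu < kappa -> 0 <= L ->
  exists2 eta0 : R, 0 < eta0 & forall eta, 0 < eta -> eta <= eta0 ->
  N%:R `^ L * Prq (@Qn _ p N) (fun xi => (kappa * N%:R <= (\sum_j xi j)%:R) &&
    allle (eta * N%:R) xi) @[N --> \oo] --> (0 : R).
Proof.
move=> nuk L0; have beta2 := rw_beta rw.
have d0 : 0 < kappa - nu by rewrite subr_gt0.
(* With h = K ln N / N the bound becomes N^(-K (kappa - nu - e)) = N^(-K e); the choice K e = L + 1
   leaves one spare power of N. *)
pose e := (kappa - nu) / 2; have e0 : 0 < e by rewrite divr_gt0.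
pose K := (L + 1) / e; have K0 : 0 < K by rewrite divr_gt0//; lra.
(* An entry at most eta N has exponential weight at most N^(K eta). Keeping this below N^((alpha -
   1)/2) lets it lose against the tail mean at 1/(2h), which decays almost like N^(-(alpha - 1)). *)
exists ((alpha - 1) / 2 / K); first by rewrite !divr_gt0//; lra.
move=> eta eta0 etale.
have Keta : K * eta <= (alpha - 1) / 2 by rewrite mulrC -ler_pdivlMr.
pose h N : R := K * ln N%:R / N%:R.
have N0 : \forall N \near \oo, 1 < (N%:R : R).
  by near=> N; rewrite ltr1n; near: N; exact: nbhs_infty_gt.
(* The logarithm is absorbed through ln N <= 4 N^(1/4); any exponent strictly between 1/2 and 1
   could replace 3/4. *)
have hle : \forall N \near \oo, 0 < h N /\ h N <= (4 * K) * N%:R `^ (- (3 / 4)).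
  near=> N; have N1 : 1 < (N%:R : R) by near: N.
  have Np : 0 < (N%:R : R) by lra.
  split; first by rewrite divr_gt0// mulr_gt0// ln_gt0.
  rewrite /h -mulrA [4 * K]mulrC -[X in _ <= X]mulrA; apply: ler_wpM2l; first exact: ltW.
  have := @ln_le_powR _ N%:R 4^-1 (ltW N1) (ltac:(lra)).
  rewrite invrK => hl.
  have -> : - (3 / 4) = 4^-1 - 1 :> R by lra.
  rewrite powRB ?(gt_eqF Np) ?implybT// powRr1 ?(ltW Np)// mulrA ler_pM2r ?invr_gt0//.
  by rewrite mulrC.
have h_0 : h N @[N --> \oo] --> (0 : R).
  have z : (4 * K) * N%:R `^ (- (3 / 4)) @[N --> \oo] --> (4 * K) * 0.
    by apply: cvgMl_tmp; apply: powRN_cvg; [lra|exact: cvgr_idn].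
  rewrite mulr0 in z; apply: squeeze_cvgr (cvg_cst _) z.
  near=> N.
  have [h1 h2] : 0 < h N /\ h N <= (4 * K) * N%:R `^ (- (3 / 4)) by near: N.
  by rewrite (ltW h1).
pose s N := (2 * h N)^-1.
have soo : s N @[N --> \oo] --> +oo.
  have hz : 2 * h N @[N --> \oo] --> (2 * 0 : R) by apply: cvgMl_tmp.
  apply/gtr0_cvgV0; last first.
    rewrite mulr0 in hz; move: hz; apply: cvg_eq_near; apply: nearW => N.
    by rewrite /s /unstable.inv_fun invrK.
  near=> N; rewrite /s invr_gt0 mulr_gt0//.
  by have [] : 0 < h N /\ h N <= (4 * K) * N%:R `^ (- (3 / 4)) by near: N.
have [K1 HK1] := tail_mean_scaling rw.
have tm := HK1 _ soo.
(* The tail mean at 1/(2h) is of order (2h)^(alpha - 1), at most a multiple of N^(-3 (alpha - 1)/4);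
   after multiplication by N^((alpha - 1)/2) a factor N^(-(alpha - 1)/4) remains. *)
have Bt : N%:R `^ (K * eta) * tmean (s N) @[N --> \oo] --> (0 : R).
  pose D := (8 * K) `^ (alpha - 1).
  have z : (D * N%:R `^ (- ((alpha - 1) / 4))) * (s N `^ (alpha - 1) * tmean (s N))
      @[N --> \oo] --> (D * 0) * K1.
    apply: cvgM => //; apply: cvgMl_tmp.
    by apply: powRN_cvg; [lra|exact: cvgr_idn].
  rewrite mulr0 mul0r in z; apply: squeeze_cvgr (cvg_cst _) z.
  near=> N; rewrite mulr_ge0 ?powR_ge0 ?tmean_ge0//=.
  have N1 : 1 < (N%:R : R) by near: N.
  have Np : 0 < (N%:R : R) by lra.
  have [h1 h2] : 0 < h N /\ h N <= (4 * K) * N%:R `^ (- (3 / 4)) by near: N.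
  rewrite mulrA; apply: ler_wpM2r; first exact: tmean_ge0.
  have sp : 0 < s N by rewrite invr_gt0 mulr_gt0.
  have E1 : N%:R `^ (K * eta) <= N%:R `^ ((alpha - 1) / 2) by rewrite ler_powR// ltW.
  apply: le_trans E1 _.
  have E2 : 1 <= (8 * K * N%:R `^ (- (3 / 4)) * s N) `^ (alpha - 1).
    apply: (@le_trans _ _ (1 `^ (alpha - 1))); first by rewrite powR1.
    apply: ge0_ler_powR; rewrite ?nnegrE//; first lra.
      apply: mulr_ge0 (ltW sp); apply: mulr_ge0 (powR_ge0 _ _).
      by apply: mulr_ge0 => //; exact: ltW.
    have e1 : 2 * h N * s N = 1 by rewrite /s mulfV// gt_eqF// mulr_gt0.
    by rewrite -[leLHS]e1 ler_pM2r//; lra.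
  have K8 : 0 <= 8 * K by apply: mulr_ge0 => //; exact: ltW.
  rewrite (powRM _ (mulr_ge0 K8 (powR_ge0 _ _)) (ltW sp)) (powRM _ K8 (powR_ge0 _ _)) in E2.
  have -> : N%:R `^ ((alpha - 1) / 2) = N%:R `^ (3 / 4 * (alpha - 1)) * N%:R `^ (- ((alpha - 1) / 4)).
    by rewrite -powRD ?(gt_eqF Np) ?implybT//; congr (_ `^ _); field.
  rewrite -powRrM in E2.
  have E3 : N%:R `^ (3 / 4 * (alpha - 1)) <= D * s N `^ (alpha - 1).
    rewrite mulNr powRN mulrAC ler_pdivlMr ?powR_gt0// mul1r in E2.
    exact: E2.
  rewrite [leRHS]mulrAC; apply: ler_wpM2r E3; exact: powR_ge0.
have e40 : 0 < e / 4 by rewrite divr_gt0.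
have [T T0 HT] : exists2 T : R, 0 <= T & tmean T <= e / 4.
  have z := tail_mean_cvg0 rw (@cvgr_idn R).
  have [M _ HM] := cvgr_le _ z _ e40.
  by exists M%:R => //; exact: (HM M (leqnn M)).
have z1 : \forall N \near \oo, h N * (2 * T * nu) <= e / 4.
  have z : h N * (2 * T * nu) @[N --> \oo] --> 0 * (2 * T * nu) by apply: cvgMr_tmp.
  by rewrite mul0r in z; exact: (cvgr_le _ z _ e40).
have z2 : \forall N \near \oo, N%:R `^ (K * eta) * tmean (s N) <= e / 4.
  exact: (cvgr_le _ Bt _ e40).
(* The three error terms of [truncated_exp_moment] use up e/4, e/4 and twice e/4. *)
have mom : \forall N \near \oo,
    Ex p (fun k => expR (h N * k%:R) * (k%:R <= eta * N%:R)%R%:R) <= 1 + h N * (nu + e).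
  near=> N.
  have N1 : 1 < (N%:R : R) by near: N.
  have Np : 0 < (N%:R : R) by lra.
  have [h1 h2] : 0 < h N /\ h N <= (4 * K) * N%:R `^ (- (3 / 4)) by near: N.
  have hB : expR (h N * (eta * N%:R)) <= N%:R `^ (K * eta).
    rewrite /powR gt_eqF// ler_expR /h le_eqVlt; apply/orP; left; apply/eqP.
    by field; rewrite gt_eqF.
  apply: le_trans (truncated_exp_moment h1 T0 hB) _.
  rewrite lerD2l; apply: ler_wpM2l; first exact: ltW.
  rewrite lerD2l.
  have a1 : h N * (2 * T * nu) <= e / 4 by near: N.
  have a2 : N%:R `^ (K * eta) * tmean (s N) <= e / 4 by near: N.
  have -> : 2 * h N * T * nu = h N * (2 * T * nu) by ring.
  rewrite -mulrA; lra.
apply: (@squeeze_cvgr _ _ _ _ (fun=> 0) (fun N => N%:R `^ (- 1))); last 2 first.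
- exact: cvg_cst.
- by apply: powRN_cvg => //; exact: cvgr_idn.
near=> N.
have N1 : 1 < (N%:R : R) by near: N.
have Np : 0 < (N%:R : R) by lra.
have [h1 h2] : 0 < h N /\ h N <= (4 * K) * N%:R `^ (- (3 / 4)) by near: N.
rewrite mulr_ge0 ?powR_ge0 ?Prq_ge0//=.
have M : Ex p (fun k => expR (h N * k%:R) * (k%:R <= eta * N%:R)%R%:R) <= expR (h N * (nu + e)).
  by apply: le_trans (expR_ge1Dx _); near: N.
have CB := @chernoff_bound N (h N) (eta * N%:R) (kappa * N%:R) (ltW h1).
apply: (@le_trans _ _ (N%:R `^ L * (expR (- (h N * (kappa * N%:R))) * expR (h N * (nu + e)) ^+ N))).
  rewrite ler_wpM2l ?powR_ge0//; apply: le_trans CB _.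
  rewrite ler_wpM2l ?expR_ge0// lerXn2r ?nnegrE ?expR_ge0//.
  by apply: Ex_ge0 => // k; rewrite mulr_ge0// expR_ge0.
rewrite -expRM_natr -expRD /powR gt_eqF// -expRD ler_expR le_eqVlt; apply/orP; left; apply/eqP.
rewrite /h /K /e; field.
by rewrite !gt_eqF.
Unshelve. all: by end_near. Qed.

End LargeDeviations.

(** * Law of large numbers for the remaining entries *)

Section LLN.
Context {R : realType}.
Variables (p : nat -> R) (c' beta : R).
Hypothesis rw : regular_weight p c' beta.
Local Notation alpha := (beta - 1).
Local Notation nu := (Ex p (fun k => k%:R)).
Local Notation tmean T := (Ex p (fun k => k%:R * (T < k%:R)%R%:R)).

Let p0 := rw_ge0 rw.
Let p1 := rw_sum1 rw.
Let Q0 N := @Qn_ge0 _ p p0 N.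
Let Q1 N := @Qn_sum1 _ p p0 p1 N.

Lemma Prq_coord N (i : 'I_N) (B : pred nat) :
  Prq (@Qn _ p N) (fun xi => B (xi i)) = Prq p B.
Proof.
pose g (j : 'I_N) (k : nat) : R := if j == i then (B k)%:R else 1.
have g0 j k : 0 <= g j k by rewrite /g; case: ifP.
have sg j : summ p (g j).
  rewrite /g; case: (j == i); first exact: summ_nat.
  exact: (summ_nat p0 p1 xpredT).
have [_ E] := @Ex_prod _ p p0 N g g0 sg.
transitivity (Ex (@Qn _ p N) (fun xi => \prod_j g j (xi j))).
  apply: eq_Ex => xi; rewrite (bigD1 i)//= big1 ?mulr1 /g ?eqxx//.
  by move=> j /negbTE ->.
rewrite E (bigD1 i)//= big1 ?mulr1 /g ?eqxx// => j /negbTE ->.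
exact: Ex_cst.
Qed.

Lemma Prq_not_allle N (a : R) :
  Prq (@Qn _ p N) (fun xi => ~~ allle a xi) <= N%:R * Prq p (fun k => a < k%:R).
Proof.
have [s E] := @Ex_sum _ _ (@Qn _ p N) _ (index_enum 'I_N) xpredT
  (fun j xi => ((a < (xi j)%:R)%R%:R)) (fun j _ => summ_nat (@Q0 N) (@Q1 N) _).
apply: (@le_trans _ _ (Ex (@Qn _ p N) (fun xi => \sum_j (a < (xi j)%:R)%R%:R))).
  apply: Prq_markov => // xi.
  case: (boolP (allle a xi)) => [_|]; first by rewrite sumr_ge0.
  rewrite negb_forall => /existsP[j]; rewrite -ltNge => aj.
  by rewrite (bigD1 j)//= aj lerDl sumr_ge0.
rewrite E (eq_bigr (fun=> Prq p (fun k => a < k%:R))); last first.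
  by move=> j _; exact: (@Prq_coord N j (fun k => a < k%:R)).
by rewrite sumr_const card_ord mulr_natl.
Qed.

(** By the union bound the probability is at most of order N (eta N)^(-alpha), and alpha > 1. *)
Lemma max_cvg0 (eta : R) : 0 < eta ->
  Prq (@Qn _ p N) (fun xi => ~~ allle (eta * N%:R) xi) @[N --> \oo] --> (0 : R).
Proof.
move=> eta0; have beta2 := rw_beta rw.
have soo : eta * N%:R @[N --> \oo] --> +oo.
  apply/cvgryPge => A; near=> N; rewrite -ler_pdivrMl//; near: N.
  exact: nbhs_infty_ger.
have ts := tail_scaling rw soo.
have z : (eta `^ (- alpha) * N%:R `^ (- (alpha - 1))) * ((eta * N%:R) `^ alpha *
    Prq p (fun k => eta * N%:R < k%:R)) @[N --> \oo] --> (eta `^ (- alpha) * 0) * (c' / alpha).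
  by apply: cvgM => //; apply: cvgMl_tmp; apply: powRN_cvg; [lra|exact: cvgr_idn].
rewrite mulr0 mul0r in z; apply: squeeze_cvgr (cvg_cst _) z.
near=> N; rewrite Prq_ge0//=; apply: le_trans (Prq_not_allle _ _) _.
have N0 : 0 < (N%:R : R) by rewrite ltr0n; near: N; exact: nbhs_infty_gt.
rewrite mulrA le_eqVlt; apply/orP; left; apply/eqP; congr (_ * _).
rewrite powRM ?(ltW eta0)// powRN.
rewrite mulrACA mulVf ?mul1r; last by rewrite gt_eqF// powR_gt0.
rewrite -powRD ?(gt_eqF N0) ?implybT//.
by rewrite (_ : _ + _ = 1) ?powRr1//; ring.
Unshelve. all: by end_near. Qed.

Lemma expRN_le (x T : R) : 0 <= x -> expR (- x) <= 1 - x + x * Num.min 1 x.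
Proof.
move=> x0; have [x1|x1] := leP 1 x.
  by rewrite mulr1 subrK expR_le1 oppr_le0.
rewrite expRN; have h := expR_ge1Dx x; have e0 : 0 < 1 + x by lra.
have : (expR x)^-1 <= (1 + x)^-1 by rewrite lef_pV2 ?posrE ?expR_gt0.
move/le_trans; apply; rewrite -[leLHS]mul1r ler_pdivrMr//.
have -> : (1 - x + x * x) * (1 + x) = 1 + x * x * x by ring.
by rewrite lerDl !mulr_ge0.
Qed.

(** For nonnegative variables a lower exponential bound needs only the mean. The error x min(1, x)
    at x = t k is at most t T times t k for k <= T, and at most t k beyond T, where the tail mean is
    small. Choosing t after T gives E exp(-t xi) <= 1 - t (nu - e/2), hence geometric decay. *)
Lemma lln_lower (e : R) : 0 < e ->
  Prq (@Qn _ p N) (fun xi => (\sum_j xi j)%:R <= (nu - e) * N%:R) @[N --> \oo] --> (0 : R).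
Proof.
move=> e0.
have e40 : 0 < e / 4 by rewrite divr_gt0.
have [T T0 HT] : exists2 T : R, 0 <= T & tmean T <= e / 4.
  have z := tail_mean_cvg0 rw (@cvgr_idn R).
  have [M _ HM] := cvgr_le _ z _ e40.
  by exists M%:R => //; exact: (HM M (leqnn M)).
have nu0 : 0 <= nu by exact: (mean_ge0 rw).
(* The denominator ensures t T nu <= e/4, and the added 1 keeps it positive. *)
pose t := e / 4 / (T * nu + 1).
have Tn1 : 0 < T * nu + 1 by rewrite ltr_wpDl// mulr_ge0.
have t0 : 0 < t by rewrite divr_gt0.
have tT : t * T * nu <= e / 4.
  rewrite -mulrA /t -mulrA ler_piMr ?(ltW e40)// mulrC ler_pdivrMr// mul1r lerDl ler01//.
clearbody t; pose g k : R := expR (- (t * k%:R)).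
have g0 k : 0 <= g k by exact: expR_ge0.
have sc : summ p (fun=> 1) by apply: (summ_bd p0 p1 (C := 1)) => x; rewrite normr1.
have sg : summ p g.
  apply: (summ_bd p0 p1 (C := 1)) => k; rewrite ger0_norm// expR_le1 oppr_le0.
  by rewrite mulr_ge0// ltW.
have s1 := summ_id rw; have sT := summ_tail rw T.
have sG1 := summD sc (summZ (t * (t * T - 1)) s1).
have sG := summD sG1 (summZ t sT).
have Eg : Ex p g <= 1 - t * (nu - e / 2).
  apply: (@le_trans _ _ (1 + t * (t * T - 1) * nu + t * tmean T)).
    have EG := ExD sG1 (summZ t sT).
    rewrite (ExD sc (summZ _ s1)) !ExZ (Ex_cst p0 p1) in EG.
    rewrite -EG; apply: Ex_le => // k.
    have tk : 0 <= t * k%:R by rewrite mulr_ge0// ltW.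
    apply: le_trans (expRN_le 0 tk) _.
    case: (ltP T (k%:R : R)) => Tk.
      have : t * k%:R * Num.min 1 (t * k%:R) <= t * k%:R.
        by rewrite ler_piMr// ge_min lexx.
      have : 0 <= t * T * (t * k%:R) by rewrite !mulr_ge0// ltW.
      rewrite mulr1; lra.
    have : t * k%:R * Num.min 1 (t * k%:R) <= t * k%:R * (t * T).
      rewrite ler_wpM2l// ge_min; apply/orP; right.
      by rewrite ler_wpM2l// ltW.
    rewrite !mulr0; lra.
  have : t * tmean T <= t * (e / 4) by rewrite ler_wpM2l// ltW.
  have : t * (t * T * nu) <= t * (e / 4) by rewrite ler_wpM2l// ltW.
  lra.
pose r := expR (- (t * (e / 2))).
have r1 : r < 1 by rewrite expR_lt1 oppr_lt0 mulr_gt0//; lra.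
have r0 : 0 <= r by exact: expR_ge0.
apply: (@squeeze_cvgr _ _ _ _ (fun=> 0) (fun N => r ^+ N)).
- near=> N; rewrite Prq_ge0//=.
  have [sP EP] := @Ex_exp _ p p0 N g g0 sg.
  apply: (@le_trans _ _ (expR (t * (nu - e)) ^+ N * Ex (@Qn _ p N) (fun xi => \prod_i g (xi i)))).
    rewrite -ExZ; apply: Prq_markov => //; first exact: summZ.
    move=> xi; case: (leP ((\sum_j xi j)%:R : R) ((nu - e) * N%:R)) => h; last first.
      by rewrite mulr_ge0 ?exprn_ge0 ?expR_ge0// prodr_ge0.
    rewrite -expR_sum -expRM_natr -expRD -[leLHS]expR0 ler_expR.
    rewrite sumrN -mulr_sumr -natr_sum -mulrA -mulrBr mulr_ge0 ?subr_ge0//.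
    exact: ltW.
  rewrite EP -exprMn lerXn2r ?nnegrE ?mulr_ge0 ?expR_ge0 ?Ex_ge0//.
  apply: (@le_trans _ _ (expR (t * (nu - e)) * expR (- (t * (nu - e / 2))))).
    rewrite ler_wpM2l ?expR_ge0//; apply: le_trans Eg _; exact: expR_ge1Dx.
  by rewrite -expRD ler_expR; lra.
- exact: cvg_cst.
- by apply: cvg_expr; rewrite ger0_norm.
Unshelve. all: by end_near. Qed.

(** The upper tail is heavy, so the Chernoff bound at power 0, valid for entries at most eta N, is
    combined with the absence of larger entries. *)
Lemma lln_upper (e : R) : 0 < e ->
  Prq (@Qn _ p N) (fun xi => (nu + e) * N%:R <= (\sum_j xi j)%:R) @[N --> \oo] --> (0 : R).
Proof.
move=> e0.
have [|eta eta0 H] := @chernoff _ p c' beta rw (nu + e) 0 _ (lexx _); first lra.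
have := H _ eta0 (lexx _) => {}H.
have z : N%:R `^ 0 * Prq (@Qn _ p N) (fun xi => ((nu + e) * N%:R <= (\sum_j xi j)%:R) &&
    allle (eta * N%:R) xi) + Prq (@Qn _ p N) (fun xi => ~~ allle (eta * N%:R) xi)
    @[N --> \oo] --> (0 + 0 : R) by apply: cvgD => //; exact: max_cvg0.
rewrite addr0 in z.
apply: squeeze_cvgr (cvg_cst _) z; near=> N.
rewrite Prq_ge0//= powRr0 mul1r; apply: Prq_union => // xi h.
by rewrite h /=; case: allle.
Unshelve. all: by end_near. Qed.

Definition typical (e eta : R) N (xi : {ffun 'I_N -> nat}) :=
  [&& (nu - e) * N%:R < (\sum_j xi j)%:R, (\sum_j xi j)%:R < (nu + e) * N%:R
    & allle (eta * N%:R) xi].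

Lemma typical_cvg (e eta : R) : 0 < e -> 0 < eta ->
  Prq (@Qn _ p N) (fun xi => ~~ typical e eta xi) @[N --> \oo] --> (0 : R).
Proof.
move=> e0 eta0.
have z : Prq (@Qn _ p N) (fun xi => (\sum_j xi j)%:R <= (nu - e) * N%:R) +
    (Prq (@Qn _ p N) (fun xi => (nu + e) * N%:R <= (\sum_j xi j)%:R) +
     Prq (@Qn _ p N) (fun xi => ~~ allle (eta * N%:R) xi)) @[N --> \oo] --> (0 + (0 + 0) : R).
  by apply: cvgD; [exact: lln_lower|apply: cvgD; [exact: lln_upper|exact: max_cvg0]].
rewrite !addr0 in z; apply: squeeze_cvgr (cvg_cst _) z; near=> N.
rewrite Prq_ge0//=.
apply: le_trans (lerD (lexx _) (Prq_or (@Q0 N) (@Q1 N) _ _)).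
apply: Prq_union => // xi; rewrite /typical !negb_and -!leNgt.
by [].
Unshelve. all: by end_near. Qed.

End LLN.

(** * One big jump and the local limit *)

Lemma perm_enum_lift N (i : 'I_N.+1) :
  perm_eq (enum 'I_N.+1) (i :: [seq lift i j | j <- enum 'I_N]).
Proof.
apply: uniq_perm; first exact: enum_uniq.
  rewrite cons_uniq map_inj_uniq ?enum_uniq ?andbT; last exact: lift_inj.
  by apply/mapP => -[j _ ij]; have := neq_lift i j; rewrite -ij eqxx.
move=> j; rewrite mem_enum inE; symmetry.
case: (unliftP i j) => [j' ->|->]; rewrite inE; last by rewrite eqxx.
by rewrite map_f ?orbT// mem_enum.
Qed.

(** An entry dominating the others heads the sorted list wherever it stands, so the contribution of
    a large entry does not depend on its position. *)
Lemma sort_ins N (i : 'I_N.+1) k (xi : {ffun 'I_N -> nat}) :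
  (forall j, (xi j <= k)%N) ->
  sort geq [seq ins i k xi j | j <- enum 'I_N.+1] =
  k :: sort geq [seq xi j | j <- enum 'I_N].
Proof.
move=> xik.
have gtot : total geq by move=> x y; exact: leq_total.
have gtr : transitive geq by move=> x y z xy yz; exact: leq_trans yz xy.
have gas : antisymmetric geq by move=> x y; rewrite andbC; exact: anti_leq.
apply: (sorted_eq gtr gas).
- exact: sort_sorted.
- rewrite /= path_sortedE// sort_sorted// andbT.
  by apply/allP => x; rewrite mem_sort => /mapP[j _ ->]; exact: xik.
- rewrite perm_sort; apply: perm_trans (perm_map _ (perm_enum_lift i)) _.
  rewrite /= ins_at perm_cons perm_sym perm_sort -map_comp perm_sym.
  by rewrite (eq_map (g := xi))// => j /=; rewrite ins_lift.
Qed.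

Section Decomposition.
Context {R : realType}.
Variables (p : nat -> R).
Hypothesis p0 : forall k, 0 <= p k.
Hypothesis p1 : (\esum_(k in [set: nat]) (p k)%:E = 1)%E.

Let Q0 N := @Qn_ge0 _ p p0 N.
Let Q1 N := @Qn_sum1 _ p p0 p1 N.

Lemma weight_le1 k : p k <= 1.
Proof.
rewrite -lee_fin -p1; apply: esum_ge; exists [set k]; first by split.
by rewrite fsbig_set1.
Qed.

Definition BBpr N m (A : pred (seq int)) : R :=
  Prq (@Qn _ p N) (fun y => (\sum_j y j == m)%N && A (ordvec [seq y j | j <- enum 'I_N])).

Definition rest N (i : 'I_N.+1) (y : {ffun 'I_N.+1 -> nat}) : {ffun 'I_N -> nat} :=
  [ffun j => y (lift i j)].

Lemma rest_ins N (i : 'I_N.+1) k xi : rest i (ins i k xi) = xi.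
Proof. by apply/ffunP => j; rewrite ffunE ins_lift. Qed.

Variables (N m : nat) (b : R) (typ : pred {ffun 'I_N -> nat}).
Hypothesis typ_le : forall xi, typ xi -> allle b xi.

(** Contribution to P(S_(N+1) = m) of a fixed coordinate equal to m - S_N > b, the N
    others being typical; since typical entries are at most b, these events are disjoint
    for distinct coordinates. *)
Definition BBmain (A : pred (seq int)) : R :=
  Ex (@Qn _ p N) (fun xi => if (\sum_j xi j <= m)%N then
    p (m - \sum_j xi j) * [&& typ xi, b < (m - \sum_j xi j)%N%:R & A (@xivec m N.+1 xi)]%:R
    else 0).

(** Error term for one large coordinate with an atypical remainder. The event [A] is dropped from
    it, which keeps the final error uniform in [A]. *)
Definition BBrest : R :=
  Ex (@Qn _ p N) (fun xi => if (\sum_j xi j <= m)%N then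
    p (m - \sum_j xi j) * (~~ typ xi && (b < (m - \sum_j xi j)%N%:R))%:R else 0).

(** Slicing at [i] and [sort_ins]: typical entries are at most b < m - S_N, so the sorted full
    vector is [xivec] of the remaining entries. *)
Lemma BBmain_Prq A (i : 'I_N.+1) : BBmain A =
  Prq (@Qn _ p N.+1) (fun y => (\sum_j y j == m)%N &&
    (A (ordvec [seq y j | j <- enum 'I_N.+1]) && (typ (rest i y) && (b < (y i)%:R)))).
Proof.
rewrite (@Prq_slice _ p p0 N i m (fun y => A (ordvec [seq y j | j <- enum 'I_N.+1]) &&
  (typ (rest i y) && (b < (y i)%:R)))).
apply: eq_Ex => xi; case: leqP => // sm; congr (_ * _).
rewrite rest_ins ins_at.
case: (boolP (typ xi)) => [txi|_]; last by rewrite andbF.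
have [bm|_] := ltP b; last by rewrite /= andbF.
rewrite andbT /=.
have xik j : (xi j <= m - \sum_j xi j)%N.
  rewrite -(ler_nat R) ltW//; apply: le_lt_trans bm.
  by have /forallP := typ_le txi.
rewrite /ordvec sort_ins// /xivec /= subzn//.
by case: (A _).
Qed.

Lemma BBrest_Prq (i : 'I_N.+1) : BBrest =
  Prq (@Qn _ p N.+1) (fun y => (\sum_j y j == m)%N &&
    (~~ typ (rest i y) && (b < (y i)%:R))).
Proof.
rewrite (@Prq_slice _ p p0 N i m (fun y => ~~ typ (rest i y) && (b < (y i)%:R))).
apply: eq_Ex => xi; case: leqP => // sm; congr (_ * _).
by rewrite rest_ins ins_at.
Qed.

Lemma sum_Prq (B : 'I_N.+1 -> pred {ffun 'I_N.+1 -> nat}) (v : R) :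
  (forall i, v = Prq (@Qn _ p N.+1) (B i)) ->
  summ (@Qn _ p N.+1) (fun y => \sum_i (B i y)%:R) /\
  N.+1%:R * v = Ex (@Qn _ p N.+1) (fun y => \sum_i (B i y)%:R).
Proof.
move=> vB.
have [s ->] := @Ex_sum _ _ (@Qn _ p N.+1) _ (index_enum 'I_N.+1) xpredT
  (fun i y => (B i y)%:R) (fun i _ => summ_nat (@Q0 N.+1) (@Q1 N.+1) _).
split => //; rewrite (eq_bigr (fun=> v)); last by move=> i _; rewrite (vB i).
by rewrite sumr_const card_ord mulr_natl.
Qed.

(** Two positions cannot both qualify, since a coordinate above b would be among the typical entries
    attached to the other position. The N + 1 indicators therefore add up to at most 1. *)
Lemma BBpr_ge A : N.+1%:R * BBmain A <= BBpr N.+1 m A.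
Proof.
have [s ->] := sum_Prq (BBmain_Prq A).
apply: Ex_le; [exact: Q0|exact: s|exact: (summ_nat (@Q0 _) (@Q1 _))|move=> y].
case: (boolP (\sum_j y j == m)%N) => /= _; last by rewrite big1.
case: (boolP (A _)) => /= _; last by rewrite big1.
have [/existsP[i /andP[ti bi]]|] := boolP [exists i, typ (rest i y) && (b < (y i)%:R)]; last first.
  rewrite negb_exists => /forallP h.
  by rewrite big1// => i _; rewrite (negbTE (h i)).
rewrite (bigD1 i)//= big1 ?addr0; first by rewrite ti bi.
move=> j ji; apply/eqP; rewrite pnatr_eq0 eqb0; apply/negP => /andP[_ bj].
move: ji; case: (unliftP i j) => [j' jE _|->]; last by rewrite eqxx.
have /forallP/(_ j') := typ_le ti; rewrite ffunE -jE => /le_lt_trans/(_ bj).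
by rewrite ltxx.
Qed.

(** Either all entries are at most b, or some coordinate exceeds b and its remainder is typical or
    not. *)
Lemma BBpr_le A : BBpr N.+1 m A <=
  Prq (@Qn _ p N.+1) (fun y => (\sum_j y j == m)%N && allle b y) +
  N.+1%:R * BBmain A + N.+1%:R * BBrest.
Proof.
have [s ->] := sum_Prq (BBmain_Prq A).
have [s' ->] := sum_Prq BBrest_Prq.
have sc := summ_nat (@Q0 N.+1) (@Q1 N.+1) (fun y => (\sum_j y j == m)%N && allle b y).
rewrite -(ExD sc s) -(ExD (summD sc s) s').
apply: Ex_le; [exact: Q0|exact: (summ_nat (@Q0 _) (@Q1 _))| |move=> y].
  exact: summD (summD sc s) s'.
have S0 (B : 'I_N.+1 -> bool) : 0 <= \sum_i (B i)%:R :> R by apply: sumr_ge0.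
case: (_ == m); last by rewrite /= !big1// !addr0.
case: (A _); last by rewrite /= [\sum_(i < _) 0]big1// !addr_ge0// S0.
case: (boolP (allle b y)) => [_|]; first by rewrite -addrA lerDl addr_ge0.
rewrite negb_forall add0r => /existsP[i]; rewrite -ltNge => bi.
rewrite -big_split/= (bigD1 i)//= bi !andbT.
apply: (@le_trans _ _ ((typ (rest i y))%:R + (~~ typ (rest i y))%:R)).
  by case: (typ _); rewrite ?addr0 ?add0r.
by rewrite lerDl; apply: sumr_ge0 => j _; rewrite addr_ge0.
Qed.

End Decomposition.

(** * Local limit theorem, uniformly in the event *)

Section LocalLimit.
Context {R : realType}.
Variables (p : nat -> R) (c' beta : R).
Hypothesis rw : regular_weight p c' beta.
Local Notation nu := (Ex p (fun k => k%:R)).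

Let p0 := rw_ge0 rw.
Let p1 := rw_sum1 rw.
Let Q0 N := @Qn_ge0 _ p p0 N.
Let Q1 N := @Qn_sum1 _ p p0 p1 N.

(** p_q N^beta = (p_q q^beta) (q/N)^(-beta): the first factor is near c' once q is large, which
    holds as q >= kappa N / 2, and the second is near kappa^(-beta) by continuity. *)
Lemma weight_local (kappa d : R) : 0 < kappa -> 0 < d ->
  exists2 rho : R, 0 < rho & \forall N \near \oo, forall q : nat,
    `|q%:R - kappa * N%:R| <= rho * N%:R ->
    `|p q * N%:R `^ beta - c' * kappa `^ (- beta)| <= d.
Proof.
move=> k0 d0; have c0 := rw_c_gt0 rw.
pose kb := kappa `^ (- beta); have kb0 : 0 < kb by rewrite powR_gt0.
(* If x is within r of c' and y within r <= 1 of [kb], then x y is within r (kb + 1 + c') of c'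
   [kb]. *)
pose r := Num.min 1 (d / (kb + 1 + c')).
have D0 : 0 < kb + 1 + c' by lra.
have r0 : 0 < r by rewrite lt_min ltr01 divr_gt0.
have r1 : r <= 1 by rewrite ge_min lexx.
have rd : r * (kb + 1 + c') <= d by rewrite -ler_pdivlMr// ge_min lexx orbT.
have /cvgrPdist_le/(_ _ r0)/nbhs_ballP[t /= t0 Ht] := @ge0_powR_continuous R (- beta) kappa k0.
have /cvgrPdist_le/(_ _ r0)[K _ HK] := rw_lim rw.
have rho0 : 0 < Num.min (t / 2) (kappa / 2) by rewrite lt_min !divr_gt0.
exists (Num.min (t / 2) (kappa / 2)) => //.
near=> N => q hq.
have N0 : 0 < (N%:R : R) by rewrite ltr0n; near: N; exact: nbhs_infty_gt.
have qN : `|q%:R / N%:R - kappa| <= Num.min (t / 2) (kappa / 2).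
  rewrite -(ler_pM2r N0); apply: le_trans hq.
  by rewrite -[X in _ * X](gtr0_norm N0) -normrM mulrBl divfK// gt_eqF.
have qt : `|(q%:R / N%:R) `^ (- beta) - kb| <= r.
  rewrite distrC; apply: Ht; rewrite /ball/= distrC; apply: le_lt_trans qN _.
  by rewrite gt_min; apply/orP; left; lra.
have qk : kappa / 2 <= q%:R / N%:R.
  have : `|q%:R / N%:R - kappa| <= kappa / 2 by apply: le_trans qN _; rewrite ge_min lexx orbT.
  rewrite ler_norml; lra.
have q0 : 0 < (q%:R : R).
  by rewrite -(pmulr_lgt0 _ (_ : 0 < N%:R^-1)) ?invr_gt0//; apply: lt_le_trans qk; lra.
have qKR : K%:R <= (q%:R : R).
  rewrite -(ler_pM2r (_ : 0 < N%:R^-1)) ?invr_gt0//; apply: le_trans qk.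
  rewrite ler_pdivrMr// mulrC -ler_pdivrMr; last lra.
  by near: N; exact: nbhs_infty_ger.
have pq : `|p q * q%:R `^ beta - c'| <= r.
  by rewrite distrC; apply: HK; rewrite /= -(ler_nat R).
have -> : p q * N%:R `^ beta = p q * q%:R `^ beta * (q%:R / N%:R) `^ (- beta).
  rewrite powRM ?invr_ge0 ?ltW// -powR_inv1 1?ltW// -powRrM mulrN mulN1r opprK.
  by rewrite powRN mulrA mulfK// gt_eqF// powR_gt0.
move: (p q * q%:R `^ beta) ((q%:R / N%:R) `^ (- beta)) pq qt => x y xc yk.
have -> : x * y - c' * kb = (x - c') * y + c' * (y - kb) by ring.
apply: le_trans (ler_normD _ _) _; rewrite !normrM (gtr0_norm c0).
have y1 : `|y| <= kb + 1.
  move: yk; rewrite ler_norml => /andP[h1 h2]; rewrite ler_norml; lra.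
apply: le_trans rd; rewrite mulrDr; apply: lerD.
  by apply: ler_pM.
by rewrite mulrC ler_wpM2r// ltW.
Unshelve. all: by end_near. Qed.


Lemma Ex_dist (T : choiceType) (q : T -> R) (F G : T -> R) d :
  (forall x, 0 <= q x) -> (\esum_(x in [set: T]) (q x)%:E = 1)%E ->
  summ q F -> summ q G -> (forall x, `|F x - G x| <= d) -> `|Ex q F - Ex q G| <= d.
Proof.
move=> q0 q1 sF sG FG; rewrite -(ExB sF sG).
have sd : summ q (fun=> d).
  by apply: (summ_bd q0 q1 (C := `|d|)).
have sd' : summ q (fun=> - d) by exact: summN.
rewrite ler_norml -(Ex_cst q0 q1 (- d)) -[in X in _ && X](Ex_cst q0 q1 d).
have sB := summB sF sG.
by apply/andP; split; apply: Ex_le => // x; have := FG x; rewrite ler_norml => /andP[].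
Qed.

Lemma weight_tail_le C (N q : nat) (eta : R) :
  (forall k, (0 < k)%N -> p k <= C * k%:R `^ (- beta)) ->
  0 < eta -> (0 < N)%N -> eta * N%:R < q%:R -> N%:R `^ beta * p q <= C * eta `^ (- beta).
Proof.
move=> HC eta0 N0 qN; have beta2 := rw_beta rw.
have N0' : 0 < (N%:R : R) by rewrite ltr0n.
have q0 : 0 < (q%:R : R) by apply: lt_trans qN; rewrite mulr_gt0.
have C0 : 0 <= C by have := HC 1%N isT; rewrite powR1 mulr1; apply: le_trans.
apply: (@le_trans _ _ (N%:R `^ beta * (C * q%:R `^ (- beta)))).
  by rewrite ler_wpM2l ?powR_ge0// HC// -(ltr0n R).
rewrite mulrCA ler_wpM2l//.
apply: (@le_trans _ _ (N%:R `^ beta * (eta * N%:R) `^ (- beta))).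
  rewrite ler_wpM2l ?powR_ge0//; apply: ler_powRN; [lra| |exact: ltW].
  by rewrite mulr_gt0.
rewrite (powRM _ (ltW eta0) (ltW N0')) mulrCA [N%:R `^ (- beta)]powRN mulfV ?mulr1//.
by rewrite gt_eqF// powR_gt0.
Qed.

Section Bound.
Variables (N m : nat) (eta a1 d C : R) (typ : pred {ffun 'I_N -> nat}).
Hypothesis N_gt0 : (0 < N)%N.
Hypothesis eta_gt0 : 0 < eta.
Hypothesis a1_ge0 : 0 <= a1.
Hypothesis d_ge0 : 0 <= d.
Hypothesis pC : forall k, (0 < k)%N -> p k <= C * k%:R `^ (- beta).
Hypothesis typ_le : forall xi, typ xi -> allle (eta * N%:R) xi.
Hypothesis key : forall xi, typ xi ->
  [/\ (\sum_j xi j <= m)%N, eta * N%:R < (m - \sum_j xi j)%N%:R &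
    `|p (m - \sum_j xi j)%N * N%:R `^ beta - a1| <= d].
Local Notation U A := (BBpr p N.+1 m A).
Local Notation V A := (BBmain p m (eta * N%:R) typ A).
Local Notation t := (Prq (@Qn _ p N) (fun xi => ~~ typ xi)).
Local Notation QA A := (Prq (@Qn _ p N) (fun xi => A (@xivec m N.+1 xi))).
Local Notation QtA A := (Prq (@Qn _ p N) (fun xi => typ xi && A (@xivec m N.+1 xi))).

Lemma BBmain_dist A : `|N%:R `^ beta * V A - a1 * QtA A| <= d.
Proof.
have sb (F : {ffun 'I_N -> nat} -> bool) : summ (@Qn _ p N) (fun xi =>
    if (\sum_j xi j <= m)%N then p (m - \sum_j xi j) * (F xi)%:R else 0).
  apply: (summ_bd (@Q0 N) (@Q1 N) (C := 1)) => xi; case: ifP => _; last by rewrite normr0.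
  rewrite normrM (ger0_norm (p0 _)); case: (F xi); rewrite ?normr1 ?normr0 ?mulr1 ?mulr0//.
  exact: (weight_le1 p1).
rewrite /BBmain /Prq -!ExZ; apply: Ex_dist => //.
- exact: (summZ _ (sb (fun xi => [&& typ xi,
    eta * N%:R < (m - \sum_j xi j)%N%:R & A (@xivec m N.+1 xi)]))).
- exact: summZ (summ_nat (@Q0 N) (@Q1 N) _).
move=> xi; case: (boolP (typ xi)) => [ty|_]; last first.
  by rewrite /= !mulr0 if_same mulr0 subr0 normr0.
have [-> -> h] := key ty; rewrite /=.
case: (A _); last by rewrite !mulr0 subr0 normr0.
by rewrite !mulr1 mulrC.
Qed.

(** Even for an atypical remainder the large coordinate has weight at most C (eta N)^(-beta), so a
    probability of atypicality tending to 0 without any rate is enough. *)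
Lemma BBrest_le : N%:R `^ beta * BBrest p m (eta * N%:R) typ <= C * eta `^ (- beta) * t.
Proof.
have C0 : 0 <= C by have := pC (k := 1) isT; rewrite powR1 mulr1; apply: le_trans.
have sb (F : {ffun 'I_N -> nat} -> bool) : summ (@Qn _ p N) (fun xi =>
    if (\sum_j xi j <= m)%N then p (m - \sum_j xi j) * (F xi)%:R else 0).
  apply: (summ_bd (@Q0 N) (@Q1 N) (C := 1)) => xi; case: ifP => _; last by rewrite normr0.
  rewrite normrM (ger0_norm (p0 _)); case: (F xi); rewrite ?normr1 ?normr0 ?mulr1 ?mulr0//.
  exact: (weight_le1 p1).
rewrite /BBrest /Prq -!ExZ; apply: Ex_le => //.
- exact: (summZ _ (sb (fun xi => ~~ typ xi && (eta * N%:R < (m - \sum_j xi j)%N%:R)))).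
- exact: summZ (summ_nat (@Q0 N) (@Q1 N) _).
move=> xi; case: (typ xi) => /=; first by rewrite !mulr0 if_same mulr0.
rewrite mulr1; case: ifP => _; last by rewrite mulr0 mulr_ge0// powR_ge0.
have [h|_] := ltP (eta * N%:R); last by rewrite !mulr0 mulr_ge0// powR_ge0.
by rewrite mulr1; exact: weight_tail_le.
Qed.

Lemma BBpr_dist A : `|N%:R `^ beta / N.+1%:R * U A - a1 * QA A| <=
  d + t * (a1 + C * eta `^ (- beta)) + N.+1%:R `^ beta *
  Prq (@Qn _ p N.+1) (fun y => (\sum_j y j == m)%N && allle (eta * N%:R) y).
Proof.
have C0 : 0 <= C by have := pC (k := 1) isT; rewrite powR1 mulr1; apply: le_trans.
have beta2 := rw_beta rw.
have h1 := BBpr_ge p0 p1 m typ_le A.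
have h2 := BBpr_le p0 p1 m typ_le A.
have h3 := BBmain_dist A; have h4 := BBrest_le.
set X := Prq (@Qn _ p N.+1) _ in h2 *.
have X0 : 0 <= X by exact: Prq_ge0.
set f := N%:R `^ beta / N.+1%:R.
have f0 : 0 <= f by rewrite divr_ge0 ?powR_ge0.
have fN : f * N.+1%:R = N%:R `^ beta by rewrite divfK// pnatr_eq0.
(* A crude enlargement, affordable because the Chernoff estimate holds at every power and is stated
   for the actual number N + 1 of summands. *)
have fX : f * X <= N.+1%:R `^ beta * X.
  apply: ler_wpM2r => //; rewrite ler_pdivrMr ?ltr0n//.
  apply: (@le_trans _ _ (N.+1%:R `^ beta)).
    by apply: ge0_ler_powR; rewrite ?nnegrE ?ler0n ?ler_nat//; lra.
  by rewrite ler_peMr ?powR_ge0// ler1n.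
have g1 : N%:R `^ beta * V A <= f * U A by rewrite -fN -mulrA ler_wpM2l.
have g2 : f * U A <= f * X + N%:R `^ beta * V A + N%:R `^ beta * BBrest p m (eta * N%:R) typ.
  by rewrite -fN -!(mulrA f) -!mulrDr ler_wpM2l.
have k1 : a1 * QtA A <= a1 * QA A.
  by apply: ler_wpM2l => //; apply: (Prq_le (@Q0 _) (@Q1 _)) => xi /andP[].
have k2 : a1 * QA A <= a1 * QtA A + a1 * t.
  rewrite -mulrDr; apply: ler_wpM2l => //; apply: (Prq_union (@Q0 _) (@Q1 _)) => xi ->.
  by rewrite andbT; case: (typ xi).
have t0 : 0 <= t by exact: Prq_ge0.
have tC : 0 <= C * eta `^ (- beta) * t by rewrite !mulr_ge0// powR_ge0.
have ta : 0 <= a1 * t by rewrite mulr_ge0.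
have Xb : 0 <= N.+1%:R `^ beta * X by rewrite mulr_ge0 ?powR_ge0.
have -> : t * (a1 + C * eta `^ (- beta)) = a1 * t + C * eta `^ (- beta) * t by ring.
move: h3; rewrite !ler_norml => /andP[h5 h6]; apply/andP; split; lra.
Qed.
End Bound.

Lemma local_limit (lam : R) (mm NN : nat -> nat) : nu < lam ->
  NN k @[k --> \oo] --> \oo ->
  (mm k)%:R / (NN k)%:R @[k --> \oo] --> lam ->
  forall e : R, 0 < e -> \forall k \near \oo, forall A : pred (seq int),
  `|(NN k)%:R `^ beta / (NN k).+1%:R * BBpr p (NN k).+1 (mm k) A -
    c' * (lam - nu) `^ (- beta) *
      Prq (@Qn _ p (NN k)) (fun xi => A (@xivec (mm k) (NN k).+1 xi))| <= e.
Proof.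
move=> nulam Noo mlam e e0; have beta2 := rw_beta rw; have c0 := rw_c_gt0 rw.
pose kappa := lam - nu; have k0 : 0 < kappa by rewrite subr_gt0.
pose a1 := c' * kappa `^ (- beta); have a10 : 0 < a1 by rewrite mulr_gt0// powR_gt0.
have d0 : 0 < e / 4 by rewrite divr_gt0.
have [rho0 rho00 Hrho0] := weight_local k0 d0.
(* Half of [rho] is spent on the law of large numbers and half on m/N -> lam, so m - S_N stays
   within rho N of kappa N; with [eta] at most kappa/4 it then exceeds eta N. *)
pose rho := Num.min rho0 (kappa / 2).
have rhop : 0 < rho by rewrite lt_min rho00 divr_gt0.
have rhok : rho <= kappa / 2 by rewrite ge_min lexx orbT.
(* The level midway between nu and lam is eventually below m/N; the power beta compensates the
   normalisation by N^beta. *)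
have [eta0 eta00 Heta0] := @chernoff _ p c' beta rw ((nu + lam) / 2) beta (ltac:(lra)) (ltac:(lra)).
pose eta := Num.min eta0 (kappa / 4).
have etap : 0 < eta by rewrite lt_min eta00 divr_gt0.
have etak : eta <= kappa / 4 by rewrite ge_min lexx orbT.
have CH := Heta0 eta etap (ltac:(by rewrite ge_min lexx)).
have rho2 : 0 < rho / 2 by rewrite divr_gt0.
have TY := typical_cvg rw rho2 etap.
have [C HC] := rw_le rw.
have C0 : 0 <= C by have := HC 1%N isT; rewrite powR1 mulr1; apply: le_trans.
have NSoo : (NN k).+1 @[k --> \oo] --> \oo.
  apply/cvgnyPge => B; near=> k.
  by apply: leqW; near: k; move/cvgnyPge : Noo; apply.
have ch0 : \forall k \near \oo, (NN k).+1%:R `^ beta * Prq (@Qn _ p (NN k).+1) (fun xi =>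
  ((nu + lam) / 2 * (NN k).+1%:R <= (\sum_j xi j)%:R) && allle (eta * (NN k).+1%:R) xi) <= e / 4
  := cvgr_le _ (cvg_comp _ _ NSoo CH) _ d0.
have W0 : 0 < e / 4 / (a1 + C * eta `^ (- beta) + 1).
  by rewrite divr_gt0//; have : 0 <= C * eta `^ (- beta) by [rewrite mulr_ge0// powR_ge0]; lra.
have ty0 : \forall k \near \oo, Prq (@Qn _ p (NN k)) (fun xi => ~~ @typical _ p (rho / 2) eta (NN k) xi) <=
  e / 4 / (a1 + C * eta `^ (- beta) + 1) := cvgr_le _ (cvg_comp _ _ Noo TY) _ W0.
have ml : \forall k \near \oo, `|(mm k)%:R / (NN k)%:R - lam| <= rho / 2.
  move/cvgrPdist_le : mlam => /(_ _ rho2); apply: filterS => k; by rewrite distrC.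
have pl : \forall k \near \oo, forall q : nat,
    `|q%:R - kappa * (NN k)%:R| <= rho0 * (NN k)%:R ->
    `|p q * (NN k)%:R `^ beta - a1| <= e / 4.
  exact: Noo Hrho0.
near=> k.
have N1 : (1 < NN k)%N by near: k; move/cvgnyPgt : Noo; apply.
have mk : `|(mm k)%:R / (NN k)%:R - lam| <= rho / 2 by near: k.
have plk : forall q : nat, `|q%:R - kappa * (NN k)%:R| <= rho0 * (NN k)%:R ->
    `|p q * (NN k)%:R `^ beta - a1| <= e / 4 by near: k.
have tyk : Prq (@Qn _ p (NN k)) (fun xi => ~~ @typical _ p (rho / 2) eta (NN k) xi) <=
  e / 4 / (a1 + C * eta `^ (- beta) + 1) by near: k; exact: ty0.
have chk : (NN k).+1%:R `^ beta * Prq (@Qn _ p (NN k).+1) (fun xi =>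
  ((nu + lam) / 2 * (NN k).+1%:R <= (\sum_j xi j)%:R) && allle (eta * (NN k).+1%:R) xi) <= e / 4.
  by near: k; exact: ch0.
(* This absorbs the passage from N to N + 1 entries: it ensures m >= (nu + lam)/2 times N + 1. *)
have NB : 4 * lam / kappa + 1 <= ((NN k)%:R : R) by near: k; exact: Noo (nbhs_infty_ger _).
move=> A; move: (mm k) (NN k) N1 mk plk tyk chk NB => m N N1 mk plk tyk chk NB.
have N0 : 0 < (N%:R : R) by rewrite ltr0n (ltn_trans _ N1).
have mN : `|m%:R - lam * N%:R| <= rho / 2 * N%:R.
  have -> : m%:R - lam * N%:R = (m%:R / N%:R - lam) * N%:R.
    by rewrite mulrBl divfK// gt_eqF.
  by rewrite normrM (gtr0_norm N0) ler_wpM2r// ltW.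
have rN : rho * N%:R <= kappa / 2 * N%:R by rewrite ler_wpM2r// ltW.
have eN : eta * N%:R <= kappa / 4 * N%:R by rewrite ler_wpM2r// ltW.
have kN : 0 < kappa * N%:R by rewrite mulr_gt0.
have kE : kappa * N%:R = lam * N%:R - nu * N%:R by rewrite -mulrBl.
have mN' := mN; move: mN'; rewrite ler_norml => /andP[m1 m2].
pose typ := @typical _ p (rho / 2) eta N.
have typle xi : typ xi -> allle (eta * N%:R) xi by case/and3P.
have key xi : typ xi -> [/\ (\sum_j xi j <= m)%N, eta * N%:R < (m - \sum_j xi j)%N%:R &
    `|p (m - \sum_j xi j)%N * N%:R `^ beta - a1| <= e / 4].
  move=> /and3P[h1 h2 h3].
  have sm : (\sum_j xi j <= m)%N by rewrite -(ler_nat R); lra.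
  split => //; first by rewrite natrB//; lra.
  apply: plk; apply: (@le_trans _ _ (rho * N%:R)).
    by rewrite natrB// ler_norml; lra.
  by rewrite ler_wpM2r ?ge_min ?lexx// ltW.
have CC : 0 <= C * eta `^ (- beta) by rewrite mulr_ge0// powR_ge0.
have D0 : 0 < a1 + C * eta `^ (- beta) + 1 by lra.
have := @BBpr_dist N m eta a1 (e / 4) C typ (ltnW N1) etap (ltW a10) (ltW d0) HC typle key A.
move/le_trans; apply.
rewrite ler_pdivlMr// in tyk.
set t := Prq _ _ in tyk *.
have t0 : 0 <= t by exact: Prq_ge0.
have tt : t * (a1 + C * eta `^ (- beta)) <= e / 4.
  by apply: le_trans tyk; rewrite ler_wpM2l// lerDl.
have : N.+1%:R `^ beta *
  Prq (@Qn _ p N.+1) (fun y => (\sum_j y j == m)%N && allle (eta * N%:R) y) <= e / 4.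
  apply: le_trans chk; apply: ler_wpM2l; first exact: powR_ge0.
  apply: (Prq_le (@Q0 _) (@Q1 _)) => y /andP[/eqP -> /forallP al].
  apply/andP; split; last first.
    apply/forallP => j; apply: le_trans (al j) _.
    by rewrite ler_wpM2l ?ler_nat// ltW.
  move: NB; rewrite -lerBrDr ler_pdivrMr// mulrBl mul1r -[N.+1]addn1 natrD.
  rewrite /kappa in kE rN k0 kN *; lra.
lra.
Unshelve. all: by end_near. Qed.

End LocalLimit.

(** In a decreasing list the entries above x form an initial segment. The condition 0 <= x makes the
    default 0 past the end harmless. *)
Lemma nth_sort_gt (R : realType) (s : seq nat) (x : R) i : 0 <= x ->
  (x < (nth 0%N (sort geq s) i)%:R) = (i < count (fun k => (x < k%:R)%R) s)%N.
Proof.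
move=> x0; have gtr : transitive geq by move=> a b d ab bd; exact: leq_trans bd ab.
have gtot : total geq by move=> a b; exact: leq_total.
rewrite -(@permP _ _ _ (permEl (perm_sort geq s))).
have := sort_sorted gtot s; move: (sort geq s) => {}s.
elim: s i => [|a s IH] i; first by rewrite nth_nil ltNge x0.
rewrite /= path_sortedE// => /andP[al so].
have [xa|ax] := ltP x a%:R.
  by case: i => [|i] /=; rewrite ?xa// add1n ltnS IH.
rewrite add0n (_ : count _ s = 0%N).
  apply/negbTE; rewrite -leNgt; apply: le_trans ax; rewrite ler_nat.
  case: i => [|i] //=; have [h|h] := ltnP i (size s); last by rewrite nth_default.
  by move/allP: al => /(_ _ (mem_nth 0%N h)).
apply/eqP; rewrite -leqn0 leqNgt -has_count; apply/hasPn => b /(allP al) ba.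
by rewrite -leNgt; apply: le_trans ax; rewrite ler_nat.
Qed.

Lemma count_enum_gt0 (R : realType) N (xi : {ffun 'I_N -> nat}) (x : R) :
  (0 < count (fun k => (x < k%:R)%R) [seq xi i | i <- enum 'I_N])%N = ~~ allle x xi.
Proof.
rewrite -has_count has_map /allle negb_forall; apply/hasP/existsP.
  by move=> [j _ /= h]; exists j; rewrite -ltNge.
by move=> [j]; rewrite -ltNge => h; exists j => //; rewrite mem_enum.
Qed.

(** * From i.i.d. variables to balls in boxes: partition function and first-order behaviour *)

Section Transfer.
Context {R : realType}.
Variables (w : nat -> R) (c beta : R).
Hypothesis w0 : forall k, 0 <= w k.
Hypothesis c0 : 0 < c.
Hypothesis beta2 : 2 < beta.
Hypothesis wlim : (fun k => w k / (c * (k%:R : R) `^ (- beta))) @ \oo --> (1 : R).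
Local Notation p := (pw w).
Local Notation c' := (c / Phi1 w).
Local Notation nu := (Ex p (fun k => k%:R)).

Let F0 : 0 < Phi1 w := Phi1_gt0 w0 c0 beta2 wlim.
Let p0 k : 0 <= p k := pw_ge0 w0 c0 beta2 wlim k.
Let p1 := pw_sum1 w0 c0 beta2 wlim.
Let Q0 N := @Qn_ge0 _ p p0 N.
Let Q1 N := @Qn_sum1 _ p p0 p1 N.

Lemma regular_pw : regular_weight p c' beta.
Proof.
split => //; first by rewrite divr_gt0.
- exact: pw_le w0 c0 beta2 wlim.
- exact: pw_lim wlim.
Qed.

Lemma BBsum_Prq m n (A : pred (seq nat)) :
  \sum_(y : {ffun 'I_n -> 'I_m.+1} | inBB y && A (BBvec y)) BBweight w y =
  Phi1 w ^+ n * Prq (@Qn _ p n) (fun y => (\sum_j y j == m)%N && A [seq y i | i <- enum 'I_n]).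
Proof.
rewrite -(BB_Prq p0) big_distrr/=; apply: eq_bigr => y _.
rewrite -[X in _ ^+ X]card_ord -prodr_const -big_split; apply: eq_bigr => i _.
by rewrite /pw /= mulrC divfK// gt_eqF.
Qed.

Lemma Zmn_Prq m n : Zmn w m n = Phi1 w ^+ n * Prq (@Qn _ p n) (fun y => (\sum_j y j == m)%N && true).
Proof. by rewrite -(BBsum_Prq m n xpredT); apply: eq_bigl => y; rewrite andbT. Qed.

Lemma BBprob_Prq m n (A : pred (seq nat)) : BBprob w m n A =
  Prq (@Qn _ p n) (fun y => (\sum_j y j == m)%N && A [seq y i | i <- enum 'I_n]) /
  Prq (@Qn _ p n) (fun y => (\sum_j y j == m)%N && true).
Proof.
rewrite /BBprob BBsum_Prq Zmn_Prq invfM mulrACA divff ?mul1r//.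
by rewrite expf_neq0// gt_eqF.
Qed.

Lemma Qxi_Prq m n A : Qxi w m n A = Prq (@Qn _ p n.-1) (fun xi => A (@xivec m n xi)).
Proof.
rewrite /Qxi /Prq Ex_nneg//; congr fine.
rewrite esum_mkcond; apply: eq_esum => xi _.
case: ifPn => [/set_mem/= ->|/negP h]; first by rewrite mulr1.
by case: (boolP (A _)) => [Ax|_]; [case: h; apply/mem_set|rewrite mulr0].
Qed.

Variables (lam : R) (mm nn : nat -> nat).
Hypothesis nulam : nu < lam.
Hypothesis noo : (fun k => ((nn k)%:R : R)) @ \oo --> +oo.
Hypothesis mlam : (fun k => ((mm k)%:R : R) / (nn k)%:R) @ \oo --> lam.

Let n0 : \forall k \near \oo, (1 < nn k)%N.
Proof. by move/cvgrnyP/cvgnyPgt : noo; apply. Qed.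

Lemma cvg_inv_nn : (nn k)%:R^-1 @[k --> \oo] --> (0 : R).
Proof.
apply/cvgrPdist_lt => e e0; near=> k; rewrite sub0r normrN ger0_norm ?invr_ge0//.
rewrite invf_plt ?posrE//; last by rewrite ltr0n; near: k; apply: filterS n0 => k; exact: ltnW.
by near: k; move/cvgryPgt : noo; apply.
Unshelve. all: by end_near. Qed.

Lemma pred_nn_ratio : (nn k).-1%:R / (nn k)%:R @[k --> \oo] --> (1 : R).
Proof.
rewrite -[X in _ --> X]subr0.
have z : 1 - (nn k)%:R^-1 @[k --> \oo] --> (1 - 0 : R).
  by apply: cvgB; [exact: cvg_cst|exact: cvg_inv_nn].
apply: cvg_eq_near z; near=> k.
have k1 : (1 < nn k)%N by near: k.
case: (nn k) k1 => // n _; rewrite /= -[in RHS](addrK 1 n%:R) -natr1 mulrBl divff ?mul1r//.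
Unshelve. all: by end_near. Qed.

Lemma predn_cvgy : (nn k).-1 @[k --> \oo] --> \oo.
Proof.
apply/cvgnyPge => B; near=> k.
have : (B.+1 <= nn k)%N by near: k; move/cvgrnyP/cvgnyPge : noo; apply.
by case: (nn k).
Unshelve. all: by end_near. Qed.

Lemma mm_pred_ratio : (mm k)%:R / (nn k).-1%:R @[k --> \oo] --> lam.
Proof.
rewrite -[X in _ --> X]divr1.
have z : (mm k)%:R / (nn k)%:R / ((nn k).-1%:R / (nn k)%:R) @[k --> \oo] --> lam / 1.
  by apply: cvgM => //; apply: cvgV; [exact: oner_neq0|exact: pred_nn_ratio].
apply: cvg_eq_near z; near=> k.
have k1 : (1 < nn k)%N by near: k.
have := k1; case: (nn k) k1 => // n n1 _; rewrite invf_div mulrA divfK//.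
Unshelve. all: by end_near. Qed.

Let a := c' * (lam - nu) `^ (- beta).
Let f k : R := (nn k).-1%:R `^ beta / (nn k)%:R.
Let U k (A : pred (seq int)) := Prq (@Qn _ p (nn k))
  (fun y => (\sum_j y j == mm k)%N && A (ordvec [seq y i | i <- enum 'I_(nn k)])).

Let a_gt0 : 0 < a.
Proof. by apply: mulr_gt0; [exact: divr_gt0|rewrite powR_gt0// subr_gt0]. Qed.

Lemma local_pw (e : R) : 0 < e -> \forall k \near \oo, forall A : pred (seq int),
  `|f k * U k A - a * Qxi w (mm k) (nn k) A| <= e.
Proof.
move=> e0.
have L := @local_limit _ p c' beta regular_pw lam mm (fun k => (nn k).-1) nulam predn_cvgy
  mm_pred_ratio e e0.
near=> k => A.
have k1 : (1 < nn k)%N by near: k.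
have : `|(nn k).-1%:R `^ beta / (nn k).-1.+1%:R * BBpr p (nn k).-1.+1 (mm k) A -
    c' * (lam - nu) `^ (- beta) *
      Prq (@Qn _ p (nn k).-1) (fun xi => A (@xivec (mm k) (nn k).-1.+1 xi))| <= e.
  by move: A; near: k.
by rewrite Qxi_Prq /f /U /a; case: (nn k) k1.
Unshelve. all: by end_near. Qed.

(** The sure event in the local limit gives (n-1)^beta / n times P(S_n = m) -> a; replacing n - 1 by
    n costs the factor ((n-1)/n)^beta, which tends to 1. *)
Lemma Zmn_asymptotics : (fun k => Zmn w (mm k) (nn k) /
   (c * (lam - nu) `^ (- beta) * Phi1 w ^+ (nn k).-1 * (nn k)%:R `^ (1 - beta)))
          @ \oo --> (1 : R).
Proof.
have z1 : f k * U k xpredT @[k --> \oo] --> a.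
  apply/cvgrPdist_le => e /local_pw h; near=> k.
  have : `|f k * U k xpredT - a * Qxi w (mm k) (nn k) xpredT| <= e.
    by move: xpredT; near: k.
  by rewrite Qxi_Prq distrC /Prq Ex_cst// ?mulr1.
have z2 : ((nn k).-1%:R / (nn k)%:R) `^ beta @[k --> \oo] --> (1 `^ beta : R).
  by have := cvg_comp _ _ pred_nn_ratio (@ge0_powR_continuous R beta 1 ltr01).
rewrite powR1 in z2.
have z : f k * U k xpredT / (((nn k).-1%:R / (nn k)%:R) `^ beta) / a @[k --> \oo] --> a / 1 / a.
  by apply: cvgMr_tmp; apply: cvgM => //; apply: cvgV; [exact: oner_neq0|exact: z2].
rewrite divr1 divff ?gt_eqF// in z; apply: cvg_eq_near z; near=> k.
have k1 : (1 < nn k)%N by near: k.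
rewrite Zmn_Prq /f /a -/(U k xpredT).
move: (U k xpredT) => u.
have n0' : 0 < ((nn k)%:R : R) by rewrite ltr0n ltnW.
have N0' : 0 < ((nn k).-1%:R : R) by rewrite ltr0n; case: (nn k) k1 => [|[]].
rewrite powRM ?invr_ge0 ?ler0n// -powR_inv1 ?ler0n// -powRrM mulN1r.
rewrite powRB; last by rewrite (gt_eqF n0') implybT.
rewrite !powRN !powRr1 ?ler0n//.
rewrite (_ : Phi1 w ^+ nn k = Phi1 w * Phi1 w ^+ (nn k).-1); last by rewrite -exprS prednK// ltnW.
have b1 : (nn k).-1%:R `^ beta != 0 by rewrite gt_eqF// powR_gt0.
have b2 : (nn k)%:R `^ beta != 0 by rewrite gt_eqF// powR_gt0.
have b3 : (lam - nu) `^ beta != 0 by rewrite gt_eqF// powR_gt0// subr_gt0.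
have b4 : Phi1 w ^+ (nn k).-1 != 0 by rewrite expf_neq0// gt_eqF.
by field; rewrite ?b1 ?b2 ?b3 ?b4 !gt_eqF.
Unshelve. all: by end_near. Qed.

(** Conditioning divides by the same estimate for the sure event: u/v - q = (x u - a q + (a - x v)
    q) / (x v). Both errors in the numerator are at most eps a/4, and x v >= a/2. *)
Lemma total_variation (eps : R) : 0 < eps -> \forall k \near \oo, forall A : pred (seq int),
  `|BBprob w (mm k) (nn k) (fun s => A (ordvec s)) - Qxi w (mm k) (nn k) A| <= eps.
Proof.
move=> e0; have L := local_pw; have ap := a_gt0; set a' := a in ap L; clearbody a'.
have d0 : 0 < Num.min (a' / 2) (eps * a' / 4).
  by rewrite lt_min !divr_gt0// mulr_gt0.
have := L _ d0; apply: filterS => k h A.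
have hT := h xpredT; have {h}hA := h A.
rewrite BBprob_Prq.
rewrite -[X in _ / X]/(U k xpredT) -[X in X / _]/(U k A).
have QT : Qxi w (mm k) (nn k) xpredT = 1 by rewrite Qxi_Prq /Prq Ex_cst.
have q0 : 0 <= Qxi w (mm k) (nn k) A by rewrite Qxi_Prq Prq_ge0.
have q1 : Qxi w (mm k) (nn k) A <= 1 by rewrite Qxi_Prq Prq_le1.
rewrite QT mulr1 in hT.
move: hA hT; move: (f k) (U k A) (U k xpredT) => x u v hA hT.
have ha : `|x * v - a'| <= a' / 2 by apply: le_trans hT _; rewrite ge_min lexx.
have hb : `|x * v - a'| <= eps * a' / 4 by apply: le_trans hT _; rewrite ge_min lexx orbT.
have hc : `|x * u - a' * Qxi w (mm k) (nn k) A| <= eps * a' / 4.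
  by apply: le_trans hA _; rewrite ge_min lexx orbT.
move: (Qxi _ _ _ _) q0 q1 hc => q q0 q1 hc {hA hT QT d0}.
have y0 : a' / 2 <= x * v by move: ha; rewrite ler_norml => /andP[]; lra.
have xv0 : 0 < x * v by lra.
have /andP[x0 v0] : (x != 0) && (v != 0) by rewrite -negb_or -mulf_eq0 gt_eqF.
have -> : u / v - q = (x * u - a' * q + (a' - x * v) * q) / (x * v).
  by field; rewrite x0 v0.
rewrite normrM normfV (gtr0_norm xv0) ler_pdivrMr//.
apply: le_trans (ler_normD _ _) _; rewrite normrM (ger0_norm q0) distrC [`|a' - _|]distrC.
have : `|x * v - a'| * q <= eps * a' / 4 by apply: le_trans hb; rewrite ler_piMr.
have : eps * (a' / 2) <= eps * (x * v) by rewrite ler_wpM2l// ltW.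
rewrite distrC; lra.
Qed.

(** Read on integers, because m - S_(n-1) may be negative under the i.i.d. law. *)
Definition istat j (v : seq int) : R := (nth 0 v j.-1)%:~R.

Lemma istat_ordvec j s : istat j (ordvec s) = (ordstat s j)%:R.
Proof.
rewrite /istat /ordvec /ordstat; move: (sort _ s) j.-1 => {}s i.
have [h|h] := ltnP i (size s); first by rewrite (nth_map 0%N).
by rewrite !nth_default// size_map.
Qed.

Lemma istat1_xivec m N (xi : {ffun 'I_N -> nat}) :
  istat 1 (@xivec m N.+1 xi) = m%:R - (\sum_j xi j)%:R.
Proof. by rewrite /istat/= rmorphB. Qed.

Lemma istatS_xivec m N j (xi : {ffun 'I_N -> nat}) :
  istat j.+2 (@xivec m N.+1 xi) = (nth 0%N (sort geq [seq xi i | i <- enum 'I_N]) j)%:R.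
Proof.
rewrite /istat/=; move: (sort _ _) => s.
have [h|h] := ltnP j (size s); first by rewrite (nth_map 0%N).
by rewrite !nth_default// size_map.
Qed.

(** [B] is quantified after the threshold on k, so it may vary with k, as it does for events at
    scale n^(1/alpha). *)
Lemma transfer j (eps : R) : 0 < eps -> \forall k \near \oo, forall B : pred R,
  `|BBprob w (mm k) (nn k) (fun s => B (ordstat s j)%:R) -
    Prq (@Qn _ p (nn k).-1) (fun xi => B (istat j (@xivec (mm k) (nn k).-1.+1 xi)))| <= eps.
Proof.
move=> e0; near=> k => B.
have k1 : (1 < nn k)%N by near: k.
have : `|BBprob w (mm k) (nn k) (fun s => B (istat j (ordvec s))) -
  Qxi w (mm k) (nn k) (fun v => B (istat j v))| <= eps.
  have : forall A : pred (seq int), `|BBprob w (mm k) (nn k) (fun s => A (ordvec s)) -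
    Qxi w (mm k) (nn k) A| <= eps by near: k; exact: total_variation.
  exact.
rewrite Qxi_Prq; case: (nn k) k1 => //= n _.
by rewrite (_ : (fun s => B (istat j (ordvec s))) = (fun s => B (ordstat s j)%:R))//;
  apply/funext => s; rewrite istat_ordvec.
Unshelve. all: by end_near. Qed.

Lemma transfer_cvg j (B : nat -> pred R) (l : R) :
  Prq (@Qn _ p (nn k).-1) (fun xi => B k (istat j (@xivec (mm k) (nn k).-1.+1 xi)))
    @[k --> \oo] --> l ->
  BBprob w (mm k) (nn k) (fun s => B k (ordstat s j)%:R) @[k --> \oo] --> l.
Proof.
move=> /cvgrPdist_le h; apply/cvgrPdist_le => e e0.
have e20 : 0 < e / 2 by rewrite divr_gt0.
have {}h := h _ e20; have t := transfer j e20; near=> k.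
have h1 : `|l - Prq (@Qn _ p (nn k).-1) (fun xi => B k (istat j (@xivec (mm k) (nn k).-1.+1 xi)))|
  <= e / 2 by near: k.
have h2 : `|BBprob w (mm k) (nn k) (fun s => B k (ordstat s j)%:R) -
    Prq (@Qn _ p (nn k).-1) (fun xi => B k (istat j (@xivec (mm k) (nn k).-1.+1 xi)))| <= e / 2.
  by move: (B k); near: k.
move: h1 h2; rewrite [`|BBprob _ _ _ _ - _|]distrC => h1 h2.
rewrite (splitr e); apply: le_trans (lerD h1 h2); exact: ler_distD.
Unshelve. all: by end_near. Qed.

Lemma first_order1 : cvg_prob0 (fun k => BBprob w (mm k) (nn k))
  (fun k s => ((ordstat s 1)%:R - (lam - nu) * (nn k)%:R) / (nn k)%:R).
Proof.
move=> eps e0.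
apply: (@transfer_cvg 1 (fun k y => eps < `|(y - (lam - nu) * (nn k)%:R) / (nn k)%:R|)).
(* Three errors of relative size eps/4: the deviation of S_(n-1), that of m/n from lam, and nu/n for
   centering at n - 1 instead of n. *)
have e40 : 0 < eps / 4 by rewrite divr_gt0.
have z : Prq (@Qn _ p (nn k).-1) (fun xi => (\sum_j xi j)%:R <= (nu - eps / 4) * (nn k).-1%:R) +
    Prq (@Qn _ p (nn k).-1) (fun xi => (nu + eps / 4) * (nn k).-1%:R <= (\sum_j xi j)%:R)
    @[k --> \oo] --> (0 + 0 : R).
  apply: cvgD; [have := lln_lower regular_pw e40|have := lln_upper regular_pw e40];
    exact: cvg_comp predn_cvgy.
rewrite addr0 in z; apply: squeeze_cvgr (cvg_cst _) z.
have ml : \forall k \near \oo, `|lam - (mm k)%:R / (nn k)%:R| <= eps / 4.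
  by move/cvgrPdist_le : mlam; apply.
have ni : \forall k \near \oo, `|nu| * (nn k)%:R^-1 <= eps / 4.
  have z : `|nu| * (nn k)%:R^-1 @[k --> \oo] --> (`|nu| * 0 : R).
    by apply: cvgMl_tmp; exact: cvg_inv_nn.
  by rewrite mulr0 in z; exact: cvgr_le z _ e40.
near=> k; rewrite Prq_ge0//=; apply: Prq_union => // xi.
rewrite istat1_xivec.
have k1 : (1 < nn k)%N by near: k.
have : `|lam - (mm k)%:R / (nn k)%:R| <= eps / 4 by near: k.
have : `|nu| * (nn k)%:R^-1 <= eps / 4 by near: k.
have n0' : 0 < ((nn k)%:R : R) by rewrite ltr0n ltnW.
have nE : ((nn k).-1%:R : R) = (nn k)%:R - 1.
  by rewrite -[in RHS](prednK (ltnW k1)) -natr1 addrK.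
rewrite nE; move: (nn k)%:R (mm k)%:R (\sum_j xi j)%:R n0' => n m s n0' h1 h2.
rewrite normrM normfV (gtr0_norm n0') ltr_pdivlMr//.
have {}h2 : `|lam * n - m| <= eps / 4 * n.
  have -> : lam * n - m = (lam - m / n) * n by field; rewrite gt_eqF.
  by rewrite normrM (gtr0_norm n0') ler_wpM2r// ltW.
rewrite ler_pdivrMr// in h1.
move: h2; rewrite ler_norml => /andP[h2 h3] h4.
have v1 := ler_norm nu; have v2 := ler_norm (- nu); rewrite normrN in v2.
 apply/orP; have [?|h5] := leP s ((nu - eps / 4) * (n - 1)); first by left.
right; rewrite leNgt; apply/negP => h6; move: h4; apply/negP; rewrite -leNgt ler_norml.
have : 0 < eps * n by rewrite mulr_gt0.
by move=> en; apply/andP; split; lra.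
Unshelve. all: by end_near. Qed.

Lemma first_order2 : cvg_prob0 (fun k => BBprob w (mm k) (nn k))
  (fun k s => (ordstat s 2)%:R / (nn k)%:R).
Proof.
move=> eps e0.
apply: (@transfer_cvg 2 (fun k y => eps < `|y / (nn k)%:R|)).
have z := max_cvg0 regular_pw e0.
apply: squeeze_cvgr (cvg_cst _) (cvg_comp _ _ predn_cvgy z).
near=> k; rewrite Prq_ge0//=; apply: Prq_le => // xi.
have k1 : (1 < nn k)%N by near: k.
have n0' : 0 < ((nn k)%:R : R) by rewrite ltr0n ltnW.
rewrite istatS_xivec normrM normfV (gtr0_norm n0') ltr_pdivlMr// ger0_norm// => h.
rewrite -count_enum_gt0 -nth_sort_gt; last by rewrite mulr_ge0// ltW.
apply: le_lt_trans h.
by rewrite ler_wpM2l ?ler_nat ?leq_pred// ltW.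
Unshelve. all: by end_near. Qed.

End Transfer.

(** * Order statistics *)

Section Poisson.
Context {R : realType}.

Definition poisson_cdf (i : nat) (u : R) : R :=
  expR (- u) * \sum_(l < i.+1) u ^+ l / l`!%:R.

(** Term by term the derivatives are differences of neighbouring Poisson weights and telescope. The
    surviving term is minus a Gamma density, the origin of the Gamma law of the transformed
    limits. *)
Lemma is_derive_poisson_cdf i (u : R) :
  is_derive u 1 (poisson_cdf i) (- (expR (- u) * (u ^+ i / i`!%:R))).
Proof.
elim: i => [|i IH].
  rewrite (_ : poisson_cdf 0 = fun u => expR (- u)).
    by apply: is_derive_eq; rewrite fact0 expr0 divr1 mulr1 mulrN1.
  by apply/funext => v; rewrite /poisson_cdf big_ord_recl big_ord0 fact0 expr0 divr1 addr0 mulr1.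
rewrite (_ : poisson_cdf i.+1 = poisson_cdf i \+ (fun u => expR (- u) * (u ^+ i.+1 / i.+1`!%:R))).
  have h : is_derive u 1 (fun u : R => expR (- u) * (u ^+ i.+1 / i.+1`!%:R))
    (expR (- u) * (u ^+ i / i`!%:R) - expR (- u) * (u ^+ i.+1 / i.+1`!%:R)).
    have hp := is_deriveX i.+1 (is_derive_id u (1 : R)).
    have hm := is_deriveM (is_derive_expRN u) (is_deriveZ (i.+1`!%:R^-1) hp).
    rewrite (_ : (fun u => _) = (fun y => expR (- y)) * ((i.+1`!)%:R^-1 \*: (id ^+ i.+1))).
      apply: (is_derive_eq hm); rewrite /GRing.scale/= factS natrM.
      have := fact_gt0 i; rewrite -(ltr0n R) => f0.
      have i0 : i.+1%:R != 0 :> R by rewrite pnatr_eq0.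
      rewrite exprfctE /GRing.scale/= mulr1 exprS; field.
      by rewrite gt_eqF//= nat1r.
    by apply/funext => v; rewrite /GRing.mul/= exprfctE /GRing.scale/= [X in _ * X]mulrC.
  by apply: (is_derive_eq (is_deriveD IH h)); rewrite addKr.
by apply/funext => v; rewrite /poisson_cdf big_ord_recr/= mulrDr.
Qed.

Lemma poisson_cdf0 i : poisson_cdf i 0 = 1.
Proof.
rewrite /poisson_cdf oppr0 expR0 mul1r big_ord_recl expr0 fact0 divr1 big1 ?addr0// => l _.
by rewrite lift0 expr0n mul0r.
Qed.

Lemma poisson_cdf_ge0 i (u : R) : 0 <= u -> 0 <= poisson_cdf i u.
Proof.
move=> u0; rewrite mulr_ge0 ?expR_ge0//; apply: sumr_ge0 => l _.
by rewrite divr_ge0// exprn_ge0.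
Qed.

(** This is exp v >= v at v = u/(l+1), raised to the power l + 1. *)
Lemma exprn_expRN_le l (u : R) : 0 < u -> expR (- u) * u ^+ l <= l.+1%:R ^+ l.+1 / u.
Proof.
move=> u0; rewrite ler_pdivlMr// -mulrA -exprSr expRN ler_pdivrMl ?expR_gt0//.
have -> : u = l.+1%:R * (u / l.+1%:R) by rewrite mulrC divfK// pnatr_eq0.
rewrite exprMn mulrC; apply: ler_wpM2r; first by rewrite exprn_ge0.
rewrite expRM_natl; have v0 : 0 <= u / l.+1%:R by rewrite divr_ge0// ltW.
apply: lerXn2r; rewrite ?nnegrE ?expR_ge0//.
by apply: le_trans (expR_ge1Dx _); rewrite lerDr.
Qed.

Lemma poisson_cdf_cvg0 i : poisson_cdf i u @[u --> +oo] --> (0 : R).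
Proof.
pose M : R := \sum_(l < i.+1) l.+1%:R ^+ l.+1.
have z : M * u `^ (- 1) @[u --> +oo] --> (M * 0 : R).
  by apply: cvgMl_tmp; exact: powRN_cvgy.
rewrite mulr0 in z; apply: squeeze_cvgr (cvg_cst _) z.
near=> u.
have u0 : 0 < u by near: u; exact: nbhs_pinfty_gt.
rewrite (poisson_cdf_ge0 _ (ltW u0))/= /poisson_cdf /M (powR_inv1 (ltW u0)) mulr_sumr mulr_suml.
apply: ler_sum => l _; apply: le_trans (exprn_expRN_le _ u0).
rewrite mulrA ler_pdivrMr ?ltr0n ?fact_gt0// ler_peMr//.
  by rewrite mulr_ge0 ?expR_ge0// exprn_ge0// ltW.
by rewrite ler1n fact_gt0.
Unshelve. all: by end_near. Qed.

Variables (p : nat -> R).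
Hypothesis p0 : forall k, 0 <= p k.
Hypothesis p1 : (\esum_(k in [set: nat]) (p k)%:E = 1)%E.

Let Q0 N := @Qn_ge0 _ p p0 N.
Let Q1 N := @Qn_sum1 _ p p0 p1 N.

(** The event is split according to the set of positions where [B] holds. For a given set the
    indicator is a product over coordinates, so independence applies. *)
Lemma count_binomial N (B : pred nat) (i : nat) :
  Prq (@Qn _ p N) (fun xi => count B [seq xi j | j <- enum 'I_N] == i) =
  'C(N, i)%:R * (Prq p B ^+ i * (1 - Prq p B) ^+ (N - i)).
Proof.
pose g (A : {set 'I_N}) (j : 'I_N) (k : nat) : R := ((j \in A) == B k)%:R.
have [sA EA] : summ (@Qn _ p N) (fun xi => \sum_(A : {set 'I_N} | #|A| == i) \prod_j g A j (xi j)) /\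
  Ex (@Qn _ p N) (fun xi => \sum_(A : {set 'I_N} | #|A| == i) \prod_j g A j (xi j)) =
  \sum_(A : {set 'I_N} | #|A| == i) Ex (@Qn _ p N) (fun xi => \prod_j g A j (xi j)).
  apply: Ex_sum => A _; apply: (Ex_prod p0 _ _).1 => // j.
  exact: summ_nat.
transitivity (Ex (@Qn _ p N)
    (fun xi => \sum_(A : {set 'I_N} | #|A| == i) \prod_j g A j (xi j))).
  apply: eq_Ex => xi; pose S : {set 'I_N} := [set j | B (xi j)]%SET.
  have gS A : \prod_j g A j (xi j) = (A == S)%:R.
    case: eqP => [->|AS]; first by rewrite big1// => j _; rewrite /g inE eqxx.
    have [j jA] : exists j, (j \in A) != B (xi j).
      apply/existsP; rewrite -negb_forall; apply/negP => /forallP h.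
      by case: AS; apply/setP => j; rewrite inE; apply/eqP.
    by rewrite (bigD1 j)//= /g (negbTE jA) mul0r.
  rewrite count_map -size_filter (_ : size _ = #|S|).
    have [e|ne] := eqVneq #|S| i.
      rewrite (bigD1 S) ?e//= gS eqxx big1 ?addr0// => A /andP[_ /negbTE h].
      by rewrite gS h.
    rewrite big1// => A /eqP Ai; rewrite gS; case: eqP => // AS.
    by move: ne; rewrite -Ai AS eqxx.
  have u : uniq [seq x <- enum 'I_N | preim [eta xi] B x] by rewrite filter_uniq ?enum_uniq.
  rewrite -(card_uniqP u); apply: eq_card => j.
  by rewrite mem_filter mem_enum andbT [RHS]inE.
rewrite EA (eq_bigr (fun=> Prq p B ^+ i * (1 - Prq p B) ^+ (N - i))).
  by rewrite sumr_const -[X in 'C(X, _)]card_ord -card_draws mulr_natl cardsE.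
move=> A /eqP Ai; have [_ ->] := @Ex_prod _ p p0 N (g A) (fun _ _ => ler0n _ _)
  (fun j => summ_nat p0 p1 _).
rewrite (bigID (mem A))/= (eq_bigr (fun=> Prq p B)); last first.
  by move=> j jA; apply: eq_Ex => k; rewrite /g jA.
rewrite [X in _ * X](eq_bigr (fun=> 1 - Prq p B)); last first.
  by move=> j jA; rewrite -PrqC//; apply: eq_Ex => k; rewrite /g (negbTE jA).
rewrite !prodr_const Ai; congr (_ * _ ^+ _).
by rewrite -[X in (X - _)%N]card_ord -(cardC (mem A)) Ai addKn.
Qed.

Lemma count_cdf N (B : pred nat) (i : nat) :
  Prq (@Qn _ p N) (fun xi => (count B [seq xi j | j <- enum 'I_N] <= i)%N) =
  \sum_(l < i.+1) 'C(N, l)%:R * (Prq p B ^+ l * (1 - Prq p B) ^+ (N - l)).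
Proof.
under eq_bigr do rewrite -count_binomial.
have [_ <-] := @Ex_sum _ _ (@Qn _ p N) _ (index_enum 'I_i.+1) xpredT
  (fun l xi => (count B [seq xi j | j <- enum 'I_N] == l)%:R)
  (fun l _ => summ_nat (@Q0 N) (@Q1 N) _).
apply: eq_Ex => xi; have [h|h] := leqP.
  rewrite (bigD1 (Ordinal (h : (_ < i.+1)%N)))//= eqxx big1 ?addr0// => l.
  by rewrite -val_eqE/= eq_sym => /negbTE ->.
by rewrite big1// => l _; rewrite gtn_eqF// (leq_ltn_trans _ h)// -ltnS.
Qed.

End Poisson.

(** * Poisson approximation of rare binomial counts *)

Section PoissonLimit.
Context {R : realType}.
Variables (N : nat -> nat) (q : nat -> R) (mu : R).
Hypothesis Noo : N k @[k --> \oo] --> \oo.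
Hypothesis q01 : forall k, 0 <= q k <= 1.
Hypothesis Nq : (N k)%:R * q k @[k --> \oo] --> mu.

Lemma rare_cvg0 : q k @[k --> \oo] --> (0 : R).
Proof.
have z : (N k)%:R * q k * (N k)%:R^-1 @[k --> \oo] --> mu * 0.
  apply: cvgM => //; apply/gtr0_cvgV0; last by apply/cvgrnyP.
  by near=> k; rewrite ltr0n; near: k; move/cvgnyPgt : Noo; apply.
rewrite mulr0 in z; apply: cvg_eq_near z; near=> k.
rewrite mulrC mulKf// pnatr_eq0 -lt0n; near: k; move/cvgnyPgt : Noo; apply.
Unshelve. all: by end_near. Qed.

(** Induction through (l+1) C(N, l+1) = (N - l) C(N, l), the correction l q tending to 0. *)
Lemma binomial_ffact l : 'C(N k, l)%:R * q k ^+ l @[k --> \oo] --> mu ^+ l / l`!%:R.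
Proof.
elim: l => [|l IH].
  by rewrite expr0 fact0 divr1; under eq_fun do rewrite bin0 expr0 mulr1; exact: cvg_cst.
have q0 := rare_cvg0.
have z : 'C(N k, l)%:R * q k ^+ l * (((N k)%:R * q k - l%:R * q k) / l.+1%:R) @[k --> \oo] -->
   mu ^+ l / l`!%:R * ((mu - l%:R * 0) / l.+1%:R).
  apply: cvgM => //; apply: cvgMr_tmp; apply: cvgB => //.
  by apply: cvgMl_tmp.
rewrite mulr0 subr0 in z.
have -> : mu ^+ l.+1 / l.+1`!%:R = mu ^+ l / l`!%:R * (mu / l.+1%:R).
  by rewrite exprSr factS mulnC natrM invfM mulrACA.
apply: cvg_eq_near z; near=> k.
have lN : (l <= N k)%N by near: k; move/cvgnyPge : Noo; apply.
have h : l.+1%:R * 'C(N k, l.+1)%:R = (N k - l)%:R * 'C(N k, l)%:R :> R.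
  by rewrite -!natrM mul_bin_left.
have l0 : l.+1%:R != 0 :> R by rewrite pnatr_eq0.
apply: (mulfI l0); rewrite [RHS]mulrA h natrB// exprSr.
by field.
Unshelve. all: by end_near. Qed.

(** From -q/(1 - q) <= ln(1 - q) <= -q. *)
Lemma one_minus_pow_cvg : (1 - q k) ^+ N k @[k --> \oo] --> expR (- mu).
Proof.
have q0 := rare_cvg0.
have z1 : (N k)%:R * q k / (1 - q k) @[k --> \oo] --> (mu / (1 - 0) : R).
  apply: cvgM => //; apply: cvgV; first by rewrite subr0 oner_neq0.
  by apply: cvgB => //; exact: cvg_cst.
rewrite subr0 divr1 in z1.
have z2 : (N k)%:R * ln (1 - q k) @[k --> \oo] --> - mu.
  apply: squeeze_cvgr (cvgN z1) (cvgN Nq); near=> k.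
  have qk : q k < 1 by near: k; exact: cvgr_lt q0 _ ltr01.
  have qk1 : 0 < 1 - q k by rewrite subr_gt0.
  have /andP[q00 _] := q01 k.
  apply/andP; split.
    rewrite lerNl -mulrN -mulrA ler_wpM2l// -lnV ?posrE//.
    apply: le_trans (ln_le_subr1 _) _; first by rewrite invr_gt0.
    rewrite le_eqVlt; apply/orP; left; apply/eqP; field.
    by rewrite gt_eqF.
  rewrite -mulrN ler_wpM2l//; by apply: le_trans (ln_le_subr1 qk1) _; rewrite addrAC subrr add0r.
have z3 := cvg_comp _ _ z2 (@continuous_expR R (- mu)).
apply: cvg_eq_near z3; near=> k.
have qk : q k < 1 by near: k; exact: cvgr_lt q0 _ ltr01.
by rewrite /= expRM_natl lnK// posrE subr_gt0.
Unshelve. all: by end_near. Qed.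

Lemma poisson_limit i :
  \sum_(l < i.+1) 'C(N k, l)%:R * (q k ^+ l * (1 - q k) ^+ (N k - l)) @[k --> \oo]
  --> poisson_cdf i mu.
Proof.
rewrite /poisson_cdf mulr_sumr; apply: cvgr_sum => l _.
have q0 := rare_cvg0.
have z1 : (1 - q k) ^+ l @[k --> \oo] --> (1 - 0 : R) ^+ l.
  have : 1 - q k @[k --> \oo] --> (1 - 0 : R) by apply: cvgB => //; exact: cvg_cst.
  by move=> h; have := cvg_comp _ _ h (@exprn_continuous R l (1 - 0)).
rewrite subr0 expr1n in z1.
have z : 'C(N k, l)%:R * q k ^+ l * ((1 - q k) ^+ N k / (1 - q k) ^+ l) @[k --> \oo] -->
  mu ^+ l / l`!%:R * (expR (- mu) / 1).
  apply: cvgM; first exact: binomial_ffact.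
  apply: cvgM; first exact: one_minus_pow_cvg.
  by apply: cvgV => //; exact: oner_neq0.
rewrite divr1 mulrC in z; apply: cvg_eq_near z; near=> k.
have qk : q k < 1 by near: k; exact: cvgr_lt q0 _ ltr01.
have lN : (l <= N k)%N by near: k; move/cvgnyPge : Noo; apply.
have -> : (1 - q k) ^+ N k = (1 - q k) ^+ (N k - l) * (1 - q k) ^+ l by rewrite -exprD subnK.
by rewrite mulfK ?mulrA// expf_neq0// gt_eqF// subr_gt0.
Unshelve. all: by end_near. Qed.

End PoissonLimit.

Lemma poisson_cdf_continuous {R : realType} i : continuous (@poisson_cdf R i).
Proof.
move=> u; apply: differentiable_continuous; apply/derivable1_diffP.
by have := is_derive_poisson_cdf i u => h; exact: ex_derive.
Qed.

(** * The limit laws W_j through Poisson probabilities *)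

Section LimitLaw.
Context {R : realType}.
Variables (c' a : R).
Hypothesis c0 : 0 < c'.
Hypothesis a1 : 1 < a.
Local Notation mu := (@lebesgue_measure R).
Local Notation u x := (c' / a * x `^ (- a)).

Let a0 : 0 < a. Proof. by apply: lt_trans a1. Qed.
Let ca0 : 0 < c' / a. Proof. exact: divr_gt0. Qed.

Let u_gt0 (x : R) : 0 < x -> 0 < u x.
Proof. by move=> x0; rewrite mulr_gt0// powR_gt0. Qed.

(** The event W_j <= x means that a Poisson number of exceedances of x, of mean u(x), is at most j -
    2; the chain rule turns the surviving Poisson term into the density. *)
Lemma is_derive_poisson_intensity j (x : R) : (1 < j)%N -> 0 < x ->
  is_derive x 1 (fun x => poisson_cdf (j - 2) (u x)) (Wdens c' a j x).
Proof.
move=> j2 x0.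
have h := is_derive1_comp (g := fun y => u y) (is_derive_poisson_cdf (j - 2) (u x)) (is_derive_powRZ (c' / a) (- a) x0).
apply: (is_derive_eq h); rewrite /Wdens x0 -mulNr.
have f0 : (j - 2)`!%:R != 0 :> R by rewrite pnatr_eq0 -lt0n fact_gt0.
rewrite (mulNr (c' / a)); move: (x `^ (- a - 1)) => z; move: (expR _) => e; move: (x `^ _) => y; field.
by rewrite f0 gt_eqF.
Qed.

Lemma Wdens_ge0 j (x : R) : 0 <= Wdens c' a j x.
Proof.
rewrite /Wdens; case: ltP => // x0; apply: mulr_ge0; last exact: expR_ge0.
rewrite divr_ge0// mulr_ge0//; first by rewrite mulr_ge0 ?powR_ge0// ltW.
by rewrite exprn_ge0// ltW// u_gt0.
Qed.

Lemma Wdens_continuous j (x : R) : 0 < x -> {for x, continuous (Wdens c' a j)}.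
Proof.
move=> x0.
have h : {for x, continuous (fun x : R => c' * x `^ (- a - 1) * (c' / a * x `^ (- a)) ^+ (j - 2)
      / ((j - 2)`!)%:R * expR (- (c' / a) * x `^ (- a)))}.
  have cp := @ge0_powR_continuous R (- a) x x0.
  have cp1 := @ge0_powR_continuous R (- a - 1) x x0.
  have cu : {for x, continuous (fun x : R => c' / a * x `^ (- a))}.
    by apply: continuousM => //; exact: cvg_cst.
  apply: continuousM; last first.
    apply: (@continuous_comp _ _ _ _ expR); last exact: continuous_expR.
    by apply: continuousM => //; exact: cvg_cst.
  apply: continuousM; last exact: cvg_cst.
  apply: continuousM; first by apply: continuousM => //; exact: cvg_cst.
  by apply: (@continuous_comp _ _ _ _ (fun y : R => y ^+ (j - 2))) => //; exact: exprn_continuous.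
rewrite /prop_for/continuous_at /Wdens x0.
move: h; rewrite /prop_for/continuous_at; apply: cvg_eq_near; near=> y.
by have -> : 0 < y by near: y; exact: lt_nbhsr.
Unshelve. all: by end_near. Qed.

Lemma intensity_at0 : u x @[x --> 0^'+] --> +oo.
Proof.
apply/cvgryPge => M; have [M0|M0] := leP M 0.
  near=> x; have x0 : 0 < x by near: x; exact: nbhs_right_gt.
  by apply: le_trans M0 _; rewrite ltW// u_gt0.
have y0 : 0 < (c' / a / M) `^ a^-1 by rewrite powR_gt0// divr_gt0.
near=> x.
have x0 : 0 < x by near: x; exact: nbhs_right_gt.
have xy : x <= (c' / a / M) `^ a^-1 by near: x; exact: nbhs_right_le.
have yE : ((c' / a / M) `^ a^-1) `^ (- a) = M / (c' / a).
  by rewrite -powRrM mulrN mulVf ?gt_eqF// powRN powRr1 ?invf_div// ltW// divr_gt0.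
have := ler_powRN (ltW a0) x0 xy; rewrite yE ler_pdivrMr// mulrC; exact.
Unshelve. all: by end_near. Qed.

(** As x decreases to 0 the mean u(x) explodes and the Poisson probability tends to 0, which is the
    boundary value needed by [FTC_oc]. *)
Lemma WjCDF_poisson j (x : R) : (1 < j)%N -> 0 < x ->
  WjCDF c' a j x = poisson_cdf (j - 2) (u x).
Proof.
move=> j2 x0; rewrite /WjCDF /Rintegral.
have -> : [set t : R | 0 <= t <= x] = `[0, x]%classic.
  by apply/seteqP; split => t /=; rewrite in_itv.
rewrite -integral_itv_obnd_cbnd.
  have -> : (\int[mu]_(y in `]0%R, x]) (Wdens c' a j y)%:E = (poisson_cdf (j - 2) (u x))%:E - 0%:E)%E;
    last by rewrite sube0.
  apply: (@FTC_oc R (Wdens c' a j) (fun x => poisson_cdf (j - 2) (u x)) x 0 x0).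
  - by move=> y _; exact: Wdens_ge0.
  - by move=> y /andP[y0 _]; exact: is_derive_poisson_intensity.
  - by move=> y /andP[y0 _]; exact: Wdens_continuous.
  - exact: cvg_comp intensity_at0 (poisson_cdf_cvg0 _).
have mW : measurable_fun (`]0, +oo[%classic : set R) (Wdens c' a j).
  apply: open_continuous_measurable_fun; first exact: interval_open.
  by move=> y; rewrite inE/= in_itv/= andbT; exact: Wdens_continuous.
apply/measurable_EFinP; apply: measurable_funS mW => //.
by move=> y /=; rewrite !in_itv/= andbT => /andP[].
Qed.

Lemma WjCDF_le0 j (x : R) : x <= 0 -> WjCDF c' a j x = 0.
Proof.
move=> x0; rewrite /WjCDF /Rintegral integral0_eq// => t /= /andP[t0 tx].
by rewrite /Wdens ltNge (le_trans tx x0).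
Qed.

Lemma FrechetCDF_WjCDF (x : R) : FrechetCDF c' a x = WjCDF c' a 2 x.
Proof.
rewrite /FrechetCDF; case: ltP => [x0|x0]; last by rewrite WjCDF_le0.
rewrite WjCDF_poisson// /poisson_cdf big_ord_recl big_ord0 expr0 fact0 divr1 addr0 mulr1.
by rewrite mulNr.
Qed.

(** Since u decreases, the set on the left is a half-line starting at the point x0 with u(x0) = y,
    and both integrals equal 1 - [poisson_cdf (j - 2) y]. For y = 0 no such point exists: one set is
    empty, the other a singleton. *)
Lemma Rintegral_Wdens_Gamma j (y : R) : (1 < j)%N -> 0 <= y ->
  Rintegral mu [set x : R | 0 < x /\ c' / a * x `^ (- a) <= y] (Wdens c' a j) =
  Rintegral mu [set t : R | 0 <= t <= y] (@GammaDens R j).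
Proof.
move=> j2; rewrite le_eqVlt => /orP[/eqP <-|y0].
  rewrite /Rintegral (_ : [set x | _] = set0); last first.
    by apply/seteqP; split => // x [/u_gt0]; rewrite ltNge => /negP.
  rewrite integral_set0.
  have -> : [set t : R | 0 <= t <= 0] = [set 0].
    apply/seteqP; split => t /=; first by move/le_anti.
    by move=> ->; rewrite lexx.
  by rewrite integral_set1.
pose x0 := (c' / a / y) `^ a^-1.
have x00 : 0 < x0 by rewrite powR_gt0// divr_gt0.
have ux0 : u x0 = y.
  rewrite /x0 -powRrM mulrN mulVf ?gt_eqF// powRN powRr1 ?divr_ge0 ?ltW//.
  by field; rewrite !gt_eqF.
clearbody x0; have -> : [set x : R | 0 < x /\ c' / a * x `^ (- a) <= y] = `[x0, +oo[%classic.
  apply/seteqP; split => x /=; rewrite in_itv/= andbT.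
    move=> [xp]; rewrite -ux0 ler_pM2l// => h; rewrite leNgt; apply/negP => xx0.
    move: h; apply/negP; rewrite -ltNge !powRN ltf_pV2 ?posrE ?powR_gt0//.
    by rewrite gt0_ltr_powR// nnegrE ltW.
  move=> xx; have xp := lt_le_trans x00 xx; split => //.
  by rewrite -[leRHS]ux0 ler_pM2l//; apply: ler_powRN => //; exact: ltW.
have -> : [set t : R | 0 <= t <= y] = `[0, y]%classic.
  by apply/seteqP; split => t /=; rewrite in_itv.
rewrite /Rintegral.
have -> : (\int[mu]_(x in `[x0, +oo[) (Wdens c' a j x)%:E = 1%:E - (poisson_cdf (j - 2) (u x0))%:E)%E.
  apply: (@FTC_cy R (Wdens c' a j) (fun x => poisson_cdf (j - 2) (u x)) x0 1).
  - by move=> x _; exact: Wdens_ge0.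
  - by move=> x xx; exact: is_derive_poisson_intensity (lt_le_trans x00 xx).
  - by move=> x xx; exact: Wdens_continuous (lt_le_trans x00 xx).
  have z : u x @[x --> +oo] --> (c' / a * 0 : R).
    by apply: cvgMl_tmp; exact: powRN_cvgy.
  rewrite mulr0 in z.
  have z1 : poisson_cdf (j - 2) (u x) @[x --> +oo] --> poisson_cdf (j - 2) (0 : R).
    by apply: (cvg_comp _ _ z); exact: poisson_cdf_continuous.
  by rewrite poisson_cdf0 in z1.
have -> : (\int[mu]_(x in `[0%R, y]) (GammaDens j x)%:E =
  \int[mu]_(x in `[0%R, y]) (expR (- x) * (x ^+ (j - 2) / (j - 2)`!%:R))%:E)%E.
  apply: eq_integral => x; rewrite inE/= in_itv/= /GammaDens => /andP[-> _].
  by congr EFin; ring.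
have -> : (\int[mu]_(x in `[0%R, y]) (expR (- x) * (x ^+ (j - 2) / (j - 2)`!%:R))%:E =
  (- poisson_cdf (j - 2) y)%:E - (- poisson_cdf (j - 2) 0)%:E)%E.
  apply: (@FTC_cc R _ (fun x => - poisson_cdf (j - 2) x)) => // x _.
    have h := is_deriveN (is_derive_poisson_cdf (j - 2) x).
    by apply: (is_derive_eq h); rewrite opprK.
  apply: continuousM.
    apply: (@continuous_comp _ _ _ _ expR); last exact: continuous_expR.
    exact: opp_continuous.
  by apply: continuousM; [exact: exprn_continuous|exact: cvg_cst].
by rewrite ux0 poisson_cdf0 -!EFinB/= opprK addrC.
Qed.

End LimitLaw.

(** * Limits of the second and later order statistics *)

Section OrderStatistics.
Context {R : realType}.
Variables (w : nat -> R) (c beta : R).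
Hypothesis w0 : forall k, 0 <= w k.
Hypothesis c0 : 0 < c.
Hypothesis beta2 : 2 < beta.
Hypothesis wlim : (fun k => w k / (c * (k%:R : R) `^ (- beta))) @ \oo --> (1 : R).
Local Notation p := (pw w).
Local Notation c' := (c / Phi1 w).
Local Notation alpha := (beta - 1).
Local Notation nu := (Ex p (fun k => k%:R)).
Variables (lam : R) (mm nn : nat -> nat).
Hypothesis nulam : nu < lam.
Hypothesis noo : (fun k => ((nn k)%:R : R)) @ \oo --> +oo.
Hypothesis mlam : (fun k => ((mm k)%:R : R) / (nn k)%:R) @ \oo --> lam.

Let p0 k : 0 <= p k := pw_ge0 w0 c0 beta2 wlim k.
Let p1 := pw_sum1 w0 c0 beta2 wlim.
Let Q0 N := @Qn_ge0 _ p p0 N.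
Let Q1 N := @Qn_sum1 _ p p0 p1 N.
Let rw := regular_pw w0 c0 beta2 wlim.
Let Noo := predn_cvgy noo.
Let a0 : 0 < alpha. Proof. by have := beta2; lra. Qed.
Let a1 : 1 < alpha. Proof. by have := beta2; lra. Qed.
Let c'0 : 0 < c' := rw_c_gt0 rw.
Let sc k : R := (nn k)%:R `^ alpha^-1.
Local Notation P := (fun k => BBprob w (mm k) (nn k)).

Lemma scale_cvgy : sc k @[k --> \oo] --> +oo.
Proof.
apply/cvgryPge => A; near=> k.
have [A0|A0] := leP A 0; first by apply: le_trans A0 (powR_ge0 _ _).
have nA : A `^ alpha <= (nn k)%:R by near: k; move/cvgryPge : noo; apply.
rewrite -[A](powRr1 (ltW A0)) -(mulfV (lt0r_neq0 a0)) powRrM.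
by apply: ge0_ler_powR => //; rewrite ?nnegrE ?powR_ge0// invr_ge0 ltW.
Unshelve. all: by end_near. Qed.

Lemma exceedance_mean (x : R) : 0 < x ->
  (nn k).-1%:R * Prq p (fun i => x * sc k < i%:R) @[k --> \oo] --> c' / alpha * x `^ (- alpha).
Proof.
move=> x0.
have soo : x * sc k @[k --> \oo] --> +oo.
  apply/cvgryPge => A; near=> k; rewrite -ler_pdivrMl//; near: k.
  by move/cvgryPge : scale_cvgy; apply.
have t := tail_scaling rw soo.
have z : x `^ (- alpha) * ((x * sc k) `^ alpha * Prq p (fun i => x * sc k < i%:R)) *
  ((nn k).-1%:R / (nn k)%:R) @[k --> \oo] --> x `^ (- alpha) * (c' / alpha) * 1.
  by apply: cvgM; [exact: cvgMl_tmp|exact: pred_nn_ratio].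
rewrite mulr1 mulrC in z; apply: cvg_eq_near z; near=> k.
have n0 : 0 < ((nn k)%:R : R) by near: k; move/cvgryPgt : noo; apply.
rewrite powRM ?powR_ge0 ?(ltW x0)// -[sc k `^ alpha]powRrM mulVf ?(gt_eqF a0)//.
rewrite powRr1// powRN; field.
by rewrite !gt_eqF// powR_gt0.
Unshelve. all: by end_near. Qed.

(** The j-th largest box corresponds to the (j-1)-th largest of the n - 1 variables, so it is at
    most x n^(1/alpha) exactly when at most j - 2 of them exceed that level. *)
Lemma order_stat_cvg j (x : R) : (1 < j)%N -> 0 < x ->
  P k (fun s => (ordstat s j)%:R / sc k <= x) @[k --> \oo] --> WjCDF c' alpha j x.
Proof.
move=> j2 x0; rewrite WjCDF_poisson//.
apply: (@transfer_cvg _ w c beta w0 c0 beta2 wlim lam mm nn nulam noo mlam j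
  (fun k y => y / sc k <= x)).
have z := @poisson_limit R (fun k => (nn k).-1) (fun k => Prq p (fun i => x * sc k < i%:R)) _ Noo
  (fun k => introT andP (conj (Prq_ge0 p0 _) (Prq_le1 p0 p1 _))) (exceedance_mean x0) (j - 2).
apply: cvg_eq_near z; near=> k.
have s0 : 0 < sc k by near: k; move/cvgryPgt : scale_cvgy; apply.
rewrite -(count_cdf p0 p1); apply: eq_Prq => xi.
rewrite -[in istat j _](subnKC j2) istatS_xivec ler_pdivrMr// leNgt nth_sort_gt.
  by rewrite -leqNgt.
by rewrite mulr_ge0 ?powR_ge0// ltW.
Unshelve. all: by end_near. Qed.

(** Below 0 the event is eventually impossible. At 0 it is compared with the event for a small y >
    0, provided by continuity of the limit at 0. *)
Lemma order_stat_dist j : (1 < j)%N ->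
  cvg_dist P (fun k s => (ordstat s j)%:R / sc k) (WjCDF c' alpha j).
Proof.
move=> j2 x cx; have [x0|x0] := ltP 0 x; first exact: order_stat_cvg.
rewrite WjCDF_le0//.
have Fx : WjCDF c' alpha j x = 0 by exact: WjCDF_le0.
have P0 k (A : pred (seq nat)) : 0 <= P k A.
  by rewrite (BBprob_Prq w0 c0 beta2 wlim) divr_ge0// Prq_ge0.
have P0le k (A B : pred (seq nat)) : (forall s, A s -> B s) -> P k A <= P k B.
  move=> AB; rewrite !(BBprob_Prq w0 c0 beta2 wlim) ler_wpM2r ?invr_ge0 ?Prq_ge0//.
  by apply: Prq_le => // y /andP[-> /AB].
apply/cvgrPdist_le => e e0.
have [y y0 Fy] : exists2 y : R, 0 < y & x < 0 \/ WjCDF c' alpha j y <= e / 2.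
  have [xn|xn] := ltP x 0; first by exists 1 => //; left.
  have xE : x = 0 by apply: le_anti; rewrite x0 xn.
  have e20 : 0 < e / 2 by rewrite divr_gt0.
  move: cx; rewrite /prop_for/continuous_at Fx xE => /cvgrPdist_le/(_ _ e20)/nbhs_ballP[d /= d0 Hd].
  exists (d / 2); first by rewrite divr_gt0.
  right; have := Hd (d / 2); rewrite /ball/= !sub0r !normrN (ger0_norm (ltW (divr_gt0 d0 _)))//.
  by move=> h; apply: le_trans (ler_norm _) (h _); lra.
have {}Fy : x < 0 \/ \forall k \near \oo, P k (fun s => (ordstat s j)%:R / sc k <= y) <= e.
  by have [?|Fye] := Fy; [left|right; apply: (cvgr_le _ (order_stat_cvg j2 y0)); lra].
have [xn|ye] := Fy.
  near=> k; have s0 : 0 < sc k by near: k; move/cvgryPgt : scale_cvgy; apply.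
  rewrite sub0r normrN ger0_norm//.
  rewrite [X in X <= _](_ : _ = 0) ?ltW// (BBprob_Prq w0 c0 beta2 wlim) /Prq (_ : Ex _ _ = 0) ?mul0r//.
  rewrite -[RHS](Ex_cst (@Q0 (nn k)) (@Q1 (nn k)) 0); apply: eq_Ex => xi.
  case: (_ == _) => //=; rewrite lt_geF//; apply: lt_le_trans xn _.
  by rewrite divr_ge0// ltW.
near=> k.
have s0 : 0 < sc k by near: k; move/cvgryPgt : scale_cvgy; apply.
rewrite sub0r normrN ger0_norm//.
apply: (@le_trans _ _ (P k (fun s => (ordstat s j)%:R / sc k <= y))).
  by apply: P0le => s /= /le_trans; apply; rewrite (le_trans x0)// ltW.
by near: k.
Unshelve. all: by end_near. Qed.

Lemma WjCDF_cvg1 j : (1 < j)%N -> WjCDF c' alpha j x @[x --> +oo] --> (1 : R).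
Proof.
move=> j2.
have z : c' / alpha * x `^ (- alpha) @[x --> +oo] --> (c' / alpha * 0 : R).
  by apply: cvgMl_tmp; exact: powRN_cvgy.
rewrite mulr0 in z.
have z1 : poisson_cdf (j - 2) (c' / alpha * x `^ (- alpha)) @[x --> +oo] --> poisson_cdf (j - 2) (0 : R).
  by apply: (cvg_comp _ _ z); exact: poisson_cdf_continuous.
rewrite poisson_cdf0 in z1.
apply: cvg_eq_near z1; near=> x; rewrite WjCDF_poisson//.
Unshelve. all: by end_near. Qed.

Lemma order_stat_bdd j : (1 < j)%N -> bdd_prob P (fun k s => (ordstat s j)%:R / sc k).
Proof.
move=> j2 e e0.
have e20 : 0 < e / 2 by rewrite divr_gt0.
have [M [M0 HM]] : exists M : R, 0 < M /\ 1 - e / 2 <= WjCDF c' alpha j M.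
  have := WjCDF_cvg1 j2 => /cvgrPdist_le/(_ _ e20) h.
  near (pinfty_nbhs R) => M; exists M; split; first by near: M; exact: nbhs_pinfty_gt.
  have : `|1 - WjCDF c' alpha j M| <= e / 2 by near: M.
  rewrite ler_norml => /andP[]; lra.
exists M.
have z := cvgr_gt _ (order_stat_cvg j2 M0).
near=> k.
have s0 : 0 < sc k by near: k; move/cvgryPgt : scale_cvgy; apply.
have : 1 - e < P k (fun s => (ordstat s j)%:R / sc k <= M) by near: k; apply: z; lra.
(* An inequality also covers a vanishing denominator, for which both quotients are 0. *)
suff : P k [pred s | M < `|(ordstat s j)%:R / sc k|] + P k (fun s => (ordstat s j)%:R / sc k <= M) <= 1.
  by move: (P k _) (P k _) => u v; lra.
rewrite !(BBprob_Prq w0 c0 beta2 wlim) -mulrDl.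
rewrite -ExD; [|exact: (summ_nat (@Q0 _) (@Q1 _))|exact: (summ_nat (@Q0 _) (@Q1 _))].
rewrite (_ : Ex _ _ = Prq (@Qn _ p (nn k)) (fun y => (\sum_j y j == mm k)%N && true)).
  by case: (eqVneq (Prq (@Qn _ p (nn k)) (fun y => (\sum_j y j == mm k)%N && true)) 0) =>
    [->|h]; rewrite ?mul0r ?divff.
apply: eq_Ex => y; case: (_ == _) => /=; last by rewrite addr0.
rewrite ger0_norm; last by rewrite divr_ge0// ltW.
by rewrite leNgt; case: ltP => _; rewrite ?addr0 ?add0r.
Unshelve. all: by end_near. Qed.

End OrderStatistics.

(** * Weak limits and their Laplace transforms *)

(** The Lebesgue-Stieltjes measure of [f] lives on [measurableTypeR R]; the law of the identity map
    carries it to [R]. *)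
Lemma prob_cdf_exists {R : realType} (f : cumulativeBounded (0 : R) (1 : R)) :
  exists mu : probability R R, forall x, mu [set y : R | y <= x] = (f x)%:E.
Proof.
pose P : probability (measurableTypeR R) R := lebesgue_stieltjes_measure f.
pose X : measurableTypeR R -> R := idfun.
pose X' : {mfun measurableTypeR R >-> R} :=
  HB.pack X (isMeasurableFun.Build _ _ _ _ X (@measurable_id _ _ setT)).
exists (distribution P X') => x.
rewrite -(cdf_lebesgue_stieltjes_id f x) /cdf/= /distribution /pushforward/= !preimage_id.
by congr (lebesgue_stieltjes_measure _ _); apply/seteqP; split => y /=; rewrite in_itv.
Qed.

Section WeakLimit.
Context {R : realType}.
Variable (G : nat -> R -> R).
Hypothesis G0 : forall k x, 0 <= G k x.
Hypothesis G1 : forall k x, G k x <= 1.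
Hypothesis Gle : forall k x y, x <= y -> G k x <= G k y.
Hypothesis Gosc : forall a b eta : R, a < b -> 0 < eta -> exists l : R,
  (\forall k \near \oo, G k a <= l + eta) /\ (\forall k \near \oo, l - eta <= G k b).
Hypothesis Gtight : forall eta : R, 0 < eta -> exists B : R,
  (\forall k \near \oo, G k (- B) <= eta) /\ (\forall k \near \oo, 1 - eta <= G k B).

(** [F] is the right-continuous regularisation of the upper limit of [G]. *)
Let S x := [set r : R | exists2 b, x < b & \forall k \near \oo, G k b <= r].
Let F x := inf (S x).

Let S1 x : S x 1.
Proof. by exists (x + 1); [rewrite ltrDl|near=> k; exact: G1]. Unshelve. all: by end_near. Qed.

Let S_ge0 x r : S x r -> 0 <= r.
Proof.
move=> [b _ h]; near \oo => k; apply: (le_trans (G0 k b)).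
by near: k.
Unshelve. all: by end_near. Qed.

Let S_inf x : has_inf (S x).
Proof. by split; [exists 1; exact: S1|exists 0 => r; exact: S_ge0]. Qed.

Let F_le x r : S x r -> F x <= r.
Proof. by move=> h; apply: ge_inf h; case: (S_inf x). Qed.

Let F_ge x r : (forall s, S x s -> r <= s) -> r <= F x.
Proof. by move=> h; apply: lb_le_inf => //; exists 1; exact: S1. Qed.

Let F0 x : 0 <= F x. Proof. by apply: F_ge => r; exact: S_ge0. Qed.

Let F_upper x eta : 0 < eta -> \forall k \near \oo, G k x <= F x + eta.
Proof.
move=> e0; have [r [b xb h] re] := inf_adherent e0 (S_inf x).
apply: filterS h => k h; apply: le_trans (Gle k (ltW xb)) _.
by apply: le_trans h _; exact: ltW.
Qed.

(** The midpoint leaves room on both sides: it lies strictly above x, so it bounds [F x], and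
    strictly below y, so [Gosc] applies. *)
Let F_lower x y eta : x < y -> 0 < eta -> \forall k \near \oo, F x - eta <= G k y.
Proof.
move=> xy e0; have z : (x + y) / 2 < y by lra.
have e2 : 0 < eta / 2 by rewrite divr_gt0.
have [l [h1 h2]] := Gosc z e2.
have : F x <= l + eta / 2 by apply: F_le; exists ((x + y) / 2) => //; lra.
by move=> h; apply: filterS h2 => k; lra.
Qed.

Let F_nd : nondecreasing F.
Proof.
move=> x y xy; apply: F_ge => r [b yb h]; apply: F_le; exists b => //.
exact: le_lt_trans yb.
Qed.

Let F_rc : right_continuous F.
Proof.
move=> x; apply/cvgrPdist_le => e e0.
have [r [b xb h] re] := inf_adherent e0 (S_inf x).
near=> y.
have xy : x < y by near: y; exact: nbhs_right_gt.
have yb : y < b by near: y; exact: nbhs_right_lt.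
have h1 : F x <= F y by apply: F_nd; exact: ltW.
have h2 : F y <= r by apply: F_le; exists b.
rewrite ler_norml; apply/andP; split; move: re; rewrite -/(F x); lra.
Unshelve. all: by end_near. Qed.

Let F_Ny : F @ -oo --> (0 : R).
Proof.
apply/cvgrPdist_le => e e0; have [B [h _]] := Gtight e0.
near=> y; rewrite sub0r normrN ger0_norm//.
apply: F_le; exists (- B) => //.
by near: y; apply: nbhs_ninfty_lt; rewrite num_real.
Unshelve. all: by end_near. Qed.

Let F_y : F @ +oo --> (1 : R).
Proof.
apply/cvgrPdist_le => e e0; have [B [_ h]] := Gtight e0.
near=> y; rewrite ger0_norm ?subr_ge0; last by apply: F_le; exact: S1.
rewrite lerBlDr addrC -lerBlDr.
apply: F_ge => r [b yb hr]; near \oo => k.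
apply: (@le_trans _ _ (G k B)); first by near: k.
apply: (@le_trans _ _ (G k b)); last by near: k.
apply: Gle; apply: le_trans (ltW yb).
by near: y; apply: nbhs_pinfty_ge; rewrite num_real.
Unshelve. all: by end_near. Qed.

(** [Gosc] says that the upper limit of G at a does not exceed its lower limit at any b > a, so [F]
    captures the whole sequence and not only a subsequence. [Gtight] gives [F] the limits 0 and 1 at
    the two ends. *)
Lemma weak_limit : exists mu : probability R R,
  [/\ forall x eta, 0 < eta -> \forall k \near \oo, G k x <= prob_cdf mu x + eta,
      forall x y eta, x < y -> 0 < eta -> \forall k \near \oo, prob_cdf mu x - eta <= G k y &
      forall x, mu [set y : R | y <= x] = (prob_cdf mu x)%:E].
Proof.
pose f : cumulativeBounded (0 : R) (1 : R) := HB.pack F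
  (isCumulative.Build R _ R F F_nd F_rc) (isCumulativeBounded.Build R 0 1 F F_Ny F_y).
have [mu hmu] := prob_cdf_exists f; exists mu.
have E x : prob_cdf mu x = F x by rewrite /prob_cdf hmu.
split; [move=> x eta|move=> x y eta|move=> x].
- by rewrite E; exact: F_upper.
- by rewrite E; exact: F_lower.
- by rewrite E hmu.
Qed.

End WeakLimit.

Lemma cdf_squeeze_cvg {R : realType} (G : nat -> R -> R) (F : R -> R) :
  (forall x eta, 0 < eta -> \forall k \near \oo, G k x <= F x + eta) ->
  (forall x y eta, x < y -> 0 < eta -> \forall k \near \oo, F x - eta <= G k y) ->
  forall x, {for x, continuous F} -> G k x @[k --> \oo] --> F x.
Proof.
move=> up lo x cx; apply/cvgrPdist_le => e e0.
have e20 : 0 < e / 2 by rewrite divr_gt0.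
move: cx => /cvgrPdist_le/(_ _ e20)/nbhs_ballP[d /= d0 Hd].
have h : `|F x - F (x - d / 2)| <= e / 2.
  by apply: Hd; rewrite /ball/= opprB addrC subrK gtr0_norm ?divr_gt0//; lra.
have xx : x - d / 2 < x by lra.
have h1 := up x _ e20; have h2 := lo _ _ _ xx e20; near=> k.
have : G k x <= F x + e / 2 by near: k.
have : F (x - d / 2) - e / 2 <= G k x by near: k.
move: h; rewrite !ler_norml => /andP[? ?] ? ?; apply/andP; split; lra.
Unshelve. all: by end_near. Qed.

Lemma le_indic {R : realType} (a x : R) : (x <= a)%R%:R = \1_[set y : R | y <= a] x :> R.
Proof.
rewrite indicE; congr (_%:R); case: (boolP (x <= a)) => h; first by rewrite mem_set.
by rewrite memNset//=; exact/negP.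
Qed.

Lemma measurable_le_set {R : realType} (a : R) : measurable [set y : R | y <= a].
Proof.
rewrite (_ : [set y | _] = `]-oo, a]%classic); first exact: measurable_itv.
by apply/seteqP; split => y /=; rewrite in_itv.
Qed.

(** * Approximation of a decreasing function by steps *)

Section Stairs.
Context {R : realType}.
Variables (f : R -> R) (x0 h : R).
Hypothesis f0 : forall x, 0 <= f x.
Hypothesis f_nd : forall x y, x <= y -> f y <= f x.
Hypothesis h0 : 0 <= h.
Local Notation g i := (x0 + i%:R * h).

(** Within the grid the sum telescopes to f at the first grid point at or above x, minus f at the
    last one. As a combination of half-line indicators, its expectation involves only values of the
    distribution function. *)
Definition stairs (n : nat) (x : R) : R :=
  \sum_(i < n) (f (g i) - f (g i.+1)) * (x <= g i)%R%:R.

Let g_nd i j : (i <= j)%N -> g i <= g j.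
Proof. by move=> ij; rewrite lerD2l ler_wpM2r// ler_nat. Qed.

Lemma stairs_step_ge0 i : 0 <= f (g i) - f (g i.+1).
Proof. by rewrite subr_ge0 f_nd// g_nd. Qed.

Lemma stairs_le n x : stairs n x <= f x.
Proof.
(* Adding back the last value gives f at the first grid point not below x, a form that passes
   through the induction. *)
suff : stairs n x + f (g n) * (x <= g n)%R%:R <= f x.
  by apply: le_trans; rewrite lerDl mulr_ge0.
elim: n => [|n IH].
  by rewrite /stairs big_ord0 add0r; have [xg|_] := leP x (g 0);
    rewrite ?mulr1 ?mulr0//; exact: f_nd.
rewrite /stairs big_ord_recr/= -/(stairs n x).
have [xg|gx] := leP x (g n).
  by rewrite xg (le_trans xg (g_nd (leqnSn n))) !mulr1 in IH *; rewrite -addrA subrK.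
rewrite mulr0 addr0 /stairs big1 ?add0r; last first.
  by move=> i _; rewrite lt_geF ?mulr0//; apply: le_lt_trans gx; rewrite g_nd// ltnW.
by have [xg|_] := leP x (g n.+1); rewrite ?mulr1 ?mulr0//; exact: f_nd.
Qed.

(** The shift by one mesh compensates for the stairs reading f at a grid point to the right of x. *)
Lemma stairs_ge n x : x0 <= x + h -> f (x + h) <= stairs n x + f (g n).
Proof.
move=> xh; elim: n => [|n IH].
  by rewrite /stairs big_ord0 add0r mul0r addr0 f_nd.
rewrite /stairs big_ord_recr/= -/(stairs n x).
have [xg|gx] := leP x (g n); first by rewrite mulr1 -addrA subrK.
rewrite mulr0 addr0; apply: (@le_trans _ _ (f (g n.+1))).
  by apply: f_nd; rewrite -natr1 mulrDl mul1r addrA lerD2r ltW.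
by rewrite lerDr; apply: sumr_ge0 => i _; rewrite mulr_ge0// stairs_step_ge0.
Qed.

Lemma sum_stairs_step n : \sum_(i < n) (f (g i) - f (g i.+1)) <= f x0.
Proof.
have := stairs_le n x0; apply: le_trans; rewrite le_eqVlt; apply/orP; left; apply/eqP.
by apply: eq_bigr => i _; rewrite lerDl mulr_ge0// mulr1.
Qed.

End Stairs.

(** * Laplace transform of the weak limit *)

Section LaplaceTransfer.
Context {R : realType}.
Variables (T : nat -> choiceType) (q : forall k, T k -> R) (X : forall k, T k -> R).
Hypothesis q0 : forall k x, 0 <= @q k x.
Hypothesis q1 : forall k, (\esum_(x in [set: T k]) (@q k x)%:E = 1)%E.
Variable mu : probability R R.
Local Notation G k x := (Prq (@q k) (fun z => X z <= x)).
Local Notation F := (prob_cdf mu).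
Hypothesis up : forall x eta, 0 < eta -> \forall k \near \oo, G k x <= F x + eta.
Hypothesis lo : forall x y eta, x < y -> 0 < eta -> \forall k \near \oo, F x - eta <= G k y.
Hypothesis cdfE : forall x, mu [set y : R | y <= x] = (F x)%:E.
Variables (t phi C : R).
Hypothesis t0 : 0 < t.
Hypothesis summ_t : \forall k \near \oo, summ (@q k) (fun z => expR (- t * X z)).
Hypothesis summ_2t : \forall k \near \oo, summ (@q k) (fun z => expR (- (2 * t) * X z)).
Hypothesis cvg_t : Ex (@q k) (fun z => expR (- t * X z)) @[k --> \oo] --> phi.
Hypothesis bnd_2t : \forall k \near \oo, Ex (@q k) (fun z => expR (- (2 * t) * X z)) <= C.
Local Notation f := (fun x : R => expR (- t * x)).

Let f_nd x y : x <= y -> f y <= f x.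
Proof. by move=> xy; rewrite ler_expR !mulNr lerN2 ler_wpM2l// ltW. Qed.
Let f0 x : 0 <= f x. Proof. exact: expR_ge0. Qed.

Let measurable_f : measurable_fun [set: R] f.
Proof. by apply: measurableT_comp; [exact: measurable_expR|exact: measurable_funM]. Qed.

Section Grid.
Variable N : nat.
Hypothesis N0 : (0 < N)%N.
(** Grid of mesh 1/N from -N to N; mesh and cut-off both disappear as N grows. *)
Let h : R := N%:R^-1.
Let x0 : R := - N%:R.
Let n := (2 * N * N)%N.
Local Notation D := (stairs f x0 h n).
Local Notation g i := (x0 + i%:R * h).
Local Notation d i := (f (g i) - f (g i.+1)).
Let h0 : 0 < h. Proof. by rewrite invr_gt0 ltr0n. Qed.

Let gn : g n = N%:R.
Proof.
have nN : (N%:R : R) != 0 by rewrite pnatr_eq0 -lt0n.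
by rewrite /x0 /n /h 2!natrM; field.
Qed.

Let f_shift x : f x = expR (t * h) * f (x + h).
Proof. by rewrite -expRD; congr expR; ring. Qed.

(** The increments add up to at most f(-N) = exp(t N). Distribution functions are therefore compared
    with accuracy exp(-2 t N), so that the accumulated error is at most exp(-t N). *)
Let sum_eta : \sum_(i < n) d i * expR (- (2 * t * N%:R)) <= f N%:R.
Proof.
rewrite -mulr_suml; have := @sum_stairs_step R f x0 h f0 f_nd (ltW h0) n => H.
apply: le_trans (ler_wpM2r (expR_ge0 _) H) _.
by rewrite -expRD /x0 ler_expR; lra.
Qed.

Lemma Ex_stairs k s : Ex (@q k) (fun z => D (X z - s)) = \sum_(i < n) d i * G k (g i + s).
Proof.
have [_ ->] := @Ex_sum _ _ (@q k) _ (index_enum 'I_n) xpredT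
  (fun i z => d i * (X z - s <= g i)%R%:R)
  (fun i _ => summZ _ (summ_nat (@q0 k) (q1 k) _)).
by apply: eq_bigr => i _; rewrite ExZ; congr (_ * _); apply: eq_Ex => z; rewrite lerBlDr.
Qed.

Lemma summ_stairs k s : summ (@q k) (fun z => D (X z - s)).
Proof.
exact: (@Ex_sum _ _ (@q k) _ (index_enum 'I_n) xpredT
  (fun i z => d i * (X z - s <= g i)%R%:R)
  (fun i _ => summZ _ (summ_nat (@q0 k) (q1 k) _))).1.
Qed.

Lemma integral_stairs : (\int[mu]_x (D x)%:E = (\sum_(i < n) d i * F (g i))%:E)%E.
Proof.
under eq_integral do rewrite /stairs -sumEFin.
rewrite ge0_integral_sum//; last 2 first.
- move=> i; apply/measurable_EFinP; apply: measurable_funM => //.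
  by under eq_fun do rewrite le_indic; apply: measurable_indic; exact: measurable_le_set.
- by move=> i x _; rewrite lee_fin mulr_ge0// (stairs_step_ge0 _ f_nd (ltW h0)).
rewrite -sumEFin; apply: eq_bigr => i _.
under eq_integral do rewrite EFinM.
rewrite ge0_integralZl//; last 2 first.
- apply/measurable_EFinP; under eq_fun do rewrite le_indic.
  by apply: measurable_indic; exact: measurable_le_set.
- by rewrite lee_fin (stairs_step_ge0 _ f_nd (ltW h0)).
rewrite EFinM; congr (_ * _)%E; under eq_integral do rewrite le_indic.
by rewrite (integral_indic mu measurableT (measurable_le_set _)) setIT; exact: cdfE.
Qed.

Lemma measurable_stairs : measurable_fun [set: R] D.
Proof.
apply: measurable_sum => i; apply: measurable_funM => //.
by under eq_fun do rewrite le_indic; apply: measurable_indic; exact: measurable_le_set.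
Qed.

Lemma stairs_nneg x : 0 <= D x.
Proof. by apply: sumr_ge0 => i _; rewrite mulr_ge0// (stairs_step_ge0 _ f_nd (ltW h0)). Qed.


(** On the grid range, f(x) = exp(t h) f(x + h) brings f below the stairs. To the left of it, exp(-t
    x) <= exp(-t N) exp(-2 t x), and the bound at 2t plays the role of uniform integrability. *)
Lemma Laplace_upper : (phi%:E <= (expR (t * h))%:E *
  (\int[mu]_x (f x)%:E + (2 * expR (- (t * N%:R)))%:E) + (expR (- (t * N%:R)) * C)%:E)%E.
Proof.
have eta0 : 0 < expR (- (2 * t * N%:R)) by exact: expR_gt0.
have Hup : \forall k \near \oo, forall i : 'I_n, G k (g i) <= F (g i) + expR (- (2 * t * N%:R)).
  by apply: filter_forall => i; exact: up.
have E1 : phi <= expR (t * h) * (\sum_(i < n) d i * F (g i) + 2 * expR (- (t * N%:R))) +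
    expR (- (t * N%:R)) * C.
  apply: (ler_cvg_to cvg_t (cvg_cst _)).
  near=> k.
  have st : summ (@q k) (fun z => expR (- t * X z)) by near: k.
  have s2t : summ (@q k) (fun z => expR (- (2 * t) * X z)) by near: k.
  have b2t : Ex (@q k) (fun z => expR (- (2 * t) * X z)) <= C by near: k.
  have HG : forall i : 'I_n, G k (g i) <= F (g i) + expR (- (2 * t * N%:R)) by near: k.
  have sD := summ_stairs k 0.
  have sc : summ (@q k) (fun=> f N%:R).
    by apply: (summ_bd (@q0 k) (q1 k) (C := f N%:R)) => z; rewrite ger0_norm.
  apply: (@le_trans _ _ (Ex (@q k) (fun z => expR (t * h) * (D (X z - 0) + f N%:R) +
      expR (- (t * N%:R)) * expR (- (2 * t) * X z)))).
    apply: Ex_le => //; first exact: summD (summZ _ (summD sD sc)) (summZ _ s2t).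
    move=> z; rewrite subr0; have [xz|xz] := leP x0 (X z + h).
      apply: (@le_trans _ _ (expR (t * h) * (D (X z) + f N%:R))).
        rewrite f_shift ler_wpM2l ?expR_ge0// -gn.
        exact: (stairs_ge f_nd (ltW h0)).
      by rewrite lerDl mulr_ge0// expR_ge0.
    apply: (@le_trans _ _ (expR (- (t * N%:R)) * expR (- (2 * t) * X z))).
      rewrite -expRD ler_expR.
      have : t * X z <= t * - N%:R by rewrite ler_wpM2l ?ltW//; move: xz h0; rewrite /x0; lra.
      lra.
    rewrite lerDr mulr_ge0 ?expR_ge0// addr_ge0//.
    exact: stairs_nneg.
  rewrite ExD; [|exact: (summZ _ (summD sD sc))|exact: summZ].
  rewrite !ExZ ExD// Ex_cst// Ex_stairs.
  apply: lerD; last by rewrite ler_wpM2l ?expR_ge0.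
  rewrite ler_wpM2l ?expR_ge0// mulr_natl mulr2n addrA.
  have -> : f N%:R = expR (- (t * N%:R)) by rewrite mulNr.
  rewrite lerD2r -mulNr; apply: le_trans (lerD (lexx _) sum_eta).
  rewrite -big_split/=; apply: ler_sum => i _; rewrite -mulrDr addr0.
  by rewrite ler_wpM2l// (stairs_step_ge0 _ f_nd (ltW h0)).
have DI : ((\sum_(i < n) d i * F (g i))%:E <= \int[mu]_x (f x)%:E)%E.
  rewrite -integral_stairs; apply: ge0_le_integral => //.
  - by move=> x _; rewrite lee_fin stairs_nneg.
  - by apply/measurable_EFinP; exact: measurable_stairs.
  - by apply/measurable_EFinP; exact: measurable_f.
  - by move=> x _; rewrite lee_fin; exact: stairs_le f0 f_nd (ltW h0) _ _.
apply: (@le_trans _ _ (expR (t * h) * (\sum_(i < n) d i * F (g i) + 2 * expR (- (t * N%:R))) +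
    expR (- (t * N%:R)) * C)%:E); first by rewrite lee_fin.
rewrite EFinD leeD2r// EFinM lee_wpmul2l ?lee_fin ?expR_ge0// EFinD leeD2r//.
Unshelve. all: by end_near. Qed.

(** [lo] compares F only with distribution functions at a strictly larger point, here one mesh
    further; that shift costs the second factor exp(t h). *)
Lemma Laplace_lower : (\int[mu]_(x in [set x | (- N%:R < x)%R]) (f x)%:E <=
  (expR (t * h) * (expR (t * h) * phi + 2 * expR (- (t * N%:R))))%:E)%E.
Proof.
have eta0 : 0 < expR (- (2 * t * N%:R)) by exact: expR_gt0.
have Hlo : \forall k \near \oo, forall i : 'I_n, F (g i) - expR (- (2 * t * N%:R)) <= G k (g i + h).
  by apply: filter_forall => i; apply: lo => //; rewrite ltrDl.
have E1 : \sum_(i < n) d i * F (g i) <= expR (t * h) * phi + expR (- (t * N%:R)).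
  have lim : expR (t * h) * Ex (@q k) (fun z => expR (- t * X z)) + expR (- (t * N%:R))
      @[k --> \oo] --> expR (t * h) * phi + expR (- (t * N%:R)).
    by apply: cvgD; [exact: cvgMl_tmp|exact: cvg_cst].
  apply: (ler_cvg_to (cvg_cst _) lim).
  near=> k.
  have st : summ (@q k) (fun z => expR (- t * X z)) by near: k.
  have HG : forall i : 'I_n, F (g i) - expR (- (2 * t * N%:R)) <= G k (g i + h) by near: k.
  apply: (@le_trans _ _ (\sum_(i < n) d i * G k (g i + h) + f N%:R)); last first.
    rewrite mulNr lerD2r -Ex_stairs -ExZ; apply: Ex_le => //.
    - exact: summ_stairs.
    - exact: summZ.
    move=> z; have := @stairs_le R f x0 h f0 f_nd (ltW h0) n (X z - h).
    by move=> /le_trans; apply; rewrite f_shift subrK.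
  apply: le_trans (lerD (lexx _) sum_eta).
  rewrite -big_split/=; apply: ler_sum => i _; rewrite -mulrDr.
  by rewrite ler_wpM2l ?(stairs_step_ge0 _ f_nd (ltW h0))// -lerBlDr.
have mS : measurable [set x : R | - N%:R < x].
  rewrite (_ : [set x | _] = `]- N%:R, +oo[%classic); first exact: measurable_itv.
  by apply/seteqP; split => y /=; rewrite in_itv/= andbT.
have Dc : measurable_fun [set: R] (fun x => (D x + f N%:R)%:E).
  by apply/measurable_EFinP; apply: measurable_funD => //; exact: measurable_stairs.
have Dc0 x : (0 <= (D x + f N%:R)%:E)%E by rewrite lee_fin addr_ge0// stairs_nneg.
have -> : ((expR (t * h) * (expR (t * h) * phi + 2 * expR (- (t * N%:R))))%:E =
  (expR (t * h))%:E * (expR (t * h) * phi + expR (- (t * N%:R)) + f N%:R)%:E)%E.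
  by rewrite -EFinM mulNr; congr EFin; ring.
apply: (@le_trans _ _ ((expR (t * h))%:E * \int[mu]_x (D x + f N%:R)%:E)%E).
  rewrite -ge0_integralZl ?lee_fin ?expR_ge0//.
  apply: (@le_trans _ _ (\int[mu]_(x in [set x | (- N%:R < x)%R])
    ((expR (t * h))%:E * (D x + f N%:R)%:E))%E).
    apply: ge0_le_integral => //.
    - by apply/measurable_EFinP; exact: measurable_funTS.
    - apply: measurable_funTS; under eq_fun do rewrite -EFinM.
      by apply/measurable_EFinP; apply: measurable_funM => //; exact/measurable_EFinP.
    - move=> x /= Nx; rewrite -EFinM lee_fin f_shift ler_wpM2l ?expR_ge0// -gn.
      by apply: (stairs_ge f_nd (ltW h0)); rewrite (le_trans (ltW Nx))// lerDl ltW.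
  apply: ge0_subset_integral => //.
  - under eq_fun do rewrite -EFinM.
    by apply/measurable_EFinP; apply: measurable_funM => //; exact/measurable_EFinP.
  - by move=> x _; rewrite mule_ge0// lee_fin expR_ge0.
rewrite lee_wpmul2l ?lee_fin ?expR_ge0//.
under eq_integral do rewrite EFinD.
rewrite ge0_integralD//=; last 2 first.
- by move=> x _; rewrite lee_fin stairs_nneg.
- by apply/measurable_EFinP; exact: measurable_stairs.
rewrite integral_stairs integral_cst//=.
rewrite probability_setT mule1 -EFinD lee_fin.
by rewrite lerD2r.
Unshelve. all: by end_near. Qed.

End Grid.

Let grid_mesh : expR (t * N%:R^-1) @[N --> \oo] --> (1 : R).
Proof.
have z : t * N%:R^-1 @[N --> \oo] --> (t * 0 : R).
  apply: cvgMl_tmp; apply/gtr0_cvgV0; last exact: cvgr_idn.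
  by near=> N; rewrite ltr0n; near: N; exact: nbhs_infty_gt.
rewrite mulr0 in z.
by have := cvg_comp _ _ z (@continuous_expR R 0); rewrite expR0.
Unshelve. all: by end_near. Qed.

Let grid_end : expR (- (t * N%:R)) @[N --> \oo] --> (0 : R).
Proof.
have z : t * N%:R @[N --> \oo] --> +oo.
  apply/cvgryPge => A; near=> N; rewrite -ler_pdivrMl//; near: N.
  exact: nbhs_infty_ger.
exact: (cvg_comp _ _ z (@cvgr_expR R)).
Unshelve. all: by end_near. Qed.

(** The lower estimate comes first: it shows that the integral is finite, after which the upper one
    can be read in the reals. *)
Lemma Laplace_limit : (\int[mu]_x (expR (- t * x))%:E = phi%:E)%E.
Proof.
have low : (\int[mu]_x (f x)%:E <= phi%:E)%E.
  pose I (N : nat) : set R := [set x | - N%:R < x].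
  have IU : [set: R] = \bigcup_N I N.
    apply/seteqP; split => // x _; near \oo => N; exists N => //=.
    rewrite /I/= ltrNl; near: N; exact: nbhs_infty_gtr.
  have z : (\int[mu]_(x in I N) (f x)%:E)%E @[N --> \oo] --> (\int[mu]_x (f x)%:E)%E.
    rewrite IU; apply: ge0_nondecreasing_set_cvg_integral => //.
    - move=> m n mn; apply/subsetPset => x /=; apply: le_lt_trans.
      by rewrite lerN2 ler_nat.
    - move=> N; rewrite (_ : I N = `]- N%:R, +oo[%classic); first exact: measurable_itv.
      by apply/seteqP; split => y /=; rewrite in_itv/= andbT.
    - by move=> N; apply/measurable_EFinP; exact: measurable_funTS measurable_f.
  have z2 : expR (t * N%:R^-1) * (expR (t * N%:R^-1) * phi + 2 * expR (- (t * N%:R)))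
      @[N --> \oo] --> (1 * (1 * phi + 2 * 0) : R).
    by apply: cvgM => //; apply: cvgD; [exact: cvgMr_tmp|exact: cvgMl_tmp].
  rewrite mulr0 addr0 !mul1r in z2.
  have z3 : (expR (t * N%:R^-1) * (expR (t * N%:R^-1) * phi + 2 * expR (- (t * N%:R))))%:E
      @[N --> \oo] --> phi%:E by apply/cvg_EFin => //; near=> N.
  apply: (lee_cvg_to z z3); near=> N; apply: Laplace_lower.
  by near: N; exact: nbhs_infty_gt.
have [I IE] : exists I, (\int[mu]_x (f x)%:E = I%:E)%E.
  exists (fine (\int[mu]_x (f x)%:E)%E); rewrite fineK// ge0_fin_numE; last first.
    by apply: integral_ge0 => x _; rewrite lee_fin.
  exact: le_lt_trans low (ltry _).
rewrite IE in low *; apply/eqP; rewrite eq_le low/= lee_fin.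
have z2 : expR (t * N%:R^-1) * (I + 2 * expR (- (t * N%:R))) + expR (- (t * N%:R)) * C
      @[N --> \oo] --> (1 * (I + 2 * 0) + 0 * C : R).
  apply: cvgD; last exact: cvgMr_tmp.
  by apply: cvgM => //; apply: cvgD; [exact: cvg_cst|exact: cvgMl_tmp].
rewrite mulr0 addr0 mul1r mul0r addr0 in z2.
apply: (ler_cvg_to (cvg_cst _) z2); near=> N.
have N0 : (0 < N)%N by near: N; exact: nbhs_infty_gt.
by have := Laplace_upper N0; rewrite IE !(=^~ EFinM, =^~ EFinD) lee_fin.
Unshelve. all: by end_near. Qed.

End LaplaceTransfer.

(** * The stable limit *)

(** A polynomial in exp(-(x + K)) close to the indicator of x > a on x >= -K. *)
Lemma exp_power_separation {R : realType} (K a b e : R) : 0 < a + K -> a < b -> 0 < e ->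
  exists m M : nat, forall x, - K <= x ->
    [/\ 0 <= (1 - expR (- (m%:R * (x + K)))) ^+ M <= 1,
        x <= a -> (1 - expR (- (m%:R * (x + K)))) ^+ M <= e &
        b <= x -> 1 - e <= (1 - expR (- (m%:R * (x + K)))) ^+ M].
Proof.
move=> aK ab e0.
(* [m] makes the ratio [ub / ua] at most c, and M is about 1/(e ua). Then M ua >= 1/e forces
   smallness to the left of a, while M ub <= c (1/e + 1) = e gives Bernoulli's bound to the right of
   b. *)
pose c := e / (e^-1 + 1); have ie0 : 0 < e^-1 by rewrite invr_gt0.
have c0 : 0 < c by rewrite divr_gt0//; lra.
have ba : 0 < b - a by rewrite subr_gt0.
pose m := (Num.truncn (c^-1 / (b - a))).+1.
have mc : expR (- (m%:R * (b - a))) <= c.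
  rewrite expRN -[leRHS]invrK lef_pV2 ?posrE ?expR_gt0 ?invr_gt0//.
  apply: le_trans (expR_ge1Dx _); apply: (@le_trans _ _ (m%:R * (b - a))); last by rewrite lerDr.
  by rewrite -ler_pdivrMr// ltW// truncnS_gt.
pose ua := expR (- (m%:R * (a + K))); pose ub := expR (- (m%:R * (b + K))).
have ua0 : 0 < ua by exact: expR_gt0.
have ub0 : 0 < ub by exact: expR_gt0.
have ua1 : ua <= 1 by rewrite /ua -expR0 ler_expR oppr_le0 mulr_ge0// ltW.
have uba : ub = expR (- (m%:R * (b - a))) * ua by rewrite -expRD; congr expR; ring.
pose M := (Num.truncn (e * ua)^-1).+1.
have M1 : e^-1 <= M%:R * ua.
  by rewrite -ler_pdivrMr// -invfM ltW// truncnS_gt.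
have M2 : M%:R * ub <= e.
  have : M%:R <= (e * ua)^-1 + 1.
    by rewrite /M -natr1 lerD2r truncn_le// invr_ge0 mulr_ge0// ltW.
  move=> /(ler_wpM2r (ltW ub0))/le_trans; apply.
  have -> : ((e * ua)^-1 + 1) * ub = expR (- (m%:R * (b - a))) * (e^-1 + ua).
    by rewrite uba; field; rewrite !gt_eqF.
  have eE : c * (e^-1 + 1) = e by rewrite divfK// gt_eqF//; lra.
  rewrite -[leRHS]eE; apply: ler_pM; [exact: expR_ge0|lra|exact: mc|].
  by rewrite lerD2l.
clearbody M; exists m, M => x Kx.
have y0 : 0 < expR (- (m%:R * (x + K))) by exact: expR_gt0.
have y1 : expR (- (m%:R * (x + K))) <= 1.
  by rewrite -expR0 ler_expR oppr_le0 mulr_ge0//; lra.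
set y := expR _ in y0 y1 *.
have y01 : 0 <= 1 - y by rewrite subr_ge0.
split.
- by rewrite exprn_ge0//= exprn_ile1//; lra.
- move=> xa; have yu : ua <= y by rewrite ler_expR lerN2 ler_wpM2l// lerD2r.
  apply: (@le_trans _ _ (expR (- y) ^+ M)).
    by apply: lerXn2r; rewrite ?nnegrE ?expR_ge0//; exact: expR_ge1Dx.
  rewrite -expRM_natl mulrN expRN invf_ple ?posrE ?expR_gt0//.
  apply: le_trans (expR_ge1Dx _); apply: (le_trans M1).
  by apply: (@le_trans _ _ (M%:R * y)); [rewrite ler_wpM2l|rewrite lerDr].
- move=> bx; have yu : y <= ub by rewrite ler_expR lerN2 ler_wpM2l// lerD2r.
  apply: (@le_trans _ _ (1 - M%:R * y)).
    by rewrite lerD2l lerN2; apply: le_trans M2; rewrite ler_wpM2l.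
  elim: M {M1 M2} => [|M IH]; first by rewrite mul0r subr0 expr0.
  rewrite exprS -natr1; apply: le_trans (ler_wpM2l y01 IH).
  have : 0 <= M%:R * y * y by rewrite !mulr_ge0// ltW.
  lra.
Qed.

(** N x and N y may diverge separately; only their sum has to converge. As ln(1 + x) = x + O(x^2),
    the condition N x^2 -> 0 is what makes the compensation exact. *)
Lemma exp_power_cvg {R : realType} (N : nat -> nat) (x y : nat -> R) (L : R) :
  x k @[k --> \oo] --> (0 : R) -> (N k)%:R * x k ^+ 2 @[k --> \oo] --> (0 : R) ->
  (N k)%:R * (x k + y k) @[k --> \oo] --> L ->
  (1 + x k) ^+ N k * expR ((N k)%:R * y k) @[k --> \oo] --> expR L.
Proof.
move=> x0 Nx2 Nxy.
have z : (N k)%:R * (ln (1 + x k) + y k) @[k --> \oo] --> L.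
  have z1 : (N k)%:R * (x k + y k) - 2 * ((N k)%:R * x k ^+ 2) @[k --> \oo] --> L - 2 * 0.
    by apply: cvgB => //; exact: cvgMl_tmp.
  rewrite mulr0 subr0 in z1.
  apply: squeeze_cvgr z1 Nxy; near=> k.
  have xk : `|x k| <= 2^-1.
    near: k; move/cvgrPdist_le : x0 => /(_ 2^-1 (ltac:(by rewrite invr_gt0))).
    by apply: filterS => k; rewrite sub0r normrN.
  move: xk; rewrite ler_norml => /andP[xk1 xk2].
  have x1 : 0 < 1 + x k by lra.
  apply/andP; split; last first.
    rewrite ler_wpM2l// lerD2r; apply: le_trans (ln_le_subr1 x1) _; lra.
  rewrite mulrCA -mulrBr ler_wpM2l//.
  have : - ln (1 + x k) <= (1 + x k)^-1 - 1.
    by rewrite -lnV ?posrE//; apply: ln_le_subr1; rewrite invr_gt0.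
  have : (1 + x k)^-1 - 1 <= - x k + 2 * x k ^+ 2.
    rewrite lerBlDr -(ler_pM2r x1) mulVf ?gt_eqF//.
    have : 0 <= x k ^+ 2 * (1 + 2 * x k) by rewrite mulr_ge0 ?sqr_ge0//; lra.
    rewrite expr2; lra.
  lra.
have z2 := cvg_comp _ _ z (@continuous_expR R L).
apply: cvg_eq_near z2; near=> k.
have xk : `|x k| <= 2^-1.
  near: k; move/cvgrPdist_le : x0 => /(_ 2^-1 (ltac:(by rewrite invr_gt0))).
  by apply: filterS => k; rewrite sub0r normrN.
have x1 : 0 < 1 + x k by move: xk; rewrite ler_norml => /andP[]; lra.
by rewrite /= mulrDr expRD expRM_natl lnK.
Unshelve. all: by end_near. Qed.

(** Since e >= 2, exp(-x) is at most 1/2 or at least 2 when x has absolute value at least 1. *)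
Lemma expRN_sub1_sqr_ge {R : realType} (x : R) : 1 <= `|x| -> 1 / 4 <= (expR (- x) - 1) ^+ 2.
Proof.
have e2 : 2 <= expR 1 :> R by exact: expR_ge1Dx.
rewrite ler_normr => /orP[x1|x1].
  have : expR (- x) <= expR (- 1) by rewrite ler_expR lerN2.
  have : expR (- 1) <= 2^-1 :> R by rewrite expRN lef_pV2 ?posrE ?expR_gt0.
  by move=> h1 h2; have := expR_gt0 (- x); move: (expR _) h1 h2 => y *; rewrite expr2; nra.
have : expR 1 <= expR (- x) by rewrite ler_expR.
by move: (expR (- x)) => y h; rewrite expr2; nra.
Qed.

Section Stable.
Context {R : realType}.
Variables (p : nat -> R) (c' beta : R).
Hypothesis rw : regular_weight p c' beta.
Hypothesis beta3 : beta < 3.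
Local Notation alpha := (beta - 1).
Local Notation nu := (Ex p (fun k => k%:R)).
Variables (N : nat -> nat) (s : nat -> R) (r : nat -> R).
Hypothesis Noo : N k @[k --> \oo] --> \oo.
Hypothesis soo : s k @[k --> \oo] --> +oo.
Hypothesis Ns : (N k)%:R * s k `^ (- alpha) @[k --> \oo] --> (1 : R).
Hypothesis r0 : r k @[k --> \oo] --> (0 : R).

Let p0 := rw_ge0 rw.
Let p1 := rw_sum1 rw.
Let Q0 n := @Qn_ge0 _ p p0 n.
Let Q1 n := @Qn_sum1 _ p p0 p1 n.
Let beta2 := rw_beta rw.
Let a0 : 0 < alpha. Proof. by have := beta2; lra. Qed.

(** The shift [r] absorbs the difference between centering at nu n and at nu (n - 1). *)
Definition centered (k : nat) (xi : {ffun 'I_(N k) -> nat}) : R :=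
  ((\sum_j xi j)%:R - nu * (N k)%:R) / s k - r k.

Let s_gt0 : \forall k \near \oo, 0 < s k.
Proof. by move/cvgryPgt : soo; apply. Qed.

Let scaled_cvgy d : 0 < d -> d * s k @[k --> \oo] --> +oo.
Proof.
move=> d0; apply/cvgryPge => A; near=> k; rewrite -ler_pdivrMl//; near: k.
by move/cvgryPge : soo; apply.
Unshelve. all: by end_near. Qed.

(** As N is equivalent to s^alpha, limits normalised by (d s)^alpha become limits normalised by the
    number of summands. *)
Lemma scaling_count d (u : nat -> R) K : 0 < d ->
  (d * s k) `^ alpha * u k @[k --> \oo] --> K ->
  (N k)%:R * u k @[k --> \oo] --> d `^ (- alpha) * K.
Proof.
move=> d0 H.
have z : (N k)%:R * s k `^ (- alpha) * (d `^ (- alpha) * ((d * s k) `^ alpha * u k))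
    @[k --> \oo] --> 1 * (d `^ (- alpha) * K).
  by apply: cvgM => //; exact: cvgMl_tmp.
rewrite mul1r in z; apply: cvg_eq_near z; near=> k.
have sk : 0 < s k by near: k.
rewrite powRM ?ltW// !powRN; field.
by rewrite !gt_eqF// powR_gt0.
Unshelve. all: by end_near. Qed.

Lemma inv_scale_cvg0 : (s k)^-1 @[k --> \oo] --> (0 : R).
Proof. by apply/gtr0_cvgV0. Qed.

(** With th = t/s, independence gives exp(t r) (1 + x)^N exp(N th nu), where 1 + x = E exp(-th xi)
    and N (x + th nu) tends to c' Gamma(-alpha) t^alpha. The quadratic correction N th^2 vanishes
    because alpha < 2. *)
Lemma centered_Laplace (t : R) : 0 < t ->
  (\forall k \near \oo, summ (@Qn _ p (N k)) (fun xi => expR (- t * @centered k xi))) /\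
  Ex (@Qn _ p (N k)) (fun xi => expR (- t * @centered k xi)) @[k --> \oo] -->
    expR (c' * GammaR (- alpha) * t `^ alpha).
Proof.
move=> t0.
pose th k := t / s k.
pose g k := Ex p (fun i => expR (- (i%:R * th k)) - 1 + i%:R * th k).
have th0 : th k @[k --> \oo] --> (t * 0 : R) by apply: cvgMl_tmp; exact: inv_scale_cvg0.
rewrite mulr0 in th0.
have ti0 : 0 < t^-1 by rewrite invr_gt0.
have Ng : (N k)%:R * g k @[k --> \oo] --> c' * GammaR (- alpha) * t `^ alpha.
  have L := Laplace_scaling rw beta3 (scaled_cvgy ti0).
  have -> : c' * GammaR (- alpha) * t `^ alpha = t^-1 `^ (- alpha) * (c' * GammaR (- alpha)).
    by rewrite -powR_inv1 ?ltW// -powRrM mulN1r opprK mulrC.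
  apply: scaling_count => //; move: L; apply: cvg_eq_near; near=> k.
  congr (_ * _); apply: eq_Ex => i; rewrite /th.
  by rewrite invfM invrK mulrA [i%:R * _]mulrC.
have Nth2 : (N k)%:R * th k ^+ 2 @[k --> \oo] --> (0 : R).
  have z : (N k)%:R * s k `^ (- alpha) * (t ^+ 2 * s k `^ (- (2 - alpha))) @[k --> \oo] -->
     (1 * (t ^+ 2 * 0) : R).
    apply: cvgM => //; apply: cvgMl_tmp; apply: powRN_cvg => //.
    by have := beta3; lra.
  rewrite mulr0 mulr0 in z; apply: cvg_eq_near z; near=> k.
  have sk : 0 < s k by near: k.
  have e1 : (s k ^+ 2)^-1 = s k `^ (- 2) by rewrite powRN powR_mulrn// ltW.
  have e2 : s k `^ (- alpha) * s k `^ (- (2 - alpha)) = s k `^ (- 2).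
    rewrite -powRD; last by rewrite (gt_eqF sk) implybT.
    by congr (_ `^ _); ring.
  by rewrite /th exprMn exprVn e1 -e2; ring.
have g0 : g k @[k --> \oo] --> (0 : R).
  have z : (N k)%:R * g k * (N k)%:R^-1 @[k --> \oo] --> c' * GammaR (- alpha) * t `^ alpha * 0.
    apply: cvgM => //; apply/gtr0_cvgV0; last by apply/cvgrnyP.
    by near=> k; rewrite ltr0n; near: k; move/cvgnyPgt : Noo; apply.
  rewrite mulr0 in z; apply: cvg_eq_near z; near=> k.
  rewrite mulrC mulKf// pnatr_eq0 -lt0n; near: k; move/cvgnyPgt : Noo; apply.
pose x k := g k - th k * nu.
have x0 : x k @[k --> \oo] --> (0 : R).
  have z : x k @[k --> \oo] --> (0 - 0 * nu : R) by apply: cvgB => //; exact: cvgMr_tmp.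
  by rewrite mul0r subr0 in z.
have Nx2 : (N k)%:R * x k ^+ 2 @[k --> \oo] --> (0 : R).
  have z : (N k)%:R * g k * g k - 2 * nu * ((N k)%:R * g k * th k) +
      nu ^+ 2 * ((N k)%:R * th k ^+ 2) @[k --> \oo] -->
     (c' * GammaR (- alpha) * t `^ alpha * 0 - 2 * nu * (c' * GammaR (- alpha) * t `^ alpha * 0)
        + nu ^+ 2 * 0 : R).
    apply: cvgD; last exact: cvgMl_tmp.
    by apply: cvgB; [exact: cvgM|apply: cvgMl_tmp; exact: cvgM].
  rewrite !mulr0 subr0 addr0 in z; apply: cvg_eq_near z; near=> k.
  by rewrite /x; ring.
have Nxy : (N k)%:R * (x k + th k * nu) @[k --> \oo] --> c' * GammaR (- alpha) * t `^ alpha.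
  by under eq_fun do rewrite /x subrK.
have E := exp_power_cvg x0 Nx2 Nxy.
have z : expR (t * r k) * ((1 + x k) ^+ N k * expR ((N k)%:R * (th k * nu))) @[k --> \oo] -->
    expR (t * 0) * expR (c' * GammaR (- alpha) * t `^ alpha).
  apply: cvgM => //.
  have h : t * r k @[k --> \oo] --> (t * 0 : R) by exact: cvgMl_tmp.
  by have := cvg_comp _ _ h (@continuous_expR R (t * 0)).
rewrite mulr0 expR0 mul1r in z.
have key k : 0 < s k -> summ (@Qn _ p (N k)) (fun xi => expR (- t * @centered k xi)) /\
    Ex (@Qn _ p (N k)) (fun xi => expR (- t * @centered k xi)) =
    expR (t * r k) * ((1 + x k) ^+ N k * expR ((N k)%:R * (th k * nu))).
  move=> sk; have thk : 0 <= th k by rewrite divr_ge0 ?ltW.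
  have se : summ p (fun i => expR (- (i%:R * th k))).
    apply: (summ_bd p0 p1 (C := 1)) => i; rewrite ger0_norm ?expR_ge0//.
    by rewrite -expR0 ler_expR oppr_le0 mulr_ge0.
  have [sE EE] := Ex_exp p0 (N k) (fun i => expR_ge0 (- (i%:R * th k))) se.
  have Ep : Ex p (fun i => expR (- (i%:R * th k))) = 1 + x k.
    have sc : summ p (fun=> 1 : R) by exact: (summ_nat p0 p1 xpredT).
    have si := summZ (th k) (summ_id rw).
    have gE : g k = Ex p (fun i => expR (- (i%:R * th k)) - 1 + th k * i%:R).
      by apply: eq_Ex => i; rewrite [X in _ - 1 + X]mulrC.
    rewrite /x gE (ExD (summB se sc) si) (ExB se sc) (Ex_cst p0 p1) ExZ; ring.
  have cE : (fun xi : {ffun 'I_(N k) -> nat} => expR (- t * centered xi)) =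
      (fun xi => expR (t * r k + (N k)%:R * (th k * nu)) * \prod_j expR (- ((xi j)%:R * th k))).
    apply/funext => xi; rewrite -expR_sum -expRD; congr expR.
    rewrite /centered natr_sum sumrN -mulr_suml /th; ring.
  rewrite cE; split; first exact: summZ.
  by rewrite ExZ EE Ep expRD; ring.
split; first by near=> k; apply: (key k _).1; near: k.
by apply: cvg_eq_near z; near=> k; rewrite (key k _).2//; near: k.
Unshelve. all: by end_near. Qed.

Section Truncation.
Variable d : R.
Hypothesis d0 : 0 < d.
Let ex k (i : nat) : R := Num.max (i%:R / s k - d) 0.
Let mex k := Ex p (ex k).

Let exE k i : 0 < s k -> ex k i = d * Num.max (i%:R / (d * s k) - 1) 0.
Proof.
move=> sk; rewrite /ex maxr_pMr ?ltW// mulr0 mulrBr mulr1; congr (Num.max (_ - _) _).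
by field; rewrite !gt_eqF.
Qed.

Let ex_ge0 k i : 0 <= ex k i. Proof. by rewrite /ex le_max lexx orbT. Qed.

Let ex_summ : \forall k \near \oo, summ p (ex k).
Proof.
have [h _] := excess_scaling rw (scaled_cvgy d0).
near=> k; have sk : 0 < s k by near: k.
have : summ p (fun i => Num.max (i%:R / (d * s k) - 1) 0) by near: k.
by move=> /(summZ d); congr (summ p _); apply/funext => i; rewrite exE.
Unshelve. all: by end_near. Qed.

Lemma truncated_mean_cvg : exists kap : R, (N k)%:R * mex k @[k --> \oo] --> kap.
Proof.
have [_ [K HK]] := excess_scaling rw (scaled_cvgy d0).
exists (d * (d `^ (- alpha) * K)).
have z := cvgMl_tmp (a := d) (scaling_count d0 HK).
apply: cvg_eq_near (z _); near=> k; have sk : 0 < s k by near: k.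
rewrite /mex (_ : ex k = fun i => d * Num.max (i%:R / (d * s k) - 1) 0).
  by rewrite ExZ mulrCA.
by apply/funext => i; rewrite exE.
Unshelve. all: by end_near. Qed.

(** Up to the vanishing shift [r], [centered] splits into the centered sum of the excesses
    over d, which is bounded from below, and the centered sum of the entries cut at d, whose
    variance is of order d^(2 - alpha). *)
Definition truncated k (xi : {ffun 'I_(N k) -> nat}) : R := \sum_j ex k (xi j) - (N k)%:R * mex k.

Lemma truncated_ge k (xi : {ffun 'I_(N k) -> nat}) : - ((N k)%:R * mex k) <= truncated xi.
Proof. by rewrite lerDr; apply: sumr_ge0. Qed.

(** Entries at most d s have no excess, so each summand contributes a defect q of order 1/N: (1 -
    q)^N with N q convergent, a compound Poisson limit. *)
Lemma truncated_Laplace (t : R) : 0 <= t -> exists l : R,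
  Ex (@Qn _ p (N k)) (fun xi => expR (- (t * @truncated k xi))) @[k --> \oo] --> l.
Proof.
move=> t0.
have td : 0 <= t * d by rewrite mulr_ge0// ltW.
have [K HK] := excess_exp_scaling rw td (scaled_cvgy d0).
pose q k := Ex p (fun i => 1 - expR (- (t * d * Num.max (i%:R / (d * s k) - 1) 0))).
have Hq : (N k)%:R * q k @[k --> \oo] --> d `^ (- alpha) * K := scaling_count d0 HK.
have [kap Hk] := truncated_mean_cvg.
have se k : summ p (fun i => expR (- (t * d * Num.max (i%:R / (d * s k) - 1) 0))).
  apply: (summ_bd p0 p1 (C := 1)) => i; rewrite ger0_norm ?expR_ge0//.
  by rewrite -expR0 ler_expR oppr_le0 mulr_ge0// le_max lexx orbT.
have qE k : Ex p (fun i => expR (- (t * d * Num.max (i%:R / (d * s k) - 1) 0))) = 1 - q k.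
  have sc : summ p (fun=> 1 : R) by exact: (summ_nat p0 p1 xpredT).
  by rewrite /q (ExB sc (se k)) (Ex_cst p0 p1) opprB addrC subrK.
have q01 k : 0 <= q k <= 1.
  have h : 0 <= 1 - q k by rewrite -qE; apply: Ex_ge0 => // i; exact: expR_ge0.
  apply/andP; split; last by rewrite -subr_ge0.
  apply: Ex_ge0 => // i.
  by rewrite subr_ge0 -expR0 ler_expR oppr_le0 mulr_ge0// le_max lexx orbT.
have z := one_minus_pow_cvg Noo q01 Hq.
have z1 : (1 - q k) ^+ N k * expR (t * ((N k)%:R * mex k)) @[k --> \oo] -->
    expR (- (d `^ (- alpha) * K)) * expR (t * kap).
  apply: cvgM => //.
  have h : t * ((N k)%:R * mex k) @[k --> \oo] --> t * kap by exact: cvgMl_tmp.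
  by have := cvg_comp _ _ h (@continuous_expR R (t * kap)).
exists (expR (- (d `^ (- alpha) * K)) * expR (t * kap)); apply: cvg_eq_near z1.
near=> k; have sk : 0 < s k by near: k.
have [_ EE] := Ex_exp p0 (N k) (fun i => expR_ge0 _) (se k).
rewrite -qE -EE mulrC -ExZ; apply: eq_Ex => xi.
rewrite -expR_sum -expRD; congr expR; rewrite /truncated sumrN.
have -> : \sum_i t * d * Num.max ((xi i)%:R / (d * s k) - 1) 0 = t * \sum_j ex k (xi j).
  by rewrite mulr_sumr; apply: eq_bigr => j _; rewrite exE// mulrA.
ring.
Unshelve. all: by end_near. Qed.

Lemma truncated_power_cvg (K : R) (m M : nat) :
  (\forall k \near \oo, forall xi, 0 <= @truncated k xi + K) ->
  exists l : R, Ex (@Qn _ p (N k))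
    (fun xi => (1 - expR (- (m%:R * (@truncated k xi + K)))) ^+ M) @[k --> \oo] --> l.
Proof.
move=> HK; have {}HK : \forall k \near \oo, forall t, 0 <= t ->
    forall xi, 0 <= t * (@truncated k xi + K).
  by apply: filterS HK => k h t t0 xi; rewrite mulr_ge0.
have sm (k : nat) (t : R) (l : nat) :
    (forall t, 0 <= t -> forall xi, 0 <= t * (@truncated k xi + K)) -> 0 <= t ->
    summ (@Qn _ p (N k)) (fun xi => expR (- (t * (@truncated k xi + K))) *
      (1 - expR (- (m%:R * (@truncated k xi + K)))) ^+ l).
  move=> h t0; apply: (summ_bd (@Q0 _) (@Q1 _) (C := 1)) => xi.
  have e1 u : 0 <= u -> expR (- (u * (@truncated k xi + K))) <= 1.
    by move=> u0; rewrite -expR0 ler_expR oppr_le0 h.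
  have y0 : 0 <= 1 - expR (- (m%:R * (@truncated k xi + K))) by rewrite subr_ge0 e1.
  rewrite ger0_norm; last by rewrite mulr_ge0 ?expR_ge0// exprn_ge0.
  rewrite mulr_ile1 ?expR_ge0 ?exprn_ge0 ?e1// exprn_ile1// lerBlDr lerDl expR_ge0//.
(* One more factor 1 - exp(-m (A + K)) splits the expectation into those with parameters t and t +
   m. Carrying the prefactor exp(-t (A + K)) therefore reduces the power to Laplace transforms by
   induction. *)
suff : forall l (t : R), 0 <= t -> exists L : R, Ex (@Qn _ p (N k))
    (fun xi => expR (- (t * (@truncated k xi + K))) *
      (1 - expR (- (m%:R * (@truncated k xi + K)))) ^+ l) @[k --> \oo] --> L.
  move=> /(_ M 0 (lexx _))[L HL]; exists L; apply: cvg_eq_near HL; near=> k.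
  by apply: eq_Ex => xi; rewrite mul0r oppr0 expR0 mul1r.
elim=> [|l IH] t t0.
  have [L HL] := truncated_Laplace t0.
  exists (expR (- (t * K)) * L); have z := cvgMl_tmp (a := expR (- (t * K))) HL.
  apply: cvg_eq_near (z _); near=> k.
  rewrite -ExZ; apply: eq_Ex => xi; rewrite expr0 mulr1 -expRD; congr expR; ring.
have [L1 H1] := IH t t0; have tm : 0 <= t + m%:R by rewrite addr_ge0.
have [L2 H2] := IH _ tm.
exists (L1 - L2).
have z : Ex (@Qn _ p (N k)) (fun xi => expR (- (t * (@truncated k xi + K))) *
      (1 - expR (- (m%:R * (@truncated k xi + K)))) ^+ l) -
    Ex (@Qn _ p (N k)) (fun xi => expR (- ((t + m%:R) * (@truncated k xi + K))) *
      (1 - expR (- (m%:R * (@truncated k xi + K)))) ^+ l) @[k --> \oo] --> L1 - L2.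
  by apply: cvgB.
apply: cvg_eq_near z; near=> k.
have h : forall t, 0 <= t -> forall xi, 0 <= t * (@truncated k xi + K) by near: k.
rewrite -[LHS](ExB (sm _ _ l h t0) (sm _ _ l h tm)); apply: eq_Ex => xi.
rewrite exprS (_ : expR (- ((t + m%:R) * (truncated xi + K))) =
  expR (- (t * (truncated xi + K))) * expR (- (m%:R * (truncated xi + K)))); first by ring.
by rewrite -expRD; congr expR; ring.
Unshelve. all: by end_near. Qed.

End Truncation.

Section Fluctuation.
Variable d : R.
Hypothesis d0 : 0 < d.
Let mn k (i : nat) : R := Num.min (i%:R / s k) d.

Definition fluctuation k (xi : {ffun 'I_(N k) -> nat}) : R := \sum_j (mn k (xi j) - Ex p (mn k)).

Let mn_ge0 k i : 0 < s k -> 0 <= mn k i.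
Proof. by move=> sk; rewrite /mn le_min (ltW d0) andbT divr_ge0// ltW. Qed.

Let mn_summ k : 0 < s k -> summ p (mn k).
Proof.
move=> sk; apply: (summ_bd p0 p1 (C := d)) => i.
by rewrite ger0_norm ?mn_ge0// /mn ge_min lexx orbT.
Qed.

Lemma centered_decomposition : \forall k \near \oo, forall xi,
  @centered k xi = truncated d xi + fluctuation xi - r k.
Proof.
have [h _] := excess_scaling rw (scaled_cvgy d0).
near=> k => xi; have sk : 0 < s k by near: k.
have se : summ p (fun i => Num.max (i%:R / s k - d) 0).
  have : summ p (fun i => Num.max (i%:R / (d * s k) - 1) 0) by near: k.
  move=> /(summZ d); congr (summ p _); apply/funext => i.
  rewrite maxr_pMr ?ltW// mulr0 mulrBr mulr1; congr (Num.max (_ - _) _).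
  by field; rewrite !gt_eqF.
have split_ i : i%:R / s k = Num.max (i%:R / s k - d) 0 + mn k i.
  rewrite /mn; have [h1|h1] := leP (i%:R / s k) d.
    by rewrite max_r ?add0r// subr_le0.
  by rewrite max_l ?subrK// subr_ge0 ltW.
have nuE : nu / s k = Ex p (fun i => Num.max (i%:R / s k - d) 0) + Ex p (mn k).
  rewrite -(ExD se (mn_summ sk)) mulrC -ExZ; apply: eq_Ex => i.
  by rewrite mulrC; exact: split_.
rewrite /centered /truncated /fluctuation mulrBl -mulrA [(N k)%:R / _]mulrC mulrA nuE.
rewrite natr_sum mulr_suml (eq_bigr _ (fun j _ => split_ (xi j))) big_split/= sumrB.
by rewrite sumr_const card_ord -mulr_natl; ring.
Unshelve. all: by end_near. Qed.

Hypothesis d2 : d <= 2^-1.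

Let v k := 2 * ((N k)%:R * Ex p (fun i => mn k i ^+ 2)).

(** Centered cut entries lie in [-d, d], within the reach of [expR_le_sqr] as d <= 1/2; the linear
    term has mean 0, and the quadratic one is bounded by the second moment. *)
Lemma fluctuation_exp k (sg : R) : 0 < s k -> `|sg| = 1 ->
  summ (@Qn _ p (N k)) (fun xi => expR (sg * fluctuation xi)) /\
  Ex (@Qn _ p (N k)) (fun xi => expR (sg * fluctuation xi)) <= expR (v k).
Proof.
move=> sk sg1.
have smn := mn_summ sk.
have scst (C : R) : summ p (fun=> C).
  by apply: (summ_bd p0 p1 (C := `|C|)).
have smn2 : summ p (fun i => mn k i ^+ 2).
  apply: (summ_bd p0 p1 (C := d ^+ 2)) => i; rewrite ger0_norm ?sqr_ge0//.
  by apply: lerXn2r; rewrite ?nnegrE; [exact: mn_ge0|exact: ltW|rewrite /mn ge_min lexx orbT].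
set e := Ex p (mn k).
have e0 : 0 <= e by apply: Ex_ge0 => // i; exact: mn_ge0.
have ed : e <= d.
  rewrite -(Ex_cst p0 p1 d); apply: Ex_le => // i.
  by rewrite /mn ge_min lexx orbT.
have fd i : `|sg * (mn k i - e)| <= 2^-1.
  rewrite normrM sg1 mul1r; apply: le_trans d2; rewrite ler_norml.
  have := mn_ge0 i sk; have : mn k i <= d by rewrite /mn ge_min lexx orbT.
  lra.
have sexp : summ p (fun i => expR (sg * (mn k i - e))).
  apply: (summ_bd p0 p1 (C := expR 2^-1)) => i.
  by rewrite ger0_norm ?expR_ge0// ler_expR (le_trans (ler_norm _))// fd.
have [sE EE] := Ex_exp p0 (N k) (fun i => expR_ge0 (sg * (mn k i - e))) sexp.
have cE : (fun xi : {ffun 'I_(N k) -> nat} => expR (sg * fluctuation xi)) =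
    (fun xi => \prod_j expR (sg * (mn k (xi j) - e))).
  by apply/funext => xi; rewrite -expR_sum /fluctuation mulr_sumr.
rewrite cE; split => //; rewrite EE.
have sg2 : sg ^+ 2 = 1 by rewrite -real_normK ?num_real// sg1 expr1n.
have sA : summ p (fun i => 1 + sg * (mn k i - e)).
  exact: summD (scst 1) (summZ sg (summB smn (scst e))).
have sq : summ p (fun i => mn k i ^+ 2 - 2 * e * mn k i + e ^+ 2).
  exact: summD (summB smn2 (summZ _ smn)) (scst _).
have h : Ex p (fun i => expR (sg * (mn k i - e))) <= expR (2 * Ex p (fun i => mn k i ^+ 2)).
  apply: (@le_trans _ _ (Ex p (fun i => 1 + sg * (mn k i - e) +
     2 * (mn k i ^+ 2 - 2 * e * mn k i + e ^+ 2)))).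
    apply: Ex_le => //; first exact: summD sA (summZ _ sq).
    move=> i; have := expR_le_sqr (le_trans (ler_norm _) (fd i)).
    by have -> : mn k i ^+ 2 - 2 * e * mn k i + e ^+ 2 = (sg * (mn k i - e)) ^+ 2;
      first by rewrite exprMn sg2; ring.
  rewrite (ExD sA (summZ 2 sq)) (ExD (scst 1) (summZ sg (summB smn (scst e)))) !ExZ.
  rewrite (ExB smn (scst e)) !(Ex_cst p0 p1) (ExD (summB smn2 (summZ _ smn)) (scst _)).
  rewrite (ExB smn2 (summZ _ smn)) ExZ (Ex_cst p0 p1) -/e subrr mulr0 addr0.
  apply: le_trans (expR_ge1Dx _); rewrite lerD2l ler_wpM2l//.
  have := sqr_ge0 e; rewrite expr2; lra.
have -> : expR (v k) = expR (2 * Ex p (fun i => mn k i ^+ 2)) ^+ N k.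
  by rewrite -expRM_natl; congr expR; rewrite /v; ring.
apply: lerXn2r; rewrite ?nnegrE ?expR_ge0//.
by apply: Ex_ge0 => // i; exact: expR_ge0.
Qed.

(** Chebyshev's inequality, the variance being bounded through exponential moments, which factor
    over the coordinates: x^2 <= 4 (exp x + exp(-x) - 2). *)
Lemma fluctuation_tail k (g : R) : 0 < s k -> 0 < g ->
  Prq (@Qn _ p (N k)) (fun xi => g < `|fluctuation xi|) <= 8 / g ^+ 2 * (expR (v k) - 1).
Proof.
move=> sk g0.
have [s1 h1] := @fluctuation_exp k 1 sk (normr1 _).
have [s2 h2] := @fluctuation_exp k (-1) sk (normrN1 _).
have sq (x : R) : x ^+ 2 <= 4 * (expR x + expR (- x) - 2).
  wlog x0 : x / 0 <= x => [hw|].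
    have [|x0] := leP 0 x; first exact: hw.
    by have := hw (- x); rewrite sqrrN opprK [_ (- x) + _]addrC; apply; rewrite oppr_ge0 ltW.
  have -> : expR x + expR (- x) - 2 = (expR (x / 2) - expR (- (x / 2))) ^+ 2.
    have e1 : 2 * (x / 2) = x by field.
    have e2 : 2 * - (x / 2) = - x by field.
    by rewrite sqrrB -!expRM_natl -expRD subrr expR0 e1 e2; ring.
  have : x / 2 <= expR (x / 2) - expR (- (x / 2)).
    have := expR_ge1Dx (x / 2).
    have : expR (- (x / 2)) <= 1 by rewrite -expR0 ler_expR oppr_le0 divr_ge0.
    lra.
  have x20 : 0 <= x / 2 by rewrite divr_ge0.
  move=> h; have : (x / 2) ^+ 2 <= (expR (x / 2) - expR (- (x / 2))) ^+ 2.
    by apply: lerXn2r => //; rewrite nnegrE//; apply: le_trans h.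
  by rewrite expr_div_n; lra.
have sc : summ (@Qn _ p (N k)) (fun=> 2 : R).
  by apply: (summ_bd (@Q0 _) (@Q1 _) (C := 2)) => xi; rewrite ger0_norm.
have sS := summB (summD s1 s2) sc.
apply: (@le_trans _ _ (Ex (@Qn _ p (N k)) (fun xi => 4 / g ^+ 2 *
   (expR (1 * fluctuation xi) + expR (-1 * fluctuation xi) - 2)))).
  apply: Prq_markov => //; first exact: summZ.
  move=> xi; rewrite mul1r mulN1r mulrAC ler_pdivlMr ?exprn_gt0//.
  have [h|h] := ltP g; last first.
    by rewrite mul0r; apply: le_trans (sq _); exact: sqr_ge0.
  rewrite mul1r; apply: le_trans (sq _); rewrite -[leRHS]real_normK ?num_real//.
  by apply: lerXn2r; rewrite ?nnegrE; [exact: ltW|exact: normr_ge0|exact: ltW].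
rewrite ExZ (ExB (summD s1 s2) sc) (ExD s1 s2) (Ex_cst (@Q0 _) (@Q1 _)).
have : 0 <= 4 / g ^+ 2 by rewrite divr_ge0// sqr_ge0.
move=> /ler_wpM2l h; apply: le_trans (h _ (2 * (expR (v k) - 1)) _) _; first lra.
by rewrite le_eqVlt; apply/orP; left; apply/eqP; field; rewrite gt_eqF.
Qed.

End Fluctuation.

(** The exponent of [fluctuation_exp] tends to 2 K d^(2 - alpha), which is small with d because
    alpha < 2. *)
Lemma fluctuation_small (g eta : R) : 0 < g -> 0 < eta -> exists2 d : R, 0 < d &
  \forall k \near \oo,
    Prq (@Qn _ p (N k)) (fun xi => g < `|fluctuation d xi|) <= eta.
Proof.
move=> g0 eta0; have [K HK] := min_sqr_scaling rw beta3.
have a2 : 0 < 2 - alpha by have := beta3; lra.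
(* Chosen so that 8/g^2 times exp(v0) - 1 equals eta. *)
pose v0 := ln (1 + eta * g ^+ 2 / 8).
have u0 : 0 < eta * g ^+ 2 / 8 by rewrite divr_gt0// mulr_gt0// exprn_gt0.
have v00 : 0 < v0 by rewrite ln_gt0// ltrDl.
pose d1 := (v0 / (2 * (`|K| + 1))) `^ (2 - alpha)^-1.
have K1 : 0 < 2 * (`|K| + 1) by have := normr_ge0 K; lra.
have d10 : 0 < d1 by rewrite powR_gt0// divr_gt0.
have d0 : 0 < Num.min 2^-1 d1 by rewrite lt_min invr_gt0 ltr0n d10.
exists (Num.min 2^-1 d1) => //; set d := Num.min 2^-1 d1 in d0 *.
have dE : d `^ (2 - alpha) <= v0 / (2 * (`|K| + 1)).
  have d1E : d1 `^ (2 - alpha) = v0 / (2 * (`|K| + 1)).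
    by rewrite /d1 -powRrM mulVf ?gt_eqF// powRr1// ltW// divr_gt0.
  rewrite -d1E; apply: ge0_ler_powR; rewrite ?nnegrE; [exact: ltW..|].
  by rewrite /d ge_min lexx orbT.
have d2 : d <= 2^-1 by rewrite /d ge_min lexx.
clearbody d.
have Hv : 2 * ((N k)%:R * Ex p (fun i => Num.min (i%:R / s k) d ^+ 2)) @[k --> \oo] -->
    2 * (d ^+ 2 * (d `^ (- alpha) * K)).
  apply: cvgMl_tmp; have z := cvgMl_tmp (a := d ^+ 2) (scaling_count d0 (HK _ (scaled_cvgy d0))).
  apply: cvg_eq_near (z _); near=> k; have sk : 0 < s k by near: k.
  rewrite mulrCA; congr (_ * _); rewrite -ExZ; apply: eq_Ex => i.
  rewrite -exprMn minr_pMr ?ltW// mulr1; congr (Num.min _ _ ^+ 2).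
  by field; rewrite !gt_eqF.
have lim_lt : 2 * (d ^+ 2 * (d `^ (- alpha) * K)) < v0.
  have -> : d ^+ 2 * (d `^ (- alpha) * K) = d `^ (2 - alpha) * K.
    rewrite mulrA -powR_mulrn ?ltW// -powRD//.
    by rewrite (gt_eqF d0) implybT.
  have p0' : 0 <= d `^ (2 - alpha) by exact: powR_ge0.
  apply: (@le_lt_trans _ _ (2 * (v0 / (2 * (`|K| + 1)) * `|K|))).
    rewrite ler_pM2l//; apply: (@le_trans _ _ (d `^ (2 - alpha) * `|K|)).
      by rewrite ler_wpM2l// ler_norm.
    by rewrite ler_wpM2r.
  have -> : 2 * (v0 / (2 * (`|K| + 1)) * `|K|) = v0 * (`|K| / (`|K| + 1)).
    by field; rewrite gt_eqF//; have := normr_ge0 K; lra.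
  rewrite gtr_pMr// ltr_pdivrMr ?mul1r ?ltrDl//; have := normr_ge0 K; lra.
have Hle : \forall k \near \oo,
    2 * ((N k)%:R * Ex p (fun i => Num.min (i%:R / s k) d ^+ 2)) <= v0 := cvgr_le _ Hv _ lim_lt.
near=> k; have sk : 0 < s k by near: k.
apply: le_trans (fluctuation_tail d0 d2 sk g0) _.
have : 2 * ((N k)%:R * Ex p (fun i => Num.min (i%:R / s k) d ^+ 2)) <= v0 by near: k; exact: Hle.
rewrite -ler_expR /v0 lnK ?posrE; last by lra.
rewrite -lerBlDl => h.
apply: (@le_trans _ _ (8 / g ^+ 2 * (eta * g ^+ 2 / 8))).
  by rewrite ler_wpM2l// divr_ge0// sqr_ge0.
by rewrite le_eqVlt; apply/orP; left; apply/eqP; field; rewrite gt_eqF.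
Unshelve. all: by end_near. Qed.

(** One number serves both levels: l = 1 - L, with L the limiting expectation of a function of the
    truncated sum that is near 0 below a' and near 1 above b'. *)
Lemma centered_oscillation (a b eta : R) : a < b -> 0 < eta -> exists l : R,
  (\forall k \near \oo, Prq (@Qn _ p (N k)) (fun xi => @centered k xi <= a) <= l + eta) /\
  (\forall k \near \oo, l - eta <= Prq (@Qn _ p (N k)) (fun xi => @centered k xi <= b)).
Proof.
move=> ab eta0.
(* Of five equal parts of [a, b], two at each end absorb the fluctuation and [r]; the middle one
   separates a' from b'. *)
pose g := (b - a) / 5; have g0 : 0 < g by rewrite /g; lra.
pose e := eta / 4; have e0 : 0 < e by rewrite divr_gt0.
have [d d0 Hfl] := fluctuation_small g0 e0.
have [kap Hkap] := truncated_mean_cvg d0.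
pose a' := a + 2 * g; pose b' := b - 2 * g.
have ab' : a' < b' by rewrite /a' /b' /g; lra.
pose K := `|kap| + 1 + `|a'|.
have K0 : 0 < a' + K by rewrite /K; have := ler_norm (- a'); have := normr_ge0 kap; rewrite normrN; lra.
have kapK : kap < K by rewrite /K; have := ler_norm kap; have := normr_ge0 a'; lra.
have HK : \forall k \near \oo, (N k)%:R * Ex p (fun i => Num.max (i%:R / s k - d) 0) <= K :=
  cvgr_le _ Hkap _ kapK.
have [m [M sep]] := exp_power_separation K0 ab' e0.
have Hpos : \forall k \near \oo, forall xi, 0 <= @truncated d k xi + K.
  near=> k => xi; have : (N k)%:R * Ex p (fun i => Num.max (i%:R / s k - d) 0) <= K by near: k; exact: HK.
  by have := truncated_ge d xi; move: (truncated d xi) => x; lra.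
have [L HL] := truncated_power_cvg d0 m M Hpos.
have dec := centered_decomposition d0.
have rg : \forall k \near \oo, `|r k| <= g.
  by move/cvgrPdist_le : r0 => /(_ _ g0); apply: filterS => k; rewrite sub0r normrN.
pose pw k (xi : {ffun 'I_(N k) -> nat}) := (1 - expR (- (m%:R * (truncated d xi + K)))) ^+ M.
have sP k : (forall xi : {ffun 'I_(N k) -> nat}, 0 <= truncated d xi + K) ->
    summ (@Qn _ p (N k)) (@pw k).
  move=> h; apply: (summ_bd (@Q0 _) (@Q1 _) (C := 1)) => xi.
  have [|/andP[h1 h2] _ _] := sep (truncated d xi); first by have := h xi; lra.
  by rewrite ger0_norm.
have scst k (C : R) : summ (@Qn _ p (N k)) (fun=> C).
  by apply: (summ_bd (@Q0 _) (@Q1 _) (C := `|C|)).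
have HL1 : \forall k \near \oo, `|L - Ex (@Qn _ p (N k)) (@pw k)| <= e.
  by move/cvgrPdist_le : HL => /(_ _ e0).
exists (1 - L).
have H : \forall k \near \oo,
    Prq (@Qn _ p (N k)) (fun xi => @centered k xi <= a) <= 1 - L + eta /\
    1 - L - eta <= Prq (@Qn _ p (N k)) (fun xi => @centered k xi <= b).
  near=> k.
  have hp : forall xi : {ffun 'I_(N k) -> nat}, 0 <= truncated d xi + K by near: k.
  have hd : forall xi, @centered k xi = truncated d xi + fluctuation d xi - r k by near: k.
  have hr : `|r k| <= g by near: k.
  have hL : `|L - Ex (@Qn _ p (N k)) (@pw k)| <= e by near: k.
  have hf : Prq (@Qn _ p (N k)) (fun xi => g < `|fluctuation d xi|) <= e by near: k.
  have h1 : Prq (@Qn _ p (N k)) (fun xi => @centered k xi <= a) <=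
      Prq (@Qn _ p (N k)) (fun xi => truncated d xi <= a') +
      Prq (@Qn _ p (N k)) (fun xi => g < `|fluctuation d xi|).
    apply: (Prq_union (@Q0 _) (@Q1 _)) => xi; rewrite hd => h.
    have [fg|] := leP `|fluctuation d xi| g; last by rewrite orbT.
    rewrite orbF /a'; move: fg hr h; rewrite !ler_norml => /andP[? ?] /andP[? ?]; lra.
  have h2 : Prq (@Qn _ p (N k)) (fun xi => truncated d xi <= a') <=
      1 - Ex (@Qn _ p (N k)) (@pw k) + e.
    rewrite -[X in X - _](Ex_cst (@Q0 (N k)) (@Q1 (N k)) 1) -[X in _ + X](Ex_cst (@Q0 (N k)) (@Q1 (N k)) e).
    rewrite -(ExB (scst k 1) (sP _ hp)) -(ExD (summB (scst k 1) (sP _ hp)) (scst k e)).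
    apply: Ex_le => //; [exact: (summ_nat (@Q0 _) (@Q1 _))|exact: summD (summB (scst k 1) (sP _ hp)) (scst k e)|].
    move=> xi; have [|/andP[u0 u1] us _] := sep (truncated d xi); first by have := hp xi; lra.
    by rewrite /pw; have [/us|_] := leP (truncated d xi) a' => /=; lra.
  have h3 : Prq (@Qn _ p (N k)) (fun xi => truncated d xi <= b') <=
      Prq (@Qn _ p (N k)) (fun xi => @centered k xi <= b) +
      Prq (@Qn _ p (N k)) (fun xi => g < `|fluctuation d xi|).
    apply: (Prq_union (@Q0 _) (@Q1 _)) => xi; rewrite hd => h.
    have [fg|] := leP `|fluctuation d xi| g; last by rewrite orbT.
    rewrite orbF; move: fg hr h; rewrite /b' !ler_norml => /andP[? ?] /andP[? ?]; lra.
  have h4 : 1 - Ex (@Qn _ p (N k)) (@pw k) <=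
      Prq (@Qn _ p (N k)) (fun xi => truncated d xi <= b') + e.
    rewrite -[X in X - _](Ex_cst (@Q0 (N k)) (@Q1 (N k)) 1) -[X in _ <= _ + X](Ex_cst (@Q0 (N k)) (@Q1 (N k)) e).
    have sn := summ_nat (@Q0 (N k)) (@Q1 (N k)) (fun xi => truncated d xi <= b').
    rewrite -(ExB (scst k 1) (sP _ hp)) -(ExD sn (scst k e)).
    apply: Ex_le => //; [exact: summB (scst k 1) (sP _ hp)|exact: summD sn (scst k e)|].
    move=> xi; have [|/andP[u0 u1] _ us] := sep (truncated d xi); first by have := hp xi; lra.
    by rewrite /pw; have [_|/ltW/us] := leP (truncated d xi) b' => /=; lra.
  move: hL; rewrite ler_norml /e => /andP[? ?].
  rewrite /e in h1 h2 h3 h4 hf *; split; lra.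
by split; apply: filterS H => k [].
Unshelve. all: by end_near. Qed.

(** E (exp(-t X) - 1)^2 = L(2t) - 2 L(t) + 1 is small for small t. *)
Lemma centered_tight (eta : R) : 0 < eta -> exists B : R,
  (\forall k \near \oo, Prq (@Qn _ p (N k)) (fun xi => @centered k xi <= - B) <= eta) /\
  (\forall k \near \oo, 1 - eta <= Prq (@Qn _ p (N k)) (fun xi => @centered k xi <= B)).
Proof.
move=> eta0; pose G := c' * GammaR (- alpha).
(* Both Laplace transforms end up within 2e of 1, and 4 (2e + 4e) = 24 e is below eta. *)
pose e := eta / 32; have e0 : 0 < e by rewrite divr_gt0.
have lim0 (C : R) : expR (C * y `^ (- alpha)) @[y --> +oo] --> (1 : R).
  have z : C * y `^ (- alpha) @[y --> +oo] --> (C * 0 : R).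
    by apply: cvgMl_tmp; exact: powRN_cvgy.
  by rewrite mulr0 in z; have := cvg_comp _ _ z (@continuous_expR R 0); rewrite expR0.
have [B [B0 [h1 h2]]] : exists B : R, 0 < B /\ `|1 - expR (G * B^-1 `^ alpha)| <= e /\
    `|1 - expR (G * (2 * B^-1) `^ alpha)| <= e.
  have /cvgrPdist_le/(_ _ e0) l1 := lim0 G.
  have /cvgrPdist_le/(_ _ e0) l2 := lim0 (G * 2 `^ alpha).
  near (pinfty_nbhs R) => B; exists B.
  have B0 : 0 < B by near: B; exact: nbhs_pinfty_gt.
  have e1 : B^-1 `^ alpha = B `^ (- alpha) by rewrite -powR_inv1 ?ltW// -powRrM mulN1r.
  have e2 : (2 * B^-1) `^ alpha = 2 `^ alpha * B `^ (- alpha).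
    by rewrite -e1 powRM// invr_ge0 ltW.
  by rewrite e1 e2 mulrA; split => //; split; near: B.
exists B; set t := B^-1 in h1 h2 *; have t0 : 0 < t by rewrite invr_gt0.
have tB : t * B = 1 by rewrite mulVf// gt_eqF.
have [s1 c1] := centered_Laplace t0.
have t20 : 0 < 2 * t by rewrite mulr_gt0.
have [s2 c2] := centered_Laplace t20.
rewrite -/G in c1 c2.
have b1 : \forall k \near \oo, `|expR (G * t `^ alpha) -
    Ex (@Qn _ p (N k)) (fun xi => expR (- t * @centered k xi))| <= e.
  by move/cvgrPdist_le : c1 => /(_ _ e0).
have b2 : \forall k \near \oo, `|expR (G * (2 * t) `^ alpha) -
    Ex (@Qn _ p (N k)) (fun xi => expR (- (2 * t) * @centered k xi))| <= e.
  by move/cvgrPdist_le : c2 => /(_ _ e0).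
have key (k : nat) (A : pred {ffun 'I_(N k) -> nat}) :
    summ (@Qn _ p (N k)) (fun xi => expR (- t * @centered k xi)) ->
    summ (@Qn _ p (N k)) (fun xi => expR (- (2 * t) * @centered k xi)) ->
    `|expR (G * t `^ alpha) - Ex (@Qn _ p (N k)) (fun xi => expR (- t * @centered k xi))| <= e ->
    `|expR (G * (2 * t) `^ alpha) - Ex (@Qn _ p (N k)) (fun xi => expR (- (2 * t) * @centered k xi))| <= e ->
    (forall xi, A xi -> 1 <= `|t * @centered k xi|) ->
    Prq (@Qn _ p (N k)) A <= eta.
  move=> sa sb ha hb hA.
  have sc : summ (@Qn _ p (N k)) (fun=> 1 : R) by exact: (summ_nat (@Q0 _) (@Q1 _) xpredT).
  have sS := summD (summB sb (summZ 2 sa)) sc.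
  apply: (@le_trans _ _ (Ex (@Qn _ p (N k)) (fun xi => 4 * (expR (- (2 * t) * @centered k xi) -
      2 * expR (- t * @centered k xi) + 1)))).
    apply: Prq_markov => //; first exact: summZ.
    move=> xi; have -> : expR (- (2 * t) * centered xi) - 2 * expR (- t * centered xi) + 1 =
        (expR (- t * centered xi) - 1) ^+ 2.
      rewrite sqrrB -expRM_natl mulr1 expr1n mulr_natl; congr (expR _ - _ + _); ring.
    case: (boolP (A xi)) => [/hA/expRN_sub1_sqr_ge|_]; last by rewrite mulr_ge0// sqr_ge0.
    by rewrite -mulNr ler_pdivrMr// [_ * 4]mulrC.
  rewrite ExZ (ExD (summB sb (summZ 2 sa)) sc) (ExB sb (summZ 2 sa)) ExZ (Ex_cst (@Q0 _) (@Q1 _)).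
  move: (Ex _ _) (Ex _ _) (expR _) (expR _) ha hb h1 h2 => x y z u.
  rewrite !ler_norml /e; clear c1 c2 b1 b2 s1 s2 lim0 => /andP[? ?] /andP[? ?] /andP[? ?] /andP[? ?]; lra.
split; near=> k.
- apply: key; [near: k; exact: s1|near: k; exact: s2|near: k; exact: b1|near: k; exact: b2|move=> xi xB].
  rewrite ler_normr; apply/orP; right.
  by rewrite -mulrN -[leLHS]tB ler_wpM2l ?(ltW t0)// lerNr.
- rewrite lerBlDr addrC -lerBlDr -(PrqC (@Q0 _) (@Q1 _)).
  apply: key; [near: k; exact: s1|near: k; exact: s2|near: k; exact: b1|near: k; exact: b2|move=> xi; rewrite -ltNge => /ltW xB].
  by rewrite ler_normr -[X in X <= _]tB ler_wpM2l// (ltW t0).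
Unshelve. all: by end_near. Qed.

Theorem stable_limit : exists mu : probability R R,
  (forall t : R, 0 <= t ->
     (\int[mu]_x (expR (- t * x))%:E)%E = (expR (c' * GammaR (- alpha) * t `^ alpha))%:E) /\
  forall x, {for x, continuous (prob_cdf mu)} ->
    Prq (@Qn _ p (N k)) (fun xi => @centered k xi <= x) @[k --> \oo] --> prob_cdf mu x.
Proof.
pose G k x := Prq (@Qn _ p (N k)) (fun xi => @centered k xi <= x).
have G0 k x : 0 <= G k x by exact: Prq_ge0.
have G1 k x : G k x <= 1 by apply: Prq_le1.
have Gle k x y : x <= y -> G k x <= G k y.
  by move=> xy; apply: Prq_le => // xi /le_trans; apply.
have [mu [up lo cdfE]] := weak_limit G0 G1 Gle centered_oscillation centered_tight.
exists mu; split; last exact: cdf_squeeze_cvg.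
move=> t; rewrite le_eqVlt => /orP[/eqP <-|t0].
  rewrite powR0 ?gt_eqF// mulr0 expR0.
  under eq_integral do rewrite oppr0 mul0r expR0.
  by rewrite integral_cst//= probability_setT mule1.
have [s1 c1] := centered_Laplace t0.
have t20 : 0 < 2 * t by rewrite mulr_gt0.
have [s2 c2] := centered_Laplace t20.
(* Convergence at 2t supplies the uniform bound that controls exp(-t x) far to the left. *)
have b2 := cvgr_le _ c2 (expR (c' * GammaR (- alpha) * (2 * t) `^ alpha) + 1) (ltac:(lra)).
exact: (@Laplace_limit R (fun k => {ffun 'I_(N k) -> nat}) (fun k => @Qn _ p (N k))
  centered (fun k => @Q0 (N k)) (fun k => @Q1 (N k)) mu up lo cdfE t _ _ t0 s1 s2 c1 b2).
Qed.

End Stable.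

(** * Fluctuations of the largest box *)

Section LargestBox.
Context {R : realType}.
Variables (w : nat -> R) (c beta : R).
Hypothesis w0 : forall k, 0 <= w k.
Hypothesis c0 : 0 < c.
Hypothesis beta2 : 2 < beta.
Hypothesis wlim : (fun k => w k / (c * (k%:R : R) `^ (- beta))) @ \oo --> (1 : R).
Hypothesis beta3 : beta < 3.
Local Notation p := (pw w).
Local Notation c' := (c / Phi1 w).
Local Notation alpha := (beta - 1).
Local Notation nu := (Ex p (fun k => k%:R)).
Variables (lam : R) (mm nn : nat -> nat).
Hypothesis nulam : nu < lam.
Hypothesis noo : (fun k => ((nn k)%:R : R)) @ \oo --> +oo.
Hypothesis mlam : (fun k => ((mm k)%:R : R) / (nn k)%:R) @ \oo --> lam.

Let p0 k : 0 <= p k := pw_ge0 w0 c0 beta2 wlim k.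
Let p1 := pw_sum1 w0 c0 beta2 wlim.
Let Q0 N := @Qn_ge0 _ p p0 N.
Let Q1 N := @Qn_sum1 _ p p0 p1 N.
Let rw := regular_pw w0 c0 beta2 wlim.
Let Noo := predn_cvgy noo.
Let a0 : 0 < alpha. Proof. by have := beta2; lra. Qed.
Let sc k : R := (nn k)%:R `^ alpha^-1.
Let soo : sc k @[k --> \oo] --> +oo := scale_cvgy beta2 noo.
Let X := @centered R p (fun k => (nn k).-1) sc (fun k => nu / sc k).

Let Ns : (nn k).-1%:R * sc k `^ (- alpha) @[k --> \oo] --> (1 : R).
Proof.
have z := pred_nn_ratio noo; apply: cvg_eq_near z; near=> k.
have n0 : 0 < ((nn k)%:R : R) by near: k; move/cvgryPgt : noo; apply.
by rewrite powRN -[sc k `^ alpha]powRrM mulVf ?(gt_eqF a0)// powRr1// ltW.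
Unshelve. all: by end_near. Qed.

Let r0 : nu / sc k @[k --> \oo] --> (0 : R).
Proof.
have z : nu / sc k @[k --> \oo] --> (nu * 0 : R).
  by apply: cvgMl_tmp; exact: inv_scale_cvg0.
by rewrite mulr0 in z.
Qed.

Lemma centered_largest : \forall k \near \oo, forall xi : {ffun 'I_(nn k).-1 -> nat},
  ((mm k)%:R - nu * (nn k)%:R - @istat R 1 (@xivec (mm k) (nn k).-1.+1 xi)) / sc k = X xi.
Proof.
near=> k => xi.
have n0 : (0 < nn k)%N by rewrite -(ltr0n R); near: k; move/cvgryPgt : noo; apply.
rewrite istat1_xivec /X /centered.
have -> : ((nn k)%:R : R) = (nn k).-1%:R + 1 by rewrite natr1 prednK.
ring.
Unshelve. all: by end_near. Qed.

Lemma largest_bdd : bdd_prob (fun k => BBprob w (mm k) (nn k))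
  (fun k s => ((ordstat s 1)%:R - ((mm k)%:R - nu * (nn k)%:R)) / sc k).
Proof.
(* Three contributions of e/4: the two tails of the centered sum and the total variation error. *)
move=> e e0; have e4 : 0 < e / 4 by rewrite divr_gt0.
have [B [h1 h2]] := centered_tight rw beta3 Noo soo Ns r0 e4; exists B.
have T := transfer w0 c0 beta2 wlim nulam noo mlam 1 e4.
have cl := centered_largest.
near=> k.
have clk : forall xi : {ffun 'I_(nn k).-1 -> nat},
  ((mm k)%:R - nu * (nn k)%:R - @istat R 1 (@xivec (mm k) (nn k).-1.+1 xi)) / sc k = X xi by near: k.
have h1k : Prq (@Qn _ p (nn k).-1) (fun xi => X xi <= - B) <= e / 4 by near: k; exact: h1.
have h2k : 1 - e / 4 <= Prq (@Qn _ p (nn k).-1) (fun xi => X xi <= B) by near: k; exact: h2.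
have : forall A : pred R, `|BBprob w (mm k) (nn k) (fun s => A (ordstat s 1)%:R) -
    Prq (@Qn _ p (nn k).-1) (fun xi => A (@istat R 1 (@xivec (mm k) (nn k).-1.+1 xi)))| <= e / 4.
  by near: k.
move=> /(_ (fun y => B < `|(y - ((mm k)%:R - nu * (nn k)%:R)) / sc k|)).
have : Prq (@Qn _ p (nn k).-1) (fun xi => B <
     `|(@istat R 1 (@xivec (mm k) (nn k).-1.+1 xi) - ((mm k)%:R - nu * (nn k)%:R)) / sc k|) <=
    Prq (@Qn _ p (nn k).-1) (fun xi => X xi <= - B) +
    Prq (@Qn _ p (nn k).-1) (fun xi => ~~ (X xi <= B)).
  apply: (Prq_union (@Q0 _) (@Q1 _)) => xi.
  rewrite -normrN -mulNr opprB clk lter_normr -ltNge => /orP[->|]; first by rewrite orbT.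
  by rewrite ltrNr => /ltW ->.
rewrite (PrqC (@Q0 _) (@Q1 _)) => h3; rewrite ler_norml => /andP[h4 h5].
move: h5 h3 h1k h2k; rewrite /=.
move: (BBprob _ _ _ _) (Prq _ _) (Prq _ _) (Prq _ _) => x y z u; lra.
Unshelve. all: by end_near. Qed.

Lemma largest_stable : exists mu : probability R R,
  (forall t : R, 0 <= t ->
     (\int[mu]_x (expR (- t * x))%:E)%E = (expR (c' * GammaR (- alpha) * t `^ alpha))%:E) /\
  cvg_dist (fun k => BBprob w (mm k) (nn k))
    (fun k s => ((mm k)%:R - nu * (nn k)%:R - (ordstat s 1)%:R) / sc k) (prob_cdf mu).
Proof.
have [mu [hL hc]] := stable_limit rw beta3 Noo soo Ns r0.
exists mu; split => // x cx.
apply: (@transfer_cvg _ w c beta w0 c0 beta2 wlim lam mm nn nulam noo mlam 1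
  (fun k y => ((mm k)%:R - nu * (nn k)%:R - y) / sc k <= x)).
have cl := centered_largest; apply: cvg_eq_near (hc x cx); near=> k.
have clk : forall xi : {ffun 'I_(nn k).-1 -> nat},
  ((mm k)%:R - nu * (nn k)%:R - @istat R 1 (@xivec (mm k) (nn k).-1.+1 xi)) / sc k = X xi by near: k.
by apply: eq_Prq => xi; rewrite clk.
Unshelve. all: by end_near. Qed.

End LargestBox.

Theorem theorem18p33 (R : realType) (w : nat -> R) (c beta : R) :
  (forall k, 0 <= w k) -> 0 < c -> 2 < beta ->
  (* w_k ~ c k^{-beta} *)
  (fun k => w k / (c * (k%:R : R) `^ (- beta))) @ \oo --> (1 : R) ->
  (* nu = Psi(1) := lim_{t -> 1-} Psi(t) exists and is finite *)
  exists nu : R, (Psi w t @[t --> at_left (1 : R)] --> nu) /\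
  forall (lam : R) (mm nn : nat -> nat),
    nu < lam ->
    ((fun k => ((nn k)%:R : R)) @ \oo --> +oo) ->
    ((fun k => ((mm k)%:R : R) / (nn k)%:R) @ \oo --> lam) ->
    (\forall k \near \oo, 0 < Zmn w (mm k) (nn k)) ->
    let alpha := beta - 1 in
    let c' := c / Phi1 w in
    let P := fun k => BBprob w (mm k) (nn k) in
    let Y := fun (j : nat) (s : seq nat) => ((ordstat s j)%:R : R) in
    let n := fun k => ((nn k)%:R : R) in
    let m := fun k => ((mm k)%:R : R) in
    let sc := fun k => n k `^ alpha^-1 in
    [/\ (* (i) *)
        cvg_prob0 P (fun k s => (Y 1%N s - (lam - nu) * n k) / n k) /\
        cvg_prob0 P (fun k s => Y 2%N s / n k),
        (* (ii) *)
        (fun k => Zmn w (mm k) (nn k) /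
           (c * (lam - nu) `^ (- beta) * Phi1 w ^+ (nn k).-1 * n k `^ (1 - beta)))
          @ \oo --> (1 : R),
        (* (iii) total variation distance -> 0 *)
        (forall eps : R, 0 < eps -> \forall k \near \oo,
           forall A : pred (seq int),
             `| P k (fun s => A (ordvec s)) - Qxi w (mm k) (nn k) A | <= eps),
        (* (iv), in the regime 2 < beta < 3 where X_alpha is defined *)
        (beta < 3 ->
           bdd_prob P (fun k s => (Y 1%N s - (m k - nu * n k)) / sc k) /\
           exists mu : probability R R,
             (forall t : R, 0 <= t ->
                (\int[mu]_x (expR (- t * x))%:E)%E
                  = (expR (c' * GammaR (- alpha) * t `^ alpha))%:E) /\
             cvg_dist P (fun k s => (m k - nu * n k - Y 1%N s) / sc k) (prob_cdf mu))
      & (* (v) *)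
        (bdd_prob P (fun k s => Y 2%N s / sc k) /\
        cvg_dist P (fun k s => Y 2%N s / sc k) (FrechetCDF c' alpha)) /\
        (* (vi) *)
        forall j : nat, (2 <= j)%N ->
          [/\ bdd_prob P (fun k s => Y j s / sc k),
              cvg_dist P (fun k s => Y j s / sc k) (WjCDF c' alpha j)
            & forall y : R, 0 <= y ->
                Rintegral lebesgue_measure
                  [set x : R | 0 < x /\ c' / alpha * x `^ (- alpha) <= y]
                  (Wdens c' alpha j)
                = Rintegral lebesgue_measure [set t : R | 0 <= t <= y]
                  (@GammaDens R j)]].
Proof.
move=> w0 c0 beta2 wlim.
exists (Ex (pw w) (fun k => k%:R)); split; first exact: Psi_at_left1 wlim.
move=> lam mm nn nulam noo mlam _ alpha c' P Y n m sc.
have stat j : (1 < j)%N -> bdd_prob P (fun k s => Y j s / sc k) /\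
    cvg_dist P (fun k s => Y j s / sc k) (WjCDF c' alpha j).
  by move=> j2; split; [exact: (order_stat_bdd w0 c0 beta2 wlim nulam noo mlam j2)|
    exact: (order_stat_dist w0 c0 beta2 wlim nulam noo mlam j2)].
have a1 : 1 < alpha by rewrite /alpha; lra.
have c'0 : 0 < c' := rw_c_gt0 (regular_pw w0 c0 beta2 wlim).
split.
- by split; [exact: (first_order1 w0 c0 beta2 wlim nulam noo mlam)|
    exact: (first_order2 w0 c0 beta2 wlim nulam noo mlam)].
- exact: (Zmn_asymptotics w0 c0 beta2 wlim nulam noo mlam).
- exact: (total_variation w0 c0 beta2 wlim nulam noo mlam).
- move=> beta3; split; first exact: (largest_bdd w0 c0 beta2 wlim beta3 nulam noo mlam).
  exact: (largest_stable w0 c0 beta2 wlim beta3 nulam noo mlam).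
- split.
    (* The Frechet law is the case j = 2, the Poisson probability of no exceedance. *)
    rewrite (_ : FrechetCDF c' alpha = WjCDF c' alpha 2); first exact: stat.
    by apply/funext => x; exact: (FrechetCDF_WjCDF c'0 a1).
  move=> j j2; have [h1 h2] := stat j j2; split => // y y0.
  exact: (Rintegral_Wdens_Gamma c'0 a1).
Qed.
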